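(* Let $\mathcal{H}$ be a complex Hilbert space and let $[0,+\infty[\,\ni t\mapsto S(t)\in\mathcal{L}(\mathcal{H},\mathcal{H})$ be a strongly continuous semigroup with $S(0)=I$ and generator $A$. Let $\omega\in\mathbb{R}$ and assume that $\|(z-A)^{-1}\|$ is uniformly bounded in the half-plane $\{z\in\mathbb{C}:\operatorname{Re} z\ge\omega\}$ (in particular this half-plane is contained in the resolvent set of $A$). Let $m:[0,+\infty[\to\,]0,+\infty[$ be a continuous positive function with $m(t)\ge\|S(t)\|$ for all $t\ge 0$. Let $\widetilde\omega<\omega$ and assume that $A$ has no spectrum on the line $\operatorname{Re} z=\widetilde\omega$ and that $\sigma_+(A):=\{z\in\sigma(A):\operatorname{Re} z>\widetilde\omega\}$ is compact (and included in the strip $\widetilde\omega<\operatorname{Re} z<\omega$). Assume that, for any neighborhood $U$ of $\sigma_+(A)$, $\|(z-A)^{-1}\|$ is uniformly bounded on $\{z\in\mathbb{C}:\operatorname{Re} z\ge\widetilde\omega\}\setminus U$. Define $r(\widetilde\omega)$ by $$\frac{1}{r(\widetilde\omega)}=\sup_{\operatorname{Re} z=\widetilde\omega}\|(z-A)^{-1}\|.$$ Let $\Pi_+$ be the spectral projection associated to $\sigma_+(A)$. Then for every $t>0$, $$S(t)=S(t)\Pi_++R(t)=S(t)\Pi_++S(t)(1-\Pi_+),$$ where $R(t)=S(t)(1-\Pi_+)$ satisfies, for all $a,\widetilde a>0$ with $a+\widetilde a=t$, $$\|R(t)\|\le\frac{e^{\widetilde\omega t}}{r(\widetilde\omega)\,\left\|\frac1m\right\|_{e^{-\widetilde\omega\cdot}L^2([0,a])}\,\left\|\frac1m\right\|_{e^{-\widetilde\omega\cdot}L^2([0,\widetilde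 a])}}\,\|I-\Pi_+\|.$$
   Context: All operator norms are those of $\mathcal{L}(\mathcal{H},\mathcal{H})$; $\sigma(A)$ is the spectrum of $A$. The spectral projection associated to $\sigma_+(A)$ is $$\Pi_+=\frac{1}{2\pi i}\int_{\partial V}(z-A)^{-1}\,dz,$$ where $V\subset\mathbb{C}$ is any compact neighborhood of $\sigma_+(A)$ with $C^1$ boundary (positively oriented), disjoint from $\sigma(A)\setminus\sigma_+(A)$. For $\omega'\in\mathbb{R}$, $b>0$ and a function $f$ on $[0,b]$, the exponentially weighted norm is $$\|f\|_{e^{-\omega'\cdot}L^2([0,b])}=\|e^{\omega'\cdot}f(\cdot)\|_{L^2([0,b])}=\left(\int_0^b e^{2\omega' s}|f(s)|^2\,ds\right)^{1/2}.$$ *)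

(* Defs.v *)
From HB Require Import structures.
From mathcomp Require Import all_boot all_order all_algebra.
From mathcomp Require Import complex sesquilinear.
From mathcomp Require Import all_classical all_reals all_analysis.

Set Implicit Arguments.
Unset Strict Implicit.
Unset Printing Implicit Defensive.

Import Order.TTheory GRing.Theory Num.Theory.
Import numFieldNormedType.Exports.

Local Open Scope classical_set_scope.
Local Open Scope complex_scope.
Local Open Scope ring_scope.

(* Subsets of the complex plane have type [set R[i]^o]: in MathComp-Analysis
   it is [R[i]^o], and not [R[i]], that carries the topology of the modulus. *)

Section Operators.
Context {R : realType} {H : completeNormedModType R[i]}.
Implicit Types (A : set (H * H)) (z : R[i]).

(* [H] is a Hilbert space for the inner product [dot] (linear in its first
   argument); completeness is part of the type of [H]. *)
Definition norm_of_dot (dot : {dot H for Num.conj}) : Prop :=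
  forall x : H, dot x x = `|x| ^+ 2.

(* Norms in [H] are elements of [R[i]] with zero imaginary part. The value is
   [+oo] exactly when [T] is unbounded on the unit ball. *)
Definition opnorm (T : H -> H) : \bar R :=
  ereal_sup [set (complex.Re `|T x|)%:E | x in [set x : H | `|x| <= 1]].

(* The values at negative times play no role. *)
Definition C0_semigroup (S : R -> {linear H -> H}) : Prop :=
  [/\ forall t, 0 <= t -> continuous (S t),
      forall x, S 0 x = x,
      forall s t x, 0 <= s -> 0 <= t -> S (s + t) x = S s (S t x)
    & forall x, {within `[0, +oo[, continuous (fun t : R => S t x : H)}].

(* An unbounded operator [A] is given by its graph: [A (x, y)] means that [x]
   is in the domain of [A] and [A x = y]. *)
Definition generator (S : R -> {linear H -> H}) : set (H * H) :=
  [set p | (fun h : R => (h^-1)%:C *: (S h p.1 - p.1)) @ 0^'+ --> p.2].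

(* [(z - A) x = y] reads [A (x, z *: x - y)]; hence the graph of [T] below is
   that of the inverse of the bijection [z - A] from the domain of [A] to
   [H]. *)
Definition resolvent_set A : set R[i]^o :=
  [set z : R[i]^o | exists T : {linear H -> H},
     continuous T /\ forall x y, T y = x <-> A (x, z *: x - y)].

Definition spectrum A : set R[i]^o := ~` resolvent_set A.

(* Equal to [(z - A)^-1] when [z] is in the resolvent set. *)
Definition resolvent A z (y : H) : H :=
  xget 0 [set x | A (x, z *: x - y)].

Definition resolvent_bounded_on A (D : set R[i]^o) : Prop :=
  exists M : R, forall z, D z ->
    resolvent_set A z /\ (opnorm (resolvent A z) <= M%:E)%E.

End Operators.

Section Contours.
Context {R : realType}.
Implicit Types g : R -> R[i].

Definition velocity g (t : R) : R[i] :=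
  derive1 (fun s => complex.Re (g s)) t +i*
  derive1 (fun s => complex.Im (g s)) t.

(* Regular closed curves of class C^1, as 1-periodic functions. *)
Definition C1_closed_curve g : Prop :=
  [/\ forall t, g (t + 1) = g t,
      forall t, derivable (fun s => complex.Re (g s)) t 1 /\
                derivable (fun s => complex.Im (g s)) t 1,
      continuous (fun t => complex.Re (velocity g t)),
      continuous (fun t => complex.Im (velocity g t))
    & forall t, velocity g t != 0].

Definition contour_integral n (g : 'I_n -> R -> R[i]) (f : R[i] -> R[i]) :
    R[i] :=
  \sum_(j < n)
    ((\int[lebesgue_measure]_(t in `[0, 1])
        complex.Re (f (g j t) * velocity (g j) t)) +i*
     (\int[lebesgue_measure]_(t in `[0, 1])
        complex.Im (f (g j t) * velocity (g j) t))).

Definition two_pi_i : R[i] := (2 * pi) *i.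

(* The boundary of [V] is the disjoint union of the simple closed C^1 curves
   [g j]. The orientation is fixed as usual in the holomorphic functional
   calculus: the index of the cycle is 1 at interior points of [V] and 0 at
   points outside [V]. *)
Definition oriented_C1_boundary (V : set R[i]^o) n (g : 'I_n -> R -> R[i]) :
    Prop :=
  [/\ forall j, C1_closed_curve (g j),
      forall i j s t, 0 <= s < 1 -> 0 <= t < 1 -> g i s = g j t ->
        i = j /\ s = t,
      \bigcup_(j in [set: 'I_n]) [set g j t | t in [set t | 0 <= t < 1]] =
        closure V `\` V°,
      forall w, V° w -> contour_integral g (fun z => (z - w)^-1) = two_pi_i
    & forall w, ~ V w -> contour_integral g (fun z => (z - w)^-1) = 0].

End Contours.

(* [P] is the spectral projection of [A] for the part [K] of its spectrum. The
   operator-valued contour integral is a weak (Pettis) integral: by Riesz,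
   testing against all vectors [y] is testing against the dual of [H]. The
   existential quantifier is harmless, since the integral does not depend on
   the choice of [V]. *)
Definition spectral_projection (R : realType) (H : completeNormedModType R[i])
    (dot : {dot H for Num.conj}) (A : set (H * H)) (K : set R[i]^o)
    (P : {linear H -> H}) : Prop :=
  continuous P /\
  exists (V : set R[i]^o) (n : nat) (g : 'I_n -> R -> R[i]),
    [/\ compact V, K `<=` V°, V `&` (spectrum A `\` K) = set0,
        oriented_C1_boundary V g
      & forall x y : H, dot (P x) y =
          two_pi_i^-1 * contour_integral g (fun z => dot (resolvent A z x) y)].

(* The norm of [f] in $e^{-w\cdot} L^2([0,b])$. *)
Definition weighted_L2norm (R : realType) (w b : R) (f : R -> R) : R :=
  Num.sqrt (\int[lebesgue_measure]_(s in `[0, b])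
              (expR (2 * w * s) * `|f s| ^+ 2)).

(* Main.v *)
From HB Require Import structures.
From mathcomp Require Import all_boot all_order all_algebra.
From mathcomp Require Import complex sesquilinear ring lra.
From mathcomp Require Import all_classical all_reals all_analysis
  measurable_realfun.
Require Import Defs.

Set Implicit Arguments.
Unset Strict Implicit.
Unset Printing Implicit Defensive.

Import Order.TTheory GRing.Theory Num.Theory.
Import numFieldNormedType.Exports.

Local Open Scope classical_set_scope.
Local Open Scope complex_scope.
Local Open Scope ring_scope.

(** The theorem rests on Parseval's identity. Let y lie in the range of 1 - P and
let chi be a cutoff that rises from 0 to 1 on [0, a]. The function
u(s) = chi(s) S(s) y solves u' = A u + chi' S(s) y. If e^(- w' s) u is square
integrable, a Fourier transform turns the equation into
u^(z) = (z - A)^-1 v^(z) on the line Re z = w', where v = chi' S(.) y, so that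
the weighted norm of u is at most that of v divided by r. The bound m on the
semigroup controls v, and the best profile of chi gives
|| y || / || 1/m ||_[0,a] (cutoff_estimate, energy_tail). In the other direction
|| S(t) y || <= m(t - s) || S(s) y || for a <= s <= t, and integrating in s yields
the second factor || 1/m ||_[0,a'] (energy_lower_bound).

Vectors in H are integrated weakly, through the Riesz representation. Instead of
a Fourier transform on the line, the orbit is cut off again on [b, b + 1] and
expanded in a Fourier series on [0, b + 1], with Bessel's inequality for v and
Fejer's theorem for u (fourier_multiplier). The second cutoff costs the energy of
the orbit on [b, b + 1], which is negligible for a suitable b when the total
energy is finite.

It remains to see that e^(- w' s) S(s) y is square integrable. This is a statement
of Gearhart-Pruss type on the range of 1 - P, where z - A has a bounded inverse
for all z with Re z >= w': away from K by hypothesis, and near K because the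
contour integral of (z - A)^-1 / (zeta - z) inverts zeta - A up to P and the
winding number of the contour (contour_op_left_inverse, kernel_lower_bound). With
the exponent w in place of w', the orbits are square integrable when w is large.
The cutoff estimate then bounds their energy by D || y || ^ 2, with D independent
of w in a bounded range, and an argument of Datko converts this bound into
integrability for the exponent w - 1 / (4 D). Finitely many steps reach w'
(energy_bounded_down).

These arguments take place on the kernel of P, so P must be idempotent. Only one
contour is available, so that the usual computation with two nested contours is
replaced by the following one. The Cauchy-type integrals inside and outside the
contour, together with the resolvent on the contour, solve
(zeta - A) f = P x - P (P x) for every complex zeta. Then f is entire and vanishes
at infinity, hence it is zero by Liouville's theorem
(contour_projection_idempotent). Liouville's theorem is in turn derived from a
maximum principle for functions with a second-order Taylor expansion (liouville). *)

(** * Integrals of real functions on compact intervals *)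

Section RealIntegrals.
Context {R : realType}.
Implicit Types (f g F : R -> R) (a b c : R).

Definition Rint a b f : R := \int[lebesgue_measure]_(s in `[a, b]) f s.

(** Measurable and bounded on bounded sets. Such functions are integrable on
every compact interval, form an algebra, and may jump, as the derivative of the
cutoff below does. *)
Definition lbm f := measurable_fun setT f /\
  forall a b, exists M, forall s, a <= s <= b -> `|f s| <= M.

Lemma continuous_lbm f : continuous f -> lbm f.
Proof.
move=> cf; split; first exact: continuous_measurable_fun.
move=> a b; have [ab|ba] := leP a b; last first.
  by exists 0 => s /andP[sa sb]; move: (le_trans sa sb); rewrite leNgt ba.
have [M0 [_ hM]] := compact_bounded (continuous_compact (A := `[a, b])
  (continuous_subspaceT cf) (@segment_compact _ a b)).
exists (M0 + 1) => s hs; apply: (hM (M0 + 1)); first by rewrite ltrDl.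
by exists s => //=; rewrite in_itv.
Qed.

Lemma lbm_cst c : lbm (fun=> c).
Proof. by apply: continuous_lbm; exact: cst_continuous. Qed.

Lemma lbmD f g : lbm f -> lbm g -> lbm (fun s => f s + g s).
Proof.
move=> [mf bf] [mg bg]; split; first exact: measurable_funD.
move=> a b; have [M hM] := bf a b; have [N hN] := bg a b.
exists (M + N) => s hs; rewrite (le_trans (ler_normD _ _))// lerD ?hM ?hN//.
Qed.

Lemma lbmM f g : lbm f -> lbm g -> lbm (fun s => f s * g s).
Proof.
move=> [mf bf] [mg bg]; split; first exact: measurable_funM.
move=> a b; have [M hM] := bf a b; have [N hN] := bg a b.
by exists (M * N) => s hs; rewrite normrM ler_pM ?hM ?hN.
Qed.

Lemma lbmN f : lbm f -> lbm (fun s => - f s).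
Proof.
move=> /(lbmM (lbm_cst (-1))); congr lbm.
by apply/funext => s; rewrite mulN1r.
Qed.

Lemma lbmB f g : lbm f -> lbm g -> lbm (fun s => f s - g s).
Proof. by move=> hf /lbmN; exact: lbmD. Qed.

Lemma lbm_ite (A : R -> bool) f g : measurable [set s | A s] ->
  lbm f -> lbm g -> lbm (fun s => if A s then f s else g s).
Proof.
move=> mA [mf bf] [mg bg]; split.
  apply: measurable_fun_ifT => //.
  apply: (@measurable_fun_bool _ _ _ _ true) => //.
  by rewrite setTI; move: mA; congr measurable; apply/seteqP; split => x /=.
move=> a b; have [M hM] := bf a b; have [N hN] := bg a b.
exists (Num.max M N) => s hs.
by case: ifP => _; rewrite le_max ?hM ?hN// orbT.
Qed.

Lemma lbm_integrable a b f : lbm f ->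
  lebesgue_measure.-integrable `[a, b] (EFin \o f).
Proof.
move=> [mf bf]; have [M hM] := bf a b.
apply: measurable_bounded_integrable => //.
- have -> : (lebesgue_measure `[a, b]%classic < +oo :> \bar R)%E.
    by rewrite lebesgue_measure_itv/=; case: ifP => _; rewrite -?EFinB ltry.
  by [].
- exact: measurable_funS mf.
- exists M; split; first exact: num_real.
  move=> N MN s /=; rewrite in_itv/= => hs.
  by rewrite (le_trans (hM _ hs))// ltW.
Qed.

Lemma eq_Rint a b f g : (forall s, a <= s <= b -> f s = g s) ->
  Rint a b f = Rint a b g.
Proof.
move=> h; apply: eq_Rintegral => s; rewrite inE/= in_itv/=; exact: h.
Qed.

Lemma RintD a b f g : lbm f -> lbm g ->
  Rint a b (fun s => f s + g s) = Rint a b f + Rint a b g.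
Proof. by move=> hf hg; apply: RintegralD => //; exact: lbm_integrable. Qed.

Lemma RintZ a b k f : lbm f -> Rint a b (fun s => k * f s) = k * Rint a b f.
Proof. by move=> hf; apply: RintegralZl => //; exact: lbm_integrable. Qed.

Lemma RintN a b f : lbm f -> Rint a b (fun s => - f s) = - Rint a b f.
Proof.
by move=> hf; rewrite -mulN1r -RintZ//; apply: eq_Rint => s _; rewrite mulN1r.
Qed.

Lemma RintB a b f g : lbm f -> lbm g ->
  Rint a b (fun s => f s - g s) = Rint a b f - Rint a b g.
Proof. by move=> hf hg; rewrite RintD ?RintN//; exact: lbmN. Qed.

Lemma eq_Rint_oc a b f g : lbm f -> lbm g ->
  (forall s, a < s <= b -> f s = g s) -> Rint a b f = Rint a b g.
Proof.
move=> hf hg h; rewrite /Rint -!Rintegral_itv_obnd_cbnd; last 2 first.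
- apply: integrableS (lbm_integrable a b hg) => //.
  by apply: subset_itvr; rewrite bnd_simp.
- apply: integrableS (lbm_integrable a b hf) => //.
  by apply: subset_itvr; rewrite bnd_simp.
by apply: eq_Rintegral => s; rewrite inE/= in_itv/=; exact: h.
Qed.

Lemma le_Rint a b f g : lbm f -> lbm g ->
  (forall s, a <= s <= b -> f s <= g s) -> Rint a b f <= Rint a b g.
Proof.
move=> hf hg h; apply: le_Rintegral; [by []|exact: lbm_integrable..|].
by move=> s /=; rewrite in_itv/=; exact: h.
Qed.

Lemma Rint_ge0 a b f : (forall s, a <= s <= b -> 0 <= f s) -> 0 <= Rint a b f.
Proof. by move=> h; apply: Rintegral_ge0 => s /=; rewrite in_itv/=; exact: h. Qed.

Lemma Rint_cst a b c : a <= b -> Rint a b (fun=> c) = c * (b - a).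
Proof.
move=> ab; rewrite /Rint Rintegral_cst//; congr (_ * _).
apply: (congr1 fine (y := (b - a)%:E)).
etransitivity; first exact: lebesgue_measure_itv.
rewrite /= lte_fin.
by case: ltgtP ab => // -> _; rewrite subrr.
Qed.

Lemma Rint_cat a b c f : lbm f -> a <= b -> b <= c ->
  Rint a c f = Rint a b f + Rint b c f.
Proof.
move=> hf ab bc; apply/eqP; rewrite -subr_eq0 opprD addrA.
rewrite /Rint (@Rintegral_itvB _ f (BLeft a) (BRight c) b)//; last first.
- exact: lbm_integrable.
rewrite Rintegral_itv_obnd_cbnd ?subrr//.
apply: integrableS (lbm_integrable b c hf) => //.
by apply: subset_itvr; rewrite bnd_simp.
Qed.

Lemma Rint_le_cst a b f M : a <= b -> lbm f ->
  (forall s, a <= s <= b -> f s <= M) -> Rint a b f <= M * (b - a).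
Proof.
by move=> ab hf h; rewrite -Rint_cst//; apply: le_Rint => //; exact: lbm_cst.
Qed.

Lemma continuous_antiderivative f : continuous f ->
  exists F, forall x, is_derive x (1 : R) F (f x).
Proof.
move=> cf; have hf := continuous_lbm cf.
pose F x := Rint 0 x f - Rint x 0 f.
have FE u x : u <= 0 -> u <= x -> F x = Rint u x f - Rint u 0 f.
  move=> u0 ux; rewrite /F; have [x0|/ltW x0] := leP 0 x.
    rewrite (Rint_cat hf u0 x0) addrAC subrr add0r.
    have [->|xn0] := eqVneq x 0; first by rewrite subrr;
      rewrite /Rint set_itv1 Rintegral_set1.
    rewrite [X in _ - X](_ : _ = 0) ?subr0// /Rint set_itv_ge ?Rintegral_set0//.
    by rewrite bnd_simp -ltNge lt_neqAle eq_sym xn0.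
  rewrite (Rint_cat hf ux x0) opprD addrA subrr add0r.
  have [->|xn0] := eqVneq x 0; first by rewrite subrr;
    rewrite /Rint set_itv1 Rintegral_set1 oppr0.
  rewrite [X in X - _](_ : _ = 0) ?add0r// /Rint set_itv_ge ?Rintegral_set0//.
  by rewrite bnd_simp -ltNge lt_neqAle xn0.
exists F => x.
pose u := Num.min x 0 - 1.
have ux : u < x by rewrite /u ltrBlDr ltr_pwDr// ge_min lexx.
have u0 : u < 0 by rewrite /u subr_lt0 gt_min ltr01 orbT.
have [|dF F'] := @continuous_FTC1_closed R f u x (x
  + 1) _ (lbm_integrable _ _ hf) ux (cf x).
  by rewrite ltrDl.
have /derivableP := dF; rewrite -derive1E F' => dF1.
have dF2 : is_derive x (1 : R) (fun y => Rint u y f - Rint u 0 f) (f x).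
  by rewrite -[f x]subr0; apply: is_deriveB.
apply: near_eq_is_derive dF2.
near=> y; rewrite (FE u)//; first exact: ltW.
by apply/ltW; near: y; exact: lt_nbhsr.
Unshelve. all: by end_near.
Qed.

Lemma is_derive_continuous F (f : R -> R) :
  (forall x, is_derive x (1 : R) F (f x)) -> continuous F.
Proof.
move=> dF x; apply/differentiable_continuous/derivable1_diffP.
by have [] := dF x.
Qed.

Lemma FTC2 F f a b : a <= b -> continuous f ->
  (forall x, a < x < b -> is_derive x (1 : R) F (f x)) -> continuous F ->
  Rint a b f = F b - F a.
Proof.
rewrite le_eqVlt => /predU1P[->|ab] cf dF cF.
  by rewrite /Rint set_itv1 Rintegral_set1 subrr.
rewrite /Rint /Rintegral (@continuous_FTC2 _ f F)//.
- exact: continuous_subspaceT.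
- split.
  + by move=> x; rewrite in_itv/= => /dF[].
  + exact: cvg_at_right_filter (cF a).
  + exact: cvg_at_left_filter (cF b).
- by move=> x; rewrite in_itv/= => /dF h; rewrite derive1E derive_val.
Qed.

End RealIntegrals.

(** * Real norms and complex integrals *)

Section RealNorm.
Context {R : realType} {V : normedZmodType R[i]}.
Implicit Types x y : V.

(** Norms in spaces over R[i] are complex numbers with zero imaginary part; nm is
the real number behind them. *)
Definition nm x : R := complex.Re `|x|.

Lemma nmE x : `|x| = (nm x)%:C.
Proof. by rewrite /nm RRe_real// ger0_real. Qed.

Lemma nm_ge0 x : 0 <= nm x.
Proof. by rewrite -ler0c -nmE. Qed.

Lemma nm0 : nm (0 : V) = 0. Proof. by rewrite /nm normr0. Qed.

Lemma nmN x : nm (- x) = nm x. Proof. by rewrite /nm normrN. Qed.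

Lemma nmD x y : nm (x + y) <= nm x + nm y.
Proof. by rewrite -lecR rmorphD/= -!nmE ler_normD. Qed.

Lemma nmB x y : nm (x - y) <= nm x + nm y.
Proof. by rewrite -(nmN y) nmD. Qed.

Lemma nm_distC x y : nm (x - y) = nm (y - x).
Proof. by rewrite -nmN opprB. Qed.

Lemma nm_eq0 x : nm x = 0 -> x = 0.
Proof. by move=> h; apply/eqP; rewrite -normr_eq0 nmE h. Qed.

Lemma nm_gt0 x : x != 0 -> 0 < nm x.
Proof. by move=> h; rewrite -ltcR -nmE normr_gt0. Qed.

Lemma nm_split x y (a b : R) : nm (x - y) <= a -> nm y <= b -> nm x <= a + b.
Proof.
by move=> h1 h2; rewrite -[x](subrK y) (le_trans (nmD _ _))// lerD.
Qed.

Lemma nm_sum (I : Type) (r : seq I) (P : pred I) (F : I -> V) :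
  nm (\sum_(i <- r | P i) F i) <= \sum_(i <- r | P i) nm (F i).
Proof.
elim/big_ind2 : _ => [|a b c d ha hb|//]; first by rewrite nm0.
by rewrite (le_trans (nmD _ _))// lerD.
Qed.

(** Continuity of curves in real epsilons, since the norm balls of a space over
R[i] have complex radii. *)
Definition vcont (f : R -> V) := forall s e, 0 < e ->
  exists2 d, 0 < d & forall s', `|s' - s| < d -> nm (f s' - f s) < e.

End RealNorm.

Section ComplexBasics.
Context {R : realType}.
Local Notation C := R[i].
Implicit Types (z : C) (x : R).
Local Notation Re := complex.Re.
Local Notation Im := complex.Im.

Lemma cReD z1 z2 : Re (z1 + z2) = Re z1
  + Re z2. Proof. by case: z1 z2 => ? ? []. Qed.
Lemma cImD z1 z2 : Im (z1 + z2) = Im z1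
  + Im z2. Proof. by case: z1 z2 => ? ? []. Qed.
Lemma cReN z : Re (- z) = - Re z. Proof. by case: z. Qed.
Lemma cImN z : Im (- z) = - Im z. Proof. by case: z. Qed.
Lemma cReM z1 z2 : Re (z1 * z2) = Re z1 * Re z2 - Im z1 * Im z2.
Proof. by case: z1 z2 => ? ? []. Qed.
Lemma cImM z1 z2 : Im (z1 * z2) = Re z1 * Im z2 + Im z1 * Re z2.
Proof. by case: z1 z2 => ? ? []. Qed.
Lemma Cext z1 z2 : Re z1 = Re z2 -> Im z1 = Im z2 -> z1 = z2.
Proof. by case: z1 z2 => ? ? [? ?] /= -> ->. Qed.

Lemma NconjE z : Num.conj z = Re z -i* Im z.
Proof. by case: z. Qed.
Lemma cReJ z : Re (Num.conj z) = Re z. Proof. by rewrite NconjE. Qed.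
Lemma cImJ z : Im (Num.conj z) = - Im z. Proof. by rewrite NconjE. Qed.

Lemma nmc_sq z : nm z ^+ 2 = Re z ^+ 2 + Im z ^+ 2.
Proof. by apply: (@complexI R); rewrite add_Re2_Im2 nmE rmorphXn. Qed.

Lemma nmc z : nm z = Num.sqrt (Re z ^+ 2 + Im z ^+ 2).
Proof. by rewrite -nmc_sq sqrtr_sqr ger0_norm// nm_ge0. Qed.

Lemma nmM z1 z2 : nm (z1 * z2) = nm z1 * nm z2.
Proof. by apply: (@complexI R); rewrite rmorphM/= -!nmE normrM. Qed.

Lemma nmV z : nm z^-1 = (nm z)^-1.
Proof. by apply: (@complexI R); rewrite fmorphV/= -!nmE normfV. Qed.

Lemma nmX z n : nm (z ^+ n) = nm z ^+ n.
Proof. by apply: (@complexI R); rewrite rmorphXn/= -!nmE normrX. Qed.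

Lemma nm1 : nm (1 : C) = 1.
Proof. by apply: (@complexI R); rewrite -nmE normr1. Qed.

Lemma nmJ z : nm (Num.conj z) = nm z.
Proof. by rewrite !nmc cReJ cImJ sqrrN. Qed.

Lemma nmR x : nm (x%:C) = `|x|.
Proof. by rewrite nmc/= expr0n/= addr0 sqrtr_sqr. Qed.

Lemma Re_le_nm z : `|Re z| <= nm z.
Proof. by rewrite nmc -sqrtr_sqr ler_wsqrtr// lerDl sqr_ge0. Qed.

Lemma Im_le_nm z : `|Im z| <= nm z.
Proof. by rewrite nmc -sqrtr_sqr ler_wsqrtr// lerDr sqr_ge0. Qed.

Lemma nm_le_ReIm z : nm z <= `|Re z| + `|Im z|.
Proof.
rewrite nmc -[leRHS]ger0_norm ?addr_ge0// -sqrtr_sqr ler_wsqrtr//.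
rewrite -(real_normK (num_real (Re z))) -(real_normK (num_real (Im z))).
by rewrite sqrrD addrAC lerDl mulrn_wge0// mulr_ge0.
Qed.

Lemma nm_conjM z : z * Num.conj z = (nm z ^+ 2)%:C.
Proof.
apply: Cext; rewrite ?cReM ?cImM cReJ cImJ/= ?nmc_sq; last by ring.
by rewrite mulrN opprK !expr2.
Qed.

Lemma nm_triR z : Re z <= nm z.
Proof. exact: le_trans (ler_norm _) (Re_le_nm _). Qed.

End ComplexBasics.

Lemma nmZ (R : realType) (H : normedModType R[i]) (k : R[i]) (x : H) :
  nm (k *: x) = nm k * nm x.
Proof. by apply: (@complexI R); rewrite rmorphM/= -!nmE normrZ. Qed.

Section ComplexIntegral.
Context {R : realType}.
Local Notation C := R[i].
Local Notation Re := complex.Re.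
Local Notation Im := complex.Im.
Implicit Types (f g : R -> C) (a b : R).

Definition cC f := continuous (fun s => Re (f s)) /\ continuous (fun s => Im (f s)).
Definition lbmC f := lbm (fun s => Re (f s)) /\ lbm (fun s => Im (f s)).
Definition Cint a b f : C :=
  Rint a b (fun s => Re (f s)) +i* Rint a b (fun s => Im (f s)).

Lemma cC_lbmC f : cC f -> lbmC f.
Proof. by move=> [? ?]; split; exact: continuous_lbm. Qed.

Lemma nbhs_dist (s d : R) : 0 < d -> \forall s' \near s, `|s' - s| < d.
Proof.
move=> d0; apply/nbhs_ballP; exists d => // s'.
by rewrite /ball/= distrC.
Qed.

Lemma vcont_continuousR (f : R -> C) (h : C -> R) :
  (forall z1 z2, `|h z1 - h z2| <= nm (z1 - z2)) ->
  vcont f -> continuous (fun s => h (f s)).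
Proof.
move=> hh cf s; apply/cvgrPdist_lt => e e0.
have [d d0 H] := cf s _ e0.
near=> s'; rewrite distrC (le_lt_trans (hh _ _))//; apply: H.
near: s'; exact: nbhs_dist.
Unshelve. all: by end_near.
Qed.

Lemma vcont_cC f : vcont f -> cC f.
Proof.
by move=> cf; split; apply: vcont_continuousR cf => z1 z2;
  rewrite -?cReN -?cImN -?cReD -?cImD ?Re_le_nm ?Im_le_nm.
Qed.

Lemma continuous_dist (f : R -> R) s e : continuous f -> 0 < e ->
  exists2 d, 0 < d & forall s', `|s' - s| < d -> `|f s' - f s| < e.
Proof.
move=> cf e0; have /cvgrPdist_lt/(_ _ e0)/nbhs_ballP[d d0 H] := cf s.
exists d => // s' hs'; rewrite distrC; apply: H.
by rewrite /ball/= distrC.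
Qed.

Lemma cC_vcont f : cC f -> vcont f.
Proof.
move=> [cr ci] s e e0; have e20 : 0 < e / 2 by rewrite divr_gt0.
have [d1 d10 h1] := continuous_dist s cr e20.
have [d2 d20 h2] := continuous_dist s ci e20.
exists (Num.min d1 d2) => [|s']; first by rewrite lt_min d10.
rewrite lt_min => /andP[/h1 k1 /h2 k2].
rewrite (le_lt_trans (nm_le_ReIm _))// !(cReD, cImD, cReN, cImN).
by rewrite [ltRHS]splitr ltrD.
Qed.

Lemma cC_cst z : cC (fun=> z).
Proof. by split; exact: cst_continuous. Qed.

Lemma contD (f g : R -> R) : continuous f -> continuous g ->
  continuous (fun s => f s + g s).
Proof. by move=> cf cg s; apply: continuousD; [exact: cf|exact: cg]. Qed.

Lemma contN (f : R -> R) : continuous f -> continuous (fun s => - f s).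
Proof. by move=> cf s; apply: continuousN; exact: cf. Qed.

Lemma contM (f g : R -> R) : continuous f -> continuous g ->
  continuous (fun s => f s * g s).
Proof. by move=> cf cg s; apply: continuousM; [exact: cf|exact: cg]. Qed.

Lemma cCD f g : cC f -> cC g -> cC (fun s => f s + g s).
Proof.
move=> [fr fi] [gr gi]; split.
  by under eq_fun do rewrite cReD; exact: contD.
by under eq_fun do rewrite cImD; exact: contD.
Qed.

Lemma cCN f : cC f -> cC (fun s => - f s).
Proof.
move=> [fr fi]; split.
  by under eq_fun do rewrite cReN; exact: contN.
by under eq_fun do rewrite cImN; exact: contN.
Qed.

Lemma cCM f g : cC f -> cC g -> cC (fun s => f s * g s).
Proof.
move=> [fr fi] [gr gi]; split.
  by under eq_fun do rewrite cReM; apply: contD; [|apply: contN]; exact: contM.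
by under eq_fun do rewrite cImM; apply: contD; exact: contM.
Qed.

Lemma cCJ f : cC f -> cC (fun s => Num.conj (f s)).
Proof.
move=> [fr fi]; split.
  by under eq_fun do rewrite cReJ.
by under eq_fun do rewrite cImJ; exact: contN.
Qed.

Lemma cCR (f : R -> R) : continuous f -> cC (fun s => (f s)%:C).
Proof. by move=> cf; split => //=; exact: cst_continuous. Qed.

Lemma lbmC_cst z : lbmC (fun=> z).
Proof. exact/cC_lbmC/cC_cst. Qed.

Lemma lbmCD f g : lbmC f -> lbmC g -> lbmC (fun s => f s + g s).
Proof.
move=> [fr fi] [gr gi]; split.
  by under eq_fun do rewrite cReD; exact: lbmD.
by under eq_fun do rewrite cImD; exact: lbmD.
Qed.

Lemma lbmCN f : lbmC f -> lbmC (fun s => - f s).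
Proof.
move=> [fr fi]; split.
  by under eq_fun do rewrite cReN; exact: lbmN.
by under eq_fun do rewrite cImN; exact: lbmN.
Qed.

Lemma lbmCM f g : lbmC f -> lbmC g -> lbmC (fun s => f s * g s).
Proof.
move=> [fr fi] [gr gi]; split.
  by under eq_fun do rewrite cReM; apply: lbmB; exact: lbmM.
by under eq_fun do rewrite cImM; apply: lbmD; exact: lbmM.
Qed.

Lemma lbmCJ f : lbmC f -> lbmC (fun s => Num.conj (f s)).
Proof.
move=> [fr fi]; split.
  by under eq_fun do rewrite cReJ.
by under eq_fun do rewrite cImJ; exact: lbmN.
Qed.

Lemma lbmCR (f : R -> R) : lbm f -> lbmC (fun s => (f s)%:C).
Proof. by move=> hf; split => //=; exact: lbm_cst. Qed.

Lemma lbmC_sum (I : Type) (r : seq I) (P : pred I) (F : I -> R -> C) :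
  (forall i, P i -> lbmC (F i)) -> lbmC (fun s => \sum_(i <- r | P i) F i s).
Proof.
move=> h; elim: r => [|i r IH].
  by under eq_fun do rewrite big_nil; exact: lbmC_cst.
under eq_fun do rewrite big_cons.
by case: (boolP (P i)) => // Pi; apply: lbmCD => //; exact: h.
Qed.

Lemma eq_Cint a b f g : (forall s, a <= s <= b -> f s = g s) ->
  Cint a b f = Cint a b g.
Proof. by move=> h; congr Complex; apply: eq_Rint => s /h ->. Qed.

Lemma CintD a b f g : lbmC f -> lbmC g ->
  Cint a b (fun s => f s + g s) = Cint a b f + Cint a b g.
Proof.
move=> [fr fi] [gr gi]; apply: Cext; rewrite /= ?cReD ?cImD/= -RintD//.
  by apply: eq_Rint => s _; rewrite cReD.
by apply: eq_Rint => s _; rewrite cImD.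
Qed.

Lemma CintZ a b k f : lbmC f -> Cint a b (fun s => k * f s) = k * Cint a b f.
Proof.
move=> [fr fi]; apply: Cext; rewrite /= ?cReM ?cImM/= -!RintZ//.
  by rewrite -RintB; [apply: eq_Rint => s _; rewrite cReM| | ];
    try by apply: lbmM => //; exact: lbm_cst.
rewrite -RintD; [apply: eq_Rint => s _; rewrite cImM//| | ];
    by apply: lbmM => //; exact: lbm_cst.
Qed.

Lemma CintN a b f : lbmC f -> Cint a b (fun s => - f s) = - Cint a b f.
Proof.
move=> hf; rewrite -mulN1r -CintZ//.
by apply: eq_Cint => s _; rewrite mulN1r.
Qed.

Lemma CintB a b f g : lbmC f -> lbmC g ->
  Cint a b (fun s => f s - g s) = Cint a b f - Cint a b g.
Proof. by move=> hf hg; rewrite CintD ?CintN//; exact: lbmCN. Qed.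

Lemma Cint_conj a b f : lbmC f ->
  Cint a b (fun s => Num.conj (f s)) = Num.conj (Cint a b f).
Proof.
move=> [fr fi]; apply: Cext; rewrite ?cReJ ?cImJ/=.
  by apply: eq_Rint => s _; rewrite cReJ.
by rewrite -RintN//; apply: eq_Rint => s _; rewrite cImJ.
Qed.

Lemma Cint_sum a b (I : Type) (r : seq I) (P : pred I) (F : I -> R -> C) :
  (forall i, P i -> lbmC (F i)) ->
  Cint a b (fun s => \sum_(i <- r | P i) F i s) =
  \sum_(i <- r | P i) Cint a b (F i).
Proof.
move=> h; elim: r => [|i r IH].
  rewrite big_nil (@eq_Cint _ _ _ (fun s => 0 * 0)) => [|s _].
    by rewrite CintZ ?mul0r//; exact: lbmC_cst.
  by rewrite big_nil mul0r.
rewrite big_cons (@eq_Cint _ _ _ (fun s => if P i then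
  F i s + \sum_(j <- r | P j) F j s else \sum_(j <- r | P j) F j s)).
  by case: ifP => // Pi; rewrite CintD ?IH//; [exact: h|exact: lbmC_sum].
by move=> s _; rewrite big_cons.
Qed.

Lemma Cint_cat a b c f : lbmC f -> a <= b -> b <= c ->
  Cint a c f = Cint a b f + Cint b c f.
Proof.
move=> [fr fi] ab bc; apply: Cext; rewrite ?cReD ?cImD/=; exact: Rint_cat.
Qed.

Lemma Cint_cst a b z : a <= b -> Cint a b (fun=> z) = z * (b - a)%:C.
Proof.
move=> ab; rewrite /Cint !Rint_cst//.
by apply: Cext; rewrite ?cReM ?cImM/= ?mulr0 ?subr0 ?add0r.
Qed.

Lemma lbm_nm f : lbmC f -> lbm (fun s => nm (f s)).
Proof.
move=> [[mr br] [mi bi]]; split.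
  under eq_fun do rewrite nmc.
  apply: (measurableT_comp (continuous_measurable_fun (@sqrt_continuous R))).
  by apply: measurable_funD; apply: measurable_funX.
move=> a b; have [M hM] := br a b; have [N hN] := bi a b.
exists (M + N) => s hs; rewrite ger0_norm ?nm_ge0//.
by rewrite (le_trans (nm_le_ReIm _))// lerD ?hM ?hN.
Qed.

(** Rotating the integral onto the real axis reduces the bound to the real
case without loss of a constant. *)
Lemma nm_Cint_le a b f : lbmC f ->
  nm (Cint a b f) <= Rint a b (fun s => nm (f s)).
Proof.
move=> hf; set I := Cint a b f.
have [->|I0] := eqVneq I 0.
  by rewrite nm0; apply: Rint_ge0 => s _; exact: nm_ge0.
have nI : 0 < nm I by exact: nm_gt0.
rewrite -(ler_pM2l nI) -expr2.
have -> : nm I ^+ 2 = Re (Cint a b (fun s => Num.conj I * f s)).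
  by rewrite CintZ// mulrC nm_conjM.
rewrite -RintZ; last exact: lbm_nm.
have hIf := lbmCM (lbmC_cst (Num.conj I)) hf.
apply: le_Rint; first by case: hIf.
  by apply: lbmM; [exact: lbm_cst|exact: lbm_nm].
by move=> s _; rewrite (le_trans (nm_triR _))// nmM nmJ.
Qed.

Lemma nm_Cint_le_cst a b f M : a <= b -> lbmC f ->
  (forall s, a <= s <= b -> nm (f s) <= M) -> nm (Cint a b f) <= M * (b - a).
Proof.
move=> ab hf h; rewrite (le_trans (nm_Cint_le _ _ hf))//.
by apply: Rint_le_cst => //; exact: lbm_nm.
Qed.

Lemma lbmC_bounded a b f : lbmC f ->
  exists M, forall s, a <= s <= b -> nm (f s) <= M.
Proof.
move=> /lbm_nm[_ /(_ a b)[M hM]]; exists M => s /hM.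
by rewrite ger0_norm// nm_ge0.
Qed.

Definition Cderiv (F f : R -> C) (P : R -> Prop) := forall s, P s ->
  is_derive s (1 : R) (fun s => Re (F s)) (Re (f s)) /\ is_derive s (1 : R)
    (fun s => Im (F s)) (Im (f s)).

Lemma CFTC2 F f a b : a <= b -> cC f -> cC F ->
  Cderiv F f (fun s => a < s < b) -> Cint a b f = F b - F a.
Proof.
move=> ab [fr fi] [Fr Fi] dF; apply: Cext; rewrite ?(cReD, cImD, cReN, cImN)/=.
  by apply: (@FTC2 _ (fun s => Re (F s)) (fun s => Re (f s))) => // s /dF[].
by apply: (@FTC2 _ (fun s => Im (F s)) (fun s => Im (f s))) => // s /dF[].
Qed.

Lemma CderivM (F G f g : R -> C) P : Cderiv F f P -> Cderiv G g P ->
  Cderiv (fun s => F s * G s) (fun s => f s * G s + F s * g s) P.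
Proof.
move=> dF dG s Ps; have [dfr dfi] := dF s Ps; have [dgr dgi] := dG s Ps.
split.
  under eq_fun do rewrite cReM; rewrite cReD !cReM.
  apply: is_derive_eq; rewrite /GRing.scale/=; ring.
under eq_fun do rewrite cImM; rewrite cImD !cImM.
apply: is_derive_eq; rewrite /GRing.scale/=; ring.
Qed.

Lemma Cint_by_parts F G f g a b : a <= b -> cC F -> cC G -> cC f -> cC g ->
  Cderiv F f (fun s => a < s < b) -> Cderiv G g (fun s => a < s < b) ->
  Cint a b (fun s => F s * g s) =
  F b * G b - F a * G a - Cint a b (fun s => f s * G s).
Proof.
move=> ab cF cG cf cg dF dG.
have l1 : lbmC (fun s => f s * G s) by apply/cC_lbmC/cCM.
have l2 : lbmC (fun s => F s * g s) by apply/cC_lbmC/cCM.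
rewrite -(@CFTC2 (fun s => F s * G s) (fun s => f s * G s + F s * g s))//.
- by rewrite CintD// addrAC subrr add0r.
- by apply: cCD; exact: cCM.
- exact: cCM.
- exact: CderivM.
Qed.

End ComplexIntegral.

(** * Hilbert space: Riesz representation and weak integrals *)

Section BoundedOperators.
Context {R : realType} {H : completeNormedModType R[i]}.
Implicit Types x y : H.

Lemma nm_complete (u : nat -> H) :
  (forall e : R, 0 < e -> exists N, forall m n, (N <= m)%N -> (N <= n)%N ->
     nm (u m - u n) < e) ->
  exists l, forall e : R, 0 < e -> exists N, forall n, (N <= n)%N ->
     nm (u n - l) < e.
Proof.
move=> hc; have /cvg_ex[l /cvgrPdist_lt hl] : cvg (u @ \oo).
  apply/cauchy_cvgP/cauchy_exP => e e0.
  have eE : e = (complex.Re e)%:C by rewrite RRe_real// gtr0_real.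
  have [N hN] : exists N, forall m n, (N <= m)%N -> (N <= n)%N ->
      nm (u m - u n) < complex.Re e.
    by apply: hc; rewrite -ltcR -eE.
  exists (u N), N => // n /= Nn; rewrite -ball_normE/= nmE eE ltcR.
  exact: hN.
exists l => e e0; have [|N _ hN] := hl e%:C; first by rewrite ltcR.
exists N => n Nn; have := hN n Nn.
by rewrite /= nmE ltcR nm_distC.
Qed.

Definition bounded_by (T : H -> H) (M : R) := forall x, nm (T x) <= M * nm x.

Lemma continuous_bounded (T : {linear H -> H}) : continuous T ->
  exists2 M, 0 <= M & bounded_by T M.
Proof.
move=> cT; have /cvgrPdist_lt/(_ 1%:C) := cT 0.
rewrite linear0 ltcR ltr01 => /(_ isT)/nbhs_ballP[d /= d0 hd].
have d0R : 0 < complex.Re d by move: d0; rewrite ltcE => /andP[].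
have dE : d = (complex.Re d)%:C by rewrite RRe_real// ger0_real// ltW.
set e := complex.Re d in d0R dE.
exists (2 / e); first by rewrite divr_ge0// ltW.
move=> x; have [->|x0] := eqVneq x 0; first by rewrite linear0 !nm0 mulr0.
have nx : 0 < nm x by exact: nm_gt0.
pose k : R := e / 2 / nm x.
have k0 : 0 < k by rewrite !divr_gt0.
have /hd/= : ball (0 : H) d (k%:C *: x).
  rewrite -ball_normE /= sub0r normrN nmE nmZ nmR gtr0_norm// dE ltcR.
  by rewrite /k divfK ?gt_eqF// ltr_pdivrMr// mulr_natr mulr2n ltrDr.
rewrite sub0r normrN nmE ltcR linearZ nmZ nmR gtr0_norm// => h.
rewrite -(ler_pM2l k0) (le_trans (ltW h))// /k.
by rewrite le_eqVlt; apply/orP; left; apply/eqP; field; rewrite !gt_eqF.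
Qed.

End BoundedOperators.

Section HilbertSpace.
Context {R : realType} {H : completeNormedModType R[i]}.
Variables (dot : {dot H for Num.conj}) (hdot : norm_of_dot dot).
Local Notation C := R[i].
Local Notation Re := complex.Re.
Implicit Types x y : H.

(** The inner product with codomain R[i] itself: on its values, rules about
complex numbers apply syntactically. *)
Definition ip (x y : H) : C := dot x y.

Lemma dotDl x y z : ip (x + y) z = ip x z + ip y z.
Proof. exact: linearDl. Qed.
Lemma dotDr x y z : ip x (y + z) = ip x y + ip x z.
Proof. exact: linearDr. Qed.
Lemma dotNl x z : ip (- x) z = - ip x z. Proof. exact: linearNl. Qed.
Lemma dotNr x z : ip x (- z) = - ip x z. Proof. exact: linearNr. Qed.
Lemma dotZl a x z : ip (a *: x) z = a * ip x z.
Proof. exact: linearZl_LR. Qed.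
Lemma dotZr a x z : ip x (a *: z) = Num.conj a * ip x z.
Proof. exact: linearZr_LR. Qed.
Lemma dot0l z : ip 0 z = 0. Proof. exact: linear0l. Qed.
Lemma dot0r z : ip z 0 = 0. Proof. exact: linear0r. Qed.
Lemma dotC x y : ip x y = Num.conj (ip y x).
Proof. by rewrite /ip hermC expr0 mul1r. Qed.
Lemma dot_suml (I : Type) (r : seq I) (P : pred I) (F : I -> H) y :
  ip (\sum_(i <- r | P i) F i) y = \sum_(i <- r | P i) ip (F i) y.
Proof. exact: linear_sumlz. Qed.
Lemma dot_sumr (I : Type) (r : seq I) (P : pred I) (F : I -> H) y :
  ip y (\sum_(i <- r | P i) F i) = \sum_(i <- r | P i) ip y (F i).
Proof. exact: linear_sumr. Qed.

Lemma dotxx x : ip x x = (nm x ^+ 2)%:C.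
Proof. by rewrite /ip hdot nmE rmorphXn. Qed.

Lemma nm_sqr x : nm x ^+ 2 = Re (ip x x).
Proof. by rewrite dotxx. Qed.

Lemma nm_sqrD x y : nm (x + y) ^+ 2 = nm x ^+ 2 + nm y ^+ 2 + 2 * Re (ip x y).
Proof.
rewrite !nm_sqr !(dotDl, dotDr) (dotC y x) !cReD cReJ; ring.
Qed.

Lemma dot_ext x x' : (forall y, ip x y = ip x' y) -> x = x'.
Proof.
move=> h; apply/eqP; rewrite -subr_eq0; apply/eqP/nm_eq0/eqP.
by rewrite -sqrf_eq0 nm_sqr dotDl dotNl h subrr.
Qed.

Lemma nm_dot x y : nm (ip x y) <= nm x * nm y.
Proof.
have [->|y0] := eqVneq y 0; first by rewrite dot0r !nm0 mulr0.
have ny : 0 < nm y by exact: nm_gt0.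
pose a : C := (- (nm y ^+ 2)^-1)%:C * ip x y.
have := sqr_ge0 (nm (x + a *: y)).
rewrite nm_sqrD dotZr nmZ /a.
have -> : Re (Num.conj ((- (nm y ^+ 2)^-1)%:C * ip x y) * ip x y) =
    - (nm (ip x y) ^+ 2 / nm y ^+ 2).
  by rewrite nmc_sq !(cReM, cImM, cReJ, cImJ)/=; ring.
rewrite nmM nmR normrN ger0_norm ?invr_ge0 ?sqr_ge0// => h.
rewrite -(@ler_pXn2r _ 2)// ?nnegrE ?nm_ge0 ?mulr_ge0 ?nm_ge0//.
rewrite exprMn -ler_pdivrMr ?exprn_gt0//.
rewrite -subr_ge0; apply: le_trans h _; rewrite le_eqVlt; apply/orP; left.
by apply/eqP; field; rewrite gt_eqF.
Qed.

Lemma parallelogram x y :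
  nm (x + y) ^+ 2 + nm (x - y) ^+ 2 = 2 * (nm x ^+ 2 + nm y ^+ 2).
Proof. by rewrite !nm_sqrD nmN dotNr cReN; ring. Qed.

Definition antilinear (L : H -> C) :=
  forall a x y, L (a *: x + y) = Num.conj a * L x + L y.

(** The representing vector is the minimizer of the coercive quadratic
functional nm x ^+ 2 - 2 * Re (L x); the parallelogram law makes every
minimizing sequence a Cauchy sequence. *)
Lemma riesz (L : H -> C) M : antilinear L ->
  (forall x, nm (L x) <= M * nm x) -> exists v, forall y, ip v y = L y.
Proof.
move=> aL bL.
have L0 : L 0 = 0.
  have := aL 1 0 0; rewrite scaler0 addr0 rmorph1 mul1r => h.
  by apply: (@addrI _ (L 0)); rewrite addr0 -h.
have LD x y : L (x + y) = L x + L y.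
  by rewrite -[x]scale1r aL rmorph1 mul1r scale1r.
have LZ a x : L (a *: x) = Num.conj a * L x.
  by rewrite -[a *: x]addr0 aL L0 addr0.
pose q x := nm x ^+ 2 - 2 * Re (L x).
have qlb x : - M ^+ 2 <= q x.
  have := le_trans (nm_triR _) (bL x).
  rewrite /q; have := sqr_ge0 (nm x - M); nra.
have qinf : has_inf (range q).
  split; first by exists (q 0), 0.
  by exists (- M ^+ 2) => _ [x _ <-].
set d := inf (range q).
have dq x : d <= q x by apply: ge_inf; [case: qinf|exists x].
have mid x y : nm (x - y) ^+ 2 <= 2 * (q x - d) + 2 * (q y - d).
  have := dq ((2^-1 : R)%:C *: (x + y)).
  have := parallelogram x y.
  rewrite /q nmZ nmR LZ LD cReM !NconjE/= oppr0 mul0r subr0 cReD.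
  rewrite ger0_norm ?invr_ge0//; set a := nm (x + y); set b := nm (x - y).
  have -> : (2^-1 * a) ^+ 2 = 4^-1 * a ^+ 2 by field.
  lra.
have hseq n : exists x, q x < d + n.+1%:R^-1.
  have [|_ [x _ <-] hx] := @inf_adherent _ (range q) (n.+1%:R^-1) _ qinf.
    by rewrite invr_gt0.
  by exists x.
have [u hu] := choice hseq.
have [l hl] : exists l, forall e : R, 0 < e -> exists N, forall n,
    (N <= n)%N -> nm (u n - l) < e.
  apply: nm_complete => e e0.
  pose N := Num.truncn (4 / e ^+ 2); exists N => m n Nm Nn.
  have hN k : (N <= k)%N -> q (u k) - d < e ^+ 2 / 4.
    move=> Nk; rewrite ltrBlDl (lt_trans (hu k))// ltrD2l.
    rewrite invf_plt ?posrE ?divr_gt0 ?exprn_gt0// invf_div.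
    rewrite (lt_le_trans (truncnS_gt _))// ler_nat.
    by rewrite ltnS.
  rewrite -(@ltr_pXn2r _ 2)// ?nnegrE ?nm_ge0 ?ltW//.
  by rewrite (le_lt_trans (mid _ _))//; have := hN _ Nm; have := hN _ Nn; lra.
have ql : q l <= d.
  apply/ler_addgt0Pr => e e0.
  pose B := nm l + nm l + 1 + 2 * `|M|.
  have B0 : 0 < B by rewrite /B; have := nm_ge0 l; have := normr_ge0 M; lra.
  have [|N hN] := hl (Num.min 1 (e / 2 / B)).
    by rewrite lt_min ltr01 !divr_gt0.
  pose K := Num.truncn (2 / e); pose n := maxn N K.
  have := hN n (leq_maxl _ _); rewrite lt_min => /andP[h1 h2].
  have hq := hu n.
  have hne : n.+1%:R^-1 < e / 2.
    rewrite invf_plt ?posrE ?divr_gt0// invf_div.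
    by rewrite (lt_le_trans (truncnS_gt _))// ler_nat ltnS leq_maxr.
  have hu1 : nm l <= nm (u n) + nm (u n - l).
    by rewrite addrC; apply: nm_split => //; rewrite -nm_distC.
  have hu2 : nm (u n) <= nm (u n - l) + nm l by apply: nm_split.
  have hL : Re (L (u n)) - Re (L l) <= `|M| * nm (u n - l).
    rewrite -cReN -cReD -mulN1r -(rmorphN1 (Num.conj : C -> C)).
    rewrite -LZ -LD scaleN1r (le_trans (nm_triR _))// (le_trans (bL _))//.
    by rewrite ler_wpM2r ?nm_ge0// ler_norm.
  have hB : nm (u n - l) * B <= e / 2 by rewrite -ler_pdivlMr// ltW.
  have b0 := nm_ge0 (u n); have a0 := nm_ge0 l; have c0 := nm_ge0 (u n - l).
  have hsq : nm l ^+ 2 <= nm (u n) ^+ 2 + nm (u n - l) * (nm l + nm l + 1).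
    have p1 : 0 <= (nm (u n) + nm (u n - l) - nm l) * (nm l + nm (u n)).
      by apply: mulr_ge0; lra.
    have p2 : 0 <= nm (u n - l) * (nm (u n - l) + nm l - nm (u n)).
      by apply: mulr_ge0; lra.
    have p3 : 0 <= nm (u n - l) * (1 - nm (u n - l)) by apply: mulr_ge0; lra.
    by rewrite -subr_ge0; move: p1 p2 p3; lra.
  have q1 : q (u n) = nm (u n) ^+ 2 - 2 * Re (L (u n)) by [].
  have q2 : q l = nm l ^+ 2 - 2 * Re (L l) by [].
  move: hL hq hne hsq; rewrite /B in hB; rewrite q1 q2; move: hB.
  move: (n.+1%:R^-1) (Re (L l)) (Re (L (u n))) => i1 i2 i3.
  move: (nm l) (nm (u n)) (nm (u n - l)) (`|M|) => i4 i5 i6 i7.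
  clear; move=> h1 h2 h3 h4 h5. lra.
have main y : Re (L y) = Re (ip l y).
  (* First variation of q at its minimizer l in the direction y. *)
  have key (t : R) : 0 <= t ^+ 2 * nm y ^+ 2 + 2 * t * (Re (ip l y) - Re (L y)).
    have := le_trans ql (dq (l + t%:C *: y)).
    rewrite /q nm_sqrD nmZ nmR LD LZ dotZr !cReD !cReM !NconjE/= oppr0 !mul0r
      !subr0.
    rewrite exprMn real_normK ?num_real//; lra.
  set c := Re (ip l y) - Re (L y) in key.
  have : c = 0.
    have := key (- c / (nm y ^+ 2 + 1)).
    set w := nm y ^+ 2; have w0 : 0 <= w by exact: sqr_ge0.
    have -> : (- c / (w + 1)) ^+ 2 * w + 2 * (- c / (w + 1)) * c =
      - (c ^+ 2 * ((w + 2) / (w + 1) ^+ 2)).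
      by field; rewrite gt_eqF// ltr_wpDl.
    rewrite oppr_ge0 pmulr_lle0; last by rewrite divr_gt0 ?exprn_gt0//; lra.
    by move=> h; apply/eqP; rewrite -sqrf_eq0 eq_le h sqr_ge0.
  by rewrite /c => /eqP; rewrite subr_eq0 => /eqP.
exists l => y; apply: Cext; first by rewrite main.
have := main ('i%C *: y).
by rewrite LZ dotZr !cReM !NconjE /=; lra.
Qed.

Lemma adjoint (T : {linear H -> H}) : continuous T ->
  exists Ta : H -> H, forall x y, ip (T x) y = ip x (Ta y).
Proof.
move=> /continuous_bounded[M M0 bT].
have h y : exists v, forall x, ip v x = Num.conj (ip (T x) y).
  apply: (@riesz _ (M * nm y)) => [a x z|x].
    by rewrite linearP dotDl dotZl rmorphD rmorphM.
  rewrite nmJ (le_trans (nm_dot _ _))// mulrAC ler_wpM2r ?nm_ge0//.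
have [Ta hTa] := choice h; exists Ta => x y.
by rewrite [RHS]dotC hTa conjCK.
Qed.

(** Integrals of vectors are weak integrals: the vector that represents the
antilinear functional obtained by integrating inner products. *)
Definition rep (L : H -> C) : H := xget 0 [set v | forall y, ip v y = L y].

Lemma repE (L : H -> C) M : antilinear L ->
  (forall x, nm (L x) <= M * nm x) -> forall y, ip (rep L) y = L y.
Proof.
by move=> aL bL; rewrite /rep; case: xgetP => [//|h] ; have [v hv] := riesz aL bL;
  have := h v.
Qed.

Lemma dot_nm_le x M : 0 <= M -> (forall y, nm (ip x y) <= M * nm y) -> nm x <= M.
Proof.
move=> M0 h; have [->|x0] := eqVneq x 0; first by rewrite nm0.
have := h x; rewrite dotxx nmR ger0_norm ?sqr_ge0// expr2.
by rewrite ler_pM2r// nm_gt0.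
Qed.

Lemma vcont_dot (X : R -> H) y : vcont X -> cC (fun s => ip (X s) y).
Proof.
move=> cX; apply: vcont_cC => s e e0.
have [|d d0 hd] := cX s (e / (nm y + 1)).
  by rewrite divr_gt0// ltr_wpDl ?nm_ge0.
exists d => // s' /hd h; rewrite -dotNl -dotDl (le_lt_trans (nm_dot _ _))//.
have n1 : 0 < nm y + 1 by rewrite ltr_wpDl ?nm_ge0.
rewrite (@le_lt_trans _ _ (nm (X s' - X s) * (nm y + 1)))//.
  by rewrite ler_wpM2l ?nm_ge0// lerDl.
by rewrite -ltr_pdivlMr.
Qed.

Lemma vcont_nm (X : R -> H) : vcont X -> continuous (fun s => nm (X s)).
Proof.
move=> cX s; apply/cvgrPdist_lt => e e0.
have [d d0 hd] := cX s _ e0.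
near=> s'; have : nm (X s' - X s) < e.
  by apply: hd; near: s'; exact: nbhs_dist.
apply: le_lt_trans; rewrite ler_norml.
have := @nm_split _ _ (X s') (X s) _ _ (lexx _) (lexx _).
have := @nm_split _ _ (X s) (X s') _ _ (lexx _) (lexx _).
by rewrite (nm_distC (X s)); lra.
Unshelve. all: by end_near.
Qed.

Definition pint a b (kappa : R -> C) (X : R -> H) : H :=
  rep (fun y => Cint a b (fun s => kappa s * ip (X s) y)).

Lemma lbmC_dot kappa X y : lbmC kappa -> vcont X ->
  lbmC (fun s => kappa s * ip (X s) y).
Proof. by move=> hk cX; apply: lbmCM => //; exact/cC_lbmC/vcont_dot. Qed.

Lemma pintE a b kappa X y : a <= b -> lbmC kappa -> vcont X ->
  ip (pint a b kappa X) y = Cint a b (fun s => kappa s * ip (X s) y).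
Proof.
move=> ab hk cX.
have [M hM] := lbmC_bounded a b hk.
have [N hN] : exists N, forall s, a <= s <= b -> nm (X s) <= N.
  have [_ /(_ a b)[N hN]] := continuous_lbm (vcont_nm cX).
  by exists N => s /hN; rewrite ger0_norm ?nm_ge0.
rewrite /pint (@repE _ (M * N * (b - a)))// => [k x z|x].
  have lz w : lbmC (fun s => kappa s * ip (X s) w) by exact: lbmC_dot.
  rewrite -CintZ// -CintD//; last by apply: lbmCM => //; exact: lbmC_cst.
  by apply: eq_Cint => s _; rewrite dotDr dotZr; ring.
rewrite mulrAC; apply: nm_Cint_le_cst => //; first exact: lbmC_dot.
move=> s hs; rewrite nmM -mulrA ler_pM ?nm_ge0 ?hM//.
by rewrite (le_trans (nm_dot _ _))// ler_wpM2r ?nm_ge0 ?hN.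
Qed.

Lemma vcont_linear (T : {linear H -> H}) X : continuous T -> vcont X ->
  vcont (fun s => T (X s)).
Proof.
move=> /continuous_bounded[M M0 bT] cX s e e0.
have [|d d0 hd] := cX s (e / (M + 1)); first by rewrite divr_gt0// ltr_wpDl.
exists d => // s' /hd h; rewrite -linearB (le_lt_trans (bT _))//.
rewrite (@le_lt_trans _ _ ((M + 1) * nm (X s' - X s)))//.
  by rewrite ler_wpM2r ?nm_ge0// lerDl.
by rewrite mulrC -ltr_pdivlMr// ltr_wpDl.
Qed.

(** Bounded operators go through weak integrals because they have adjoints. *)
Lemma pint_linear a b kappa X (T : {linear H -> H}) : a <= b -> lbmC kappa ->
  vcont X -> continuous T -> T (pint a b kappa X) = pint a b kappa (T \o X).
Proof.
move=> ab hk cX cT; have [Ta hTa] := adjoint cT.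
apply: dot_ext => y; rewrite hTa !pintE//; last exact: vcont_linear.
by apply: eq_Cint => s _; rewrite /= hTa.
Qed.

End HilbertSpace.

(** * Fourier series of vector-valued functions *)

Section Characters.
Context {R : realType}.
Local Notation C := R[i].
Implicit Types (x y L s : R).

Definition expi x : C := cos x +i* sin x.

Lemma expiD x y : expi (x + y) = expi x * expi y.
Proof.
apply: Cext; rewrite ?cReM ?cImM/= ?cosD ?sinD//.
exact: addrC.
Qed.

Lemma expi0 : expi 0 = 1.
Proof. by rewrite /expi cos0 sin0. Qed.

Lemma expiJ x : Num.conj (expi x) = expi (- x).
Proof. by rewrite NconjE /expi/= cosN sinN. Qed.

Lemma nm_expi x : nm (expi x) = 1.
Proof. by rewrite nmc/= cos2Dsin2 sqrtr1. Qed.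

Lemma expi_2pi (n : int) : expi (n%:~R * (2 * pi)) = 1.
Proof.
have h1 : expi (2 * pi) = 1.
  by rewrite /expi mulrC mulr_natr cos2pi sin2pi.
have hn (k : nat) : expi (k%:R * (2 * pi)) = 1.
  by elim: k => [|k IH];
    rewrite ?mul0r ?expi0// mulrS mulrDl mul1r expiD IH h1 mul1r.
case: n => k; first exact: hn.
by rewrite NegzE mulrNz mulNr -expiJ hn rmorph1.
Qed.

Lemma continuous_mulRl (c : R) : continuous (fun s : R => c * s).
Proof. by move=> s; apply: mulrl_continuous. Qed.

Lemma cC_expi (c : R) : cC (fun s => expi (c * s)).
Proof.
split=> s /=.
  apply: (@continuous_comp _ _ _ (fun s => c * s) (@cos R));
    last exact: continuous_cos.
  exact: continuous_mulRl.
apply: (@continuous_comp _ _ _ (fun s => c * s) (@sin R));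
  last exact: continuous_sin.
exact: continuous_mulRl.
Qed.

Lemma Cderiv_expi c P : Cderiv (fun s => expi (c * s))
  (fun s => (c *i) * expi (c * s)) P.
Proof.
move=> s _; split => /=.
  by apply: is_derive_eq; rewrite /GRing.scale/=; ring.
by apply: is_derive_eq; rewrite /GRing.scale/=; ring.
Qed.

(** The characters of the circle of length L. *)
Definition ek L (k : int) s := expi (k%:~R * (2 * pi / L) * s).

Lemma cC_ek L k : cC (ek L k). Proof. exact: cC_expi. Qed.

Lemma nm_ek L k s : nm (ek L k s) = 1. Proof. exact: nm_expi. Qed.

Lemma ekD L k l s : ek L (k + l) s = ek L k s * ek L l s.
Proof. by rewrite -expiD -!mulrDl -rmorphD. Qed.

Lemma ekN L k s : ek L (- k) s = Num.conj (ek L k s).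
Proof. by rewrite expiJ /ek rmorphN/= !mulNr. Qed.

Lemma ekBs L k s s' : ek L k (s - s') = ek L k s * Num.conj (ek L k s').
Proof. by rewrite expiJ -expiD -mulrBr. Qed.

Lemma ek0 L s : ek L 0 s = 1. Proof. by rewrite /ek !mul0r expi0. Qed.

Lemma ek_at0 L k : ek L k 0 = 1. Proof. by rewrite /ek mulr0 expi0. Qed.

Lemma ek_atL L k : L != 0 -> ek L k L = 1.
Proof. by move=> L0; rewrite /ek -mulrA divfK// expi_2pi. Qed.

Lemma Cint_ek L k : 0 < L -> Cint 0 L (ek L k) = if k == 0 then L%:C else 0.
Proof.
move=> L0; case: eqVneq => [->|k0].
  rewrite (@eq_Cint _ _ _ _ (fun=> 1)); last by move=> s _; rewrite ek0.
  by rewrite Cint_cst ?ltW// subr0 mul1r.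
set c := k%:~R * (2 * pi / L) : R.
have c0 : c != 0.
  by rewrite mulf_neq0 ?intr_eq0// mulf_neq0 ?invr_neq0 ?gt_eqF// mulr_gt0 ?pi_gt0.
have : Cint 0 L (fun s => (c *i) * ek L k s) = 0.
  rewrite (@CFTC2 _ (ek L k)) ?ltW//.
  - by rewrite ek_atL ?gt_eqF// ek_at0 subrr.
  - by apply: cCM; [exact: cC_cst|exact: cC_ek].
  - exact: cC_ek.
  - exact: Cderiv_expi.
rewrite CintZ; last exact/cC_lbmC/cC_ek.
move=> /eqP; rewrite mulf_eq0 => /orP[|/eqP//].
by rewrite eq_complex/= (negbTE c0) andbF.
Qed.

End Characters.

Section Fourier.
Context {R : realType} {H : completeNormedModType R[i]}.
Variables (dot : {dot H for Num.conj}) (hdot : norm_of_dot dot).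
Local Notation C := R[i].
Local Notation Re := complex.Re.
Local Notation ip := (ip dot).
Implicit Types x y : H.

Lemma ReZl (a : R) (z : C) : Re (a%:C * z) = a * Re z.
Proof. by rewrite cReM/= mul0r subr0. Qed.

Lemma Re_sum (I : Type) (r : seq I) (P : pred I) (F : I -> C) :
  Re (\sum_(i <- r | P i) F i) = \sum_(i <- r | P i) Re (F i).
Proof.
elim: r => [|i r IH]; first by rewrite !big_nil.
by rewrite !big_cons; case: ifP => _; rewrite ?cReD IH.
Qed.

Lemma lbm_vnm (kappa : R -> C) (X : R -> H) : lbmC kappa -> vcont X ->
  lbm (fun s => nm (kappa s *: X s) ^+ 2).
Proof.
move=> hk cX; have -> : (fun s => nm (kappa s *: X s) ^+ 2) =
    (fun s => nm (kappa s) * nm (kappa s) * (nm (X s) * nm (X s))).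
  by apply/funext => s; rewrite nmZ exprMn !expr2.
have h1 := lbm_nm hk; have h2 := continuous_lbm (vcont_nm cX).
by apply: lbmM; exact: lbmM.
Qed.

Variables (L : R) (L0 : 0 < L).
Local Notation e := (ek L).

Lemma lbmC_ek k : lbmC (e k). Proof. exact/cC_lbmC/cC_ek. Qed.

Lemma Cint_ek_orth j k :
  Cint 0 L (fun s => e j s * Num.conj (e k s)) = if j == k then L%:C else 0.
Proof.
rewrite -subr_eq0 -(Cint_ek _ L0); apply: eq_Cint => s _.
by rewrite ekD ekN.
Qed.

(** The squared norm of v minus its partial Fourier sum is nonnegative, and the
characters are orthogonal. *)
Lemma bessel (n : nat) (k : 'I_n -> int) (kappa : R -> C) (X : R -> H)
    (vh : int -> H) : injective k -> lbmC kappa -> vcont X ->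
  (forall k y, ip (vh k) y =
     Cint 0 L (fun s => Num.conj (e k s) * (kappa s * ip (X s) y))) ->
  \sum_i nm (vh (k i)) ^+ 2 <= L * Rint 0 L (fun s => nm (kappa s *: X s) ^+ 2).
Proof.
move=> ik hk cX hv.
pose v s := kappa s *: X s.
pose sg s := \sum_i (L^-1%:C * e (k i) s) *: vh (k i).
set S := \sum_i _; set I := Rint _ _ _.
have lv y : lbmC (fun s => ip (v s) y).
  have := lbmC_dot hdot y hk cX; congr lbmC.
  by apply/funext => s; rewrite /v dotZl.
have le (i : 'I_n) : lbmC (fun s => L^-1%:C * e (k i) s).
  by apply: lbmCM; [exact: lbmC_cst|exact: lbmC_ek].
have vsgE s : ip (v s) (sg s) =
    \sum_i L^-1%:C * (Num.conj (e (k i) s) * ip (v s) (vh (k i))).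
  rewrite dot_sumr; apply: eq_bigr => i _.
  rewrite dotZr rmorphM/= mulrA; congr (_ * _ * _).
  by rewrite NconjE/= oppr0.
have lvsg : lbmC (fun s => ip (v s) (sg s)).
  under eq_fun do rewrite vsgE.
  apply: lbmC_sum => i _; apply: lbmCM; first exact: lbmC_cst.
  by apply: lbmCM => //; apply/lbmCJ/lbmC_ek.
have Ivsg : Cint 0 L (fun s => ip (v s) (sg s)) = (L^-1 * S)%:C.
  rewrite (@eq_Cint _ _ _ _ (fun s => \sum_i L^-1%:C *
    (Num.conj (e (k i) s) * ip (v s) (vh (k i))))); last by [].
  rewrite Cint_sum; last first.
    move=> i _; apply: lbmCM; first exact: lbmC_cst.
    by apply: lbmCM => //; apply/lbmCJ/lbmC_ek.
  rewrite [RHS]rmorphM/= rmorph_sum/= mulr_sumr; apply: eq_bigr => i _.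
  rewrite CintZ; last by apply: lbmCM => //; apply/lbmCJ/lbmC_ek.
  congr (_ * _); rewrite -(dotxx hdot) hv; apply: eq_Cint => s _.
  by rewrite /v dotZl.
have sgE s : ip (sg s) (sg s) = \sum_i \sum_j
    (L^-1 ^+ 2)%:C * ip (vh (k i)) (vh (k j)) *
      (e (k i) s * Num.conj (e (k j) s)).
  rewrite dot_suml; apply: eq_bigr => i _.
  rewrite dotZl dot_sumr mulr_sumr; apply: eq_bigr => j _.
  rewrite dotZr rmorphM/= [Num.conj _%:C](_ : _ = L^-1%:C); last first.
    by rewrite NconjE/= oppr0.
  by rewrite rmorphXn/=; ring.
have lee i j : lbmC (fun s => (L^-1 ^+ 2)%:C * ip (vh (k i)) (vh (k j)) *
      (e (k i) s * Num.conj (e (k j) s))).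
  apply: lbmCM; first exact: lbmC_cst.
  by apply: lbmCM; [exact: lbmC_ek|exact/lbmCJ/lbmC_ek].
have lsg : lbmC (fun s => ip (sg s) (sg s)).
  under eq_fun do rewrite sgE.
  by apply: lbmC_sum => i _; apply: lbmC_sum => j _.
have Isg : Cint 0 L (fun s => ip (sg s) (sg s)) = (L^-1 * S)%:C.
  rewrite (eq_Cint (fun s _ => sgE s)) Cint_sum; last first.
    by move=> i _; apply: lbmC_sum => j _.
  rewrite [RHS]rmorphM/= rmorph_sum/= mulr_sumr; apply: eq_bigr => i _.
  rewrite Cint_sum// (bigD1 i)//= big1 ?addr0.
    rewrite CintZ; last by apply: lbmCM; [exact: lbmC_ek|exact/lbmCJ/lbmC_ek].
    rewrite Cint_ek_orth eqxx (dotxx hdot) -!rmorphM/=; congr (_%:C).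
    by field; rewrite gt_eqF.
  move=> j ji; rewrite CintZ; last by apply: lbmCM;
    [exact: lbmC_ek|exact/lbmCJ/lbmC_ek].
  by rewrite Cint_ek_orth (inj_eq ik) eq_sym (negbTE ji) mulr0.
have := @Rint_ge0 _ 0 L (fun s => nm (v s - sg s) ^+ 2) (fun s _ => sqr_ge0 _).
have l1 : lbm (fun s => nm (v s) ^+ 2) by exact: lbm_vnm.
have [l2 _] := lsg; have [l3 _] := lvsg.
rewrite (@eq_Rint _ _ _ _ (fun s => nm (v s) ^+ 2 + Re (ip (sg s) (sg s)) +
   (-2) * Re (ip (v s) (sg s)))); last first.
  by move=> s _; rewrite (nm_sqrD hdot) nmN dotNr cReN -(nm_sqr hdot); ring.
rewrite RintD; [|exact: lbmD|by apply: lbmM => //; exact: lbm_cst].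
rewrite RintD// RintZ//.
have -> : Rint 0 L (fun s => Re (ip (sg s) (sg s))) = L^-1 * S.
  by have := congr1 (@complex.Re R) Isg.
have -> : Rint 0 L (fun s => Re (ip (v s) (sg s))) = L^-1 * S.
  by have := congr1 (@complex.Re R) Ivsg.
rewrite -/I => h; rewrite -ler_pdivrMl//; lra.
Qed.

Lemma uniform_vcont (u : R -> H) (a b eps : R) : vcont u -> 0 < eps ->
  exists2 d, 0 < d & forall s s', a <= s <= b -> `|s' - s| < d ->
    nm (u s' - u s) < eps.
Proof.
move=> cu e0.
have /compact_near_coveringP cpt := @segment_compact R a b.
have := cpt R (0^'+) (fun d s => forall s', `|s' - s| < d ->
  nm (u s' - u s) < eps) _.
move=> [].
  move=> s _; have [|d d0 hd] := cu s (eps / 2); first by rewrite divr_gt0.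
  have d20 : 0 < d / 2 by rewrite divr_gt0.
  exists ([set s1 | `|s1 - s| < d / 2], [set d' | d' < d / 2]) => /=.
    split; first exact: nbhs_dist.
    exact: nbhs_right_lt.
  move=> [s1 d'] /= [h1 h2] s' h3.
  rewrite -[u s' - u s1](subrKA (u s)) (splitr eps).
  rewrite (le_lt_trans (nmD _ _))// ltrD//.
    apply: hd; rewrite (splitr d) -(subrKA s1) (le_lt_trans (ler_normD _ _))//.
    by rewrite ltrD// (lt_trans h3).
  by rewrite nm_distC; apply: hd;
    rewrite (lt_trans h1)// ltr_pdivrMr// ltr_pMr// ltr1n.
move=> d1 /= d10 hd1; exists (d1 / 2); first by rewrite divr_gt0.
move=> s s' hs; apply: (hd1 (d1 / 2)) => /=.
- rewrite sub0r normrN gtr0_norm ?divr_gt0//.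
  by rewrite ltr_pdivrMr// ltr_pMr// ltr1n.
- by rewrite divr_gt0.
- by rewrite in_itv.
Qed.

Lemma nm_1expi (t : R) : nm (1 - expi t) ^+ 2 = 2 - 2 * cos t.
Proof.
rewrite nmc_sq /= sub0r sqrrN; have := cos2Dsin2 t; lra.
Qed.

Lemma cos_le_away (t d : R) : 0 < d -> d <= t <= 2 * pi - d -> cos t <= cos d.
Proof.
move=> d0 /andP[h1 h2]; have [tpi|tpi] := leP t pi.
  move: h1; rewrite le_eqVlt => /predU1P[->//|h1].
  by rewrite ltW// ltr_cos// in_itv/=; apply/andP; split; lra.
have -> : cos t = cos (2 * pi - t).
  by rewrite -[RHS]cosN opprB -[RHS]cosD2pi; congr cos; rewrite mulr2n; ring.
have : d <= 2 * pi - t by lra.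
rewrite le_eqVlt => /predU1P[->//|h3].
by rewrite ltW// ltr_cos// in_itv/=; apply/andP; split; lra.
Qed.

(** Periodicity makes the distance on the circle, measured by the first
character, control the oscillation of u. *)
Lemma oscillation_majorant (u : R -> H) (eps : R) : vcont u -> u 0 = u L ->
  0 < eps -> exists2 K, 0 <= K & forall s s', 0 <= s <= L -> 0 <= s' <= L ->
    nm (u s' - u s) <= eps + K * nm (1 - e 1 (s - s')) ^+ 2.
Proof.
move=> cu u0L e0; have e20 : 0 < eps / 2 by rewrite divr_gt0.
have [d1 d10 hd1] := uniform_vcont 0 L cu e20.
pose d := Num.min d1 (L / 4).
have d0 : 0 < d by rewrite lt_min d10 divr_gt0.
have dL : d <= L / 4 by rewrite ge_min lexx orbT.
have hd s s' : 0 <= s <= L -> `|s' - s| < d -> nm (u s' - u s) < eps / 2.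
  by move=> hs h; apply: hd1 => //; rewrite (lt_le_trans h)// ge_min lexx.
have [M hM] : exists M, forall s, 0 <= s <= L -> nm (u s) <= M.
  have [_ /(_ 0 L)[M hM]] := continuous_lbm (vcont_nm cu).
  by exists M => s /hM; rewrite ger0_norm ?nm_ge0.
have M0 : 0 <= M.
  by apply: le_trans (nm_ge0 (u 0)) (hM 0 _); rewrite lexx ltW.
pose th := 2 * pi / L * d.
have pi0 := pi_gt0 R.
have th0 : 0 < th by rewrite mulr_gt0// divr_gt0// mulr_gt0.
have thpi : th <= pi.
  have -> : pi = 2 * pi / L * (L / 2) :> R by field; rewrite gt_eqF.
  by rewrite /th ler_pM2l ?divr_gt0 ?mulr_gt0//; lra.
pose c := 2 - 2 * cos th.
have c0 : 0 < c.
  have : cos th < cos 0 by rewrite ltr_cos ?in_itv/= ?lexx ?thpi ?(ltW th0) ?(ltW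
    pi0).
  rewrite cos0 /c; lra.
exists (2 * M / c); first by rewrite divr_ge0 ?mulr_ge0// ltW.
move=> s s' hs hs'.
have tail : 0 <= 2 * M / c * nm (1 - e 1 (s - s')) ^+ 2.
  by rewrite mulr_ge0 ?sqr_ge0// divr_ge0 ?mulr_ge0// ltW.
have [near|far] := ltP `|s' - s| d.
  by have := hd _ _ hs near; lra.
have [far2|wrap] := leP `|s' - s| (L - d).
  have hh : nm (u s' - u s) <= 2 * M.
    by rewrite (le_trans (nmB _ _))// mulr2n mulrDl mul1r lerD ?hM.
  have : c <= nm (1 - e 1 (s - s')) ^+ 2.
    rewrite /ek nm_1expi mul1r -cos_norm normrM gtr0_norm ?divr_gt0 ?mulr_gt0//.
    rewrite distrC /c; have : cos (2 * pi / L * `|s' - s|) <= cos th.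
      apply: cos_le_away => //; rewrite /th ler_pM2l ?divr_gt0 ?mulr_gt0// far/=.
      have -> : 2 * pi - 2 * pi / L * d = 2 * pi / L * (L - d).
        by field; rewrite gt_eqF.
      by rewrite ler_pM2l ?divr_gt0 ?mulr_gt0.
    lra.
  move=> hc; have : 2 * M / c * c <= 2 * M / c * nm (1 - e 1 (s - s')) ^+ 2.
    by rewrite ler_wpM2l// divr_ge0 ?mulr_ge0// ltW.
  by rewrite divfK ?gt_eqF//; lra.
have h0 : (0 <= (0:R) <= L) by rewrite lexx ltW.
have hL : 0 <= L <= L by rewrite lexx ltW.
have [ss|ss] := leP s s'.
  have w : s' - s > L - d by move: wrap; rewrite ger0_norm ?subr_ge0.
  have n1 : nm (u s' - u L) < eps / 2.
    by apply: hd => //; rewrite distrC ger0_norm; lra.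
  have n2 : nm (u s - u 0) < eps / 2.
    by apply: hd => //; rewrite subr0 ger0_norm; lra.
  rewrite -[u s' - u s](subrKA (u L)) -{2}u0L; apply: le_trans (nmD _ _) _.
  by rewrite (nm_distC (u 0)); lra.
have w : s - s' > L - d by move: wrap; rewrite distrC ger0_norm ?subr_ge0 ?ltW.
have n1 : nm (u s - u L) < eps / 2.
  by apply: hd => //; rewrite distrC ger0_norm; lra.
have n2 : nm (u s' - u 0) < eps / 2.
  by apply: hd => //; rewrite subr0 ger0_norm; lra.
rewrite -[u s' - u s](subrKA (u 0)) {2}u0L; apply: le_trans (nmD _ _) _.
by rewrite (nm_distC (u L)); lra.
Qed.

Definition dirichlet (n : nat) (t : R) : C := \sum_(j < n) e j%:Z t.

Lemma dirichlet_telescope n t : dirichlet n t * (1 - e 1 t) = 1 - e n%:Z t.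
Proof.
rewrite /dirichlet; elim: n => [|n IH]; first by rewrite big_ord0 mul0r ek0 subrr.
rewrite big_ord_recr/= mulrDl IH mulrBr mulr1 -ekD.
rewrite addrA subrK; congr (1 - e _ t).
by rewrite -addn1 PoszD.
Qed.

Lemma lbmC_ekBs k s : lbmC (fun s' => e k (s - s')).
Proof.
under eq_fun do rewrite ekBs.
by apply: lbmCM; [exact: lbmC_cst|exact/lbmCJ/lbmC_ek].
Qed.

Lemma Cint_ekBs k s :
  Cint 0 L (fun s' => e k (s - s')) = if k == 0 then L%:C else 0.
Proof.
rewrite (@eq_Cint _ _ _ _ (fun s' => e k s * Num.conj (e k s'))); last first.
  by move=> s' _; rewrite ekBs.
rewrite CintZ; last exact/lbmCJ/lbmC_ek.
rewrite Cint_conj; last exact: lbmC_ek.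
rewrite (Cint_ek _ L0); case: eqVneq => [->|_]; last by rewrite rmorph0 mulr0.
by rewrite ek0 mul1r NconjE/= oppr0.
Qed.

Definition fejer_kernel (n : nat) (t : R) : C :=
  n%:R^-1%:C * \sum_(j < n) \sum_(l < n) e (j%:Z - l%:Z) t.

Lemma fejer_kernelE n t :
  fejer_kernel n t = (n%:R^-1 * nm (dirichlet n t) ^+ 2)%:C.
Proof.
rewrite /fejer_kernel rmorphM/= -nm_conjM; congr (_ * _).
rewrite /dirichlet rmorph_sum/= mulr_suml; apply: eq_bigr => j _.
rewrite mulr_sumr; apply: eq_bigr => l _.
by rewrite ekD ekN.
Qed.

Lemma lbmC_fejer_kernel n s : lbmC (fun s' => fejer_kernel n (s - s')).
Proof.
apply: lbmCM; first exact: lbmC_cst.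
by apply: lbmC_sum => j _; apply: lbmC_sum => l _; exact: lbmC_ekBs.
Qed.

Lemma Cint_fejer_kernel n s : (0 < n)%N ->
  Cint 0 L (fun s' => fejer_kernel n (s - s')) = L%:C.
Proof.
move=> n0; rewrite CintZ; last first.
  by apply: lbmC_sum => j _; apply: lbmC_sum => l _; exact: lbmC_ekBs.
rewrite Cint_sum; last by move=> j _; apply: lbmC_sum => l _; exact: lbmC_ekBs.
rewrite (eq_bigr (fun=> L%:C)).
  rewrite sumr_const card_ord.
  have -> : L%:C *+ n = (n%:R : R)%:C * L%:C by rewrite rmorph_nat mulr_natl.
  by rewrite mulrA -rmorphM/= mulVf ?mul1r// pnatr_eq0 -lt0n.
move=> j _; rewrite Cint_sum; last by move=> l _; exact: lbmC_ekBs.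
rewrite (bigD1 j)//= Cint_ekBs subrr eqxx big1 ?addr0// => l lj.
rewrite Cint_ekBs subr_eq0 ifN//; apply: contra lj => /eqP[] h.
by apply/eqP/val_inj.
Qed.

Lemma Rint_fejer_kernel n s : (0 < n)%N ->
  Rint 0 L (fun s' => nm (fejer_kernel n (s - s'))) = L.
Proof.
move=> n0; have := congr1 (@complex.Re R) (Cint_fejer_kernel s n0).
rewrite /= => h; rewrite -[RHS]h; apply: eq_Rint => s' _.
rewrite fejer_kernelE nmR ger0_norm//= mulr_ge0 ?invr_ge0 ?sqr_ge0//.
Qed.

(** The factor 1 - e 1 t telescopes the geometric sum inside the kernel, which
dispenses with any estimate of the kernel away from its peak. *)
Lemma fejer_kernel_tail n t :
  nm (fejer_kernel n t) * nm (1 - e 1 t) ^+ 2 <= 4 / n%:R.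
Proof.
rewrite fejer_kernelE nmR ger0_norm; last by rewrite mulr_ge0 ?invr_ge0 ?sqr_ge0.
rewrite -mulrA -exprMn -nmM dirichlet_telescope mulrC.
apply: ler_wpM2r; first by rewrite invr_ge0.
have h : nm (1 - e n%:Z t) <= 2.
  by rewrite (le_trans (nmB _ _))// nm1 nm_ek.
have := nm_ge0 (1 - e n%:Z t); nra.
Qed.

Section FejerMeans.
Variables (u : R -> H) (uh : int -> H).
Hypotheses (cu : vcont u) (u0L : u 0 = u L).
Hypothesis hu : forall k y,
  ip (uh k) y = Cint 0 L (fun s => Num.conj (e k s) * ip (u s) y).

Definition fejer_mean (n : nat) (s : R) : H :=
  (n%:R * L)^-1%:C *: \sum_(j < n) \sum_(l < n)
    e (j%:Z - l%:Z) s *: uh (j%:Z - l%:Z).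

Lemma fejer_meanE n s y : (0 < n)%N -> ip (fejer_mean n s) y =
  L^-1%:C * Cint 0 L (fun s' => fejer_kernel n (s - s') * ip (u s') y).
Proof.
move=> n0; rewrite dotZl dot_suml.
have l1 k : lbmC (fun s' => e k (s - s') * ip (u s') y).
  by apply: lbmCM; [exact: lbmC_ekBs|exact/cC_lbmC/(vcont_dot hdot)].
rewrite (@eq_Cint _ _ _ _ (fun s' => n%:R^-1%:C * \sum_(j < n) \sum_(l < n)
    (e (j%:Z - l%:Z) (s - s') * ip (u s') y))); last first.
  move=> s' _; rewrite /fejer_kernel -mulrA; congr (_ * _).
  by rewrite mulr_suml; apply: eq_bigr => j _; rewrite mulr_suml.
rewrite CintZ; last by apply: lbmC_sum => j _; apply: lbmC_sum => l _.
rewrite Cint_sum; last by move=> j _; apply: lbmC_sum => l _.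
rewrite mulrA -rmorphM/= -invfM mulrC [L * _]mulrC mulrC; congr (_ * _).
apply: eq_bigr => j _; rewrite Cint_sum; last by move=> l _.
rewrite dot_suml; apply: eq_bigr => l _.
rewrite dotZl hu -CintZ; last first.
  by apply: lbmCM; [exact/lbmCJ/lbmC_ek|exact/cC_lbmC/(vcont_dot hdot)].
by apply: eq_Cint => s' _; rewrite ekBs mulrA.
Qed.

(** The Fejer mean differs from u by an average of the oscillation of u; the
majorant of the oscillation splits it into eps and a term of order 1 / n. *)
Lemma fejer_uniform (eps : R) : 0 < eps ->
  exists2 n, (0 < n)%N & forall s, 0 <= s <= L -> nm (fejer_mean n s - u s) <= eps.
Proof.
move=> e0; have e20 : 0 < eps / 2 by rewrite divr_gt0.
have [K K0 hK] := oscillation_majorant cu u0L e20.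
pose n := (Num.truncn (K * 8 / eps)).+1.
have hn : K * (4 / n%:R) <= eps / 2.
  have : K * 8 / eps < n%:R by exact: truncnS_gt.
  rewrite ltr_pdivrMr// => h; rewrite mulrA ler_pdivrMr ?ltr0n//.
  lra.
exists n => // s hs; apply: (dot_nm_le hdot); first exact: ltW.
move=> y; rewrite dotDl dotNl fejer_meanE//.
have lu w : lbmC (fun s' => ip (u s') w) by exact/cC_lbmC/(vcont_dot hdot).
have lF := lbmC_fejer_kernel n s.
have -> : ip (u s) y =
    L^-1%:C * Cint 0 L (fun s' => fejer_kernel n (s - s') * ip (u s) y).
  rewrite (@eq_Cint _ _ _ _ (fun s' => ip (u s) y * fejer_kernel n (s - s'))).
    rewrite CintZ// Cint_fejer_kernel// mulrCA -rmorphM/= mulVf ?gt_eqF//.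
    by rewrite mulr1.
  by move=> s' _; rewrite mulrC.
rewrite -mulrBr -CintB; [|by apply: lbmCM|by apply: lbmCM => //; exact: lbmC_cst].
rewrite nmM nmR gtr0_norm ?invr_gt0// mulrC ler_pdivrMr//.
have l2 : lbmC (fun s' => fejer_kernel n (s - s') * ip (u s') y -
    fejer_kernel n (s - s') * ip (u s) y).
  apply: lbmCD; first exact: lbmCM.
  by apply: lbmCN; apply: lbmCM => //; exact: lbmC_cst.
rewrite (le_trans (nm_Cint_le _ _ l2))//.
have l3 := lbm_nm lF.
apply: (@le_trans _ _ (Rint 0 L (fun s' =>
    (eps / 2 * nm y) * nm (fejer_kernel n (s - s')) + K * (4 / n%:R) * nm y))).
  apply: le_Rint; first exact: lbm_nm.
    by apply: lbmD; [apply: lbmM => //|]; exact: lbm_cst.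
  move=> s' hs'; rewrite -mulrBr nmM -dotNl -dotDl.
  apply: (@le_trans _ _ (nm (fejer_kernel n (s - s')) *
      ((eps / 2 + K * nm (1 - e 1 (s - s')) ^+ 2) * nm y))).
    rewrite ler_wpM2l ?nm_ge0// (le_trans (nm_dot hdot _ _))//.
    by rewrite ler_wpM2r ?nm_ge0// hK.
  have := fejer_kernel_tail n (s - s').
  move: (nm _ ^+ 2) (nm (fejer_kernel _ _)) => a b h.
  rewrite mulrDl mulrDr -[leLHS]addrC -[leRHS]addrC.
  have := ler_wpM2l K0 h; move/(ler_wpM2r (nm_ge0 y)).
  lra.
rewrite RintD; [|by apply: lbmM => //; exact: lbm_cst|exact: lbm_cst].
rewrite RintZ// Rint_fejer_kernel// Rint_cst; last exact: ltW.
rewrite subr0.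
have : K * (4 / n%:R) * nm y * L <= eps / 2 * nm y * L.
  apply: ler_wpM2r; first exact: ltW.
  by apply: ler_wpM2r => //; exact: nm_ge0.
move: (K * (4 / n%:R)) => w h.
rewrite [leRHS](_ : _ = eps / 2 * nm y * L + eps / 2 * nm y * L); first by lra.
by field.
Qed.

(** A Fourier multiplier that is bounded by Cst on every frequency is bounded
by Cst on square-integrable functions: Parseval, with Bessel on the side of
the data and Fejer summation on the side of the solution. *)
Lemma fourier_multiplier (kappa : R -> C) (X : R -> H) (vh : int -> H) (Cst : R) :
  lbmC kappa -> vcont X -> 0 <= Cst ->
  (forall k y, ip (vh k) y =
     Cint 0 L (fun s => Num.conj (e k s) * (kappa s * ip (X s) y))) ->
  (forall k, nm (uh k) <= Cst * nm (vh k)) ->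
  Rint 0 L (fun s => nm (u s) ^+ 2) <=
  Cst ^+ 2 * Rint 0 L (fun s => nm (kappa s *: X s) ^+ 2).
Proof.
move=> hk cX C0 hv huv; set V := Rint 0 L (fun s => nm (kappa s *: X s) ^+ 2).
have [M hM] : exists M, forall s, 0 <= s <= L -> nm (u s) <= M.
  have [_ /(_ 0 L)[M hM]] := continuous_lbm (vcont_nm cu).
  by exists M => s /hM; rewrite ger0_norm ?nm_ge0.
have M0 : 0 <= M.
  by apply: le_trans (nm_ge0 (u 0)) (hM 0 _); rewrite lexx ltW.
apply/ler_addgt0Pr => eps e0.
have [|n n0 hn] := @fejer_uniform (eps / (M * L + 1)).
  by rewrite divr_gt0// ltr_wpDl// mulr_ge0// ltW.
have fE s : ip (u s) (fejer_mean n s) = (n%:R * L)^-1%:C *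
    \sum_(j < n) \sum_(l < n)
      Num.conj (e (j%:Z - l%:Z) s) * ip (u s) (uh (j%:Z - l%:Z)).
  rewrite dotZr; congr (_ * _); first by rewrite NconjE/= oppr0.
  rewrite dot_sumr; apply: eq_bigr => j _.
  by rewrite dot_sumr; apply: eq_bigr => l _; rewrite dotZr.
have lu w k : lbmC (fun s => Num.conj (e k s) * ip (u s) w).
  by apply: lbmCM; [exact/lbmCJ/lbmC_ek|exact/cC_lbmC/(vcont_dot hdot)].
have ls : lbmC (fun s => \sum_(j < n) \sum_(l < n)
      Num.conj (e (j%:Z - l%:Z) s) * ip (u s) (uh (j%:Z - l%:Z))).
  by apply: lbmC_sum => j _; apply: lbmC_sum => l _.
have lf : lbmC (fun s => ip (u s) (fejer_mean n s)).
  by under eq_fun do rewrite fE; apply: lbmCM => //; exact: lbmC_cst.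
have If : Re (Cint 0 L (fun s => ip (u s) (fejer_mean n s))) <= Cst ^+ 2 * V.
  rewrite (eq_Cint (fun s _ => fE s)) CintZ// ReZl Cint_sum; last first.
    by move=> j _; apply: lbmC_sum => l _.
  rewrite Re_sum mulrC ler_pdivrMr ?mulr_gt0 ?ltr0n//.
  apply: (@le_trans _ _ (\sum_(j < n) Cst ^+ 2 * V * L)); last first.
    by rewrite sumr_const card_ord -[leLHS]mulr_natl le_eqVlt; apply/orP; left;
      apply/eqP; ring.
  apply: ler_sum => j _; rewrite Cint_sum// Re_sum.
  apply: (@le_trans _ _ (\sum_(l < n) Cst ^+ 2 * nm (vh (j%:Z - l%:Z)) ^+ 2)).
    apply: ler_sum => l _; rewrite -hu (dotxx hdot)/= -exprMn.
    by rewrite ler_pXn2r ?nnegrE ?nm_ge0 ?mulr_ge0 ?nm_ge0.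
  rewrite -mulr_sumr -mulrA ler_wpM2l ?sqr_ge0// mulrC.
  apply: (bessel (k := fun l : 'I_n => j%:Z - l%:Z)) => //.
  by move=> l1 l2 /addrI/oppr_inj[] /val_inj.
have [lur _] : lbmC (fun s => ip (u s) (u s)).
  have := lbm_vnm (lbmC_cst 1) cu.
  have -> : (fun s => nm (1 *: u s) ^+ 2) = (fun s => nm (u s) ^+ 2).
    by apply/funext => s; rewrite scale1r.
  by move/lbmCR; congr lbmC; apply/funext => s; rewrite (dotxx hdot).
have [lfr _] := lf.
have -> : Rint 0 L (fun s => nm (u s) ^+ 2) =
    Re (Cint 0 L (fun s => ip (u s) (fejer_mean n s))) +
    Rint 0 L (fun s => Re (ip (u s) (u s)) - Re (ip (u s) (fejer_mean n s))).
  rewrite RintB// addrC subrK; apply: eq_Rint => s _.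
  by rewrite (nm_sqr hdot).
apply: lerD => //.
apply: (@le_trans _ _ (M * (eps / (M * L + 1)) * (L - 0))).
  apply: Rint_le_cst; [exact: ltW|exact: lbmB|] => s hs.
  rewrite -cReN -cReD -dotNr -dotDr (le_trans (nm_triR _))//.
  rewrite (le_trans (nm_dot hdot _ _))// ler_pM ?nm_ge0 ?hM// nm_distC.
  exact: hn.
have h1 : 0 < M * L + 1 by rewrite ltr_wpDl// mulr_ge0// ltW.
rewrite subr0 mulrAC mulrA ler_pdivrMr// mulrC; rewrite ler_wpM2l ?(ltW e0)//.
by rewrite lerDl.
Qed.

End FejerMeans.

End Fourier.

(** * Orbits of a strongly continuous semigroup *)

Section OperatorNorm.
Context {R : realType} {H : completeNormedModType R[i]}.

Lemma opnorm_nm (T : H -> H) (M : R) x : (opnorm T <= M%:E)%E -> nm x <= 1 ->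
  nm (T x) <= M.
Proof.
move=> h hx; rewrite -lee_fin; apply: le_trans h; apply: ereal_sup_ubound.
by exists x => //=; rewrite nmE lecR.
Qed.

Lemma opnorm_bounded (T : {linear H -> H}) (M : R) :
  (opnorm T <= M%:E)%E -> bounded_by T M.
Proof.
move=> h x; have [->|x0] := eqVneq x 0; first by rewrite linear0 !nm0 mulr0.
have nx : 0 < nm x by exact: nm_gt0.
have := @opnorm_nm T M ((nm x)^-1%:C *: x) h.
rewrite linearZ !nmZ nmR gtr0_norm ?invr_gt0// mulVf ?gt_eqF// lexx => /(_ isT).
by rewrite mulrC ler_pdivrMr.
Qed.

End OperatorNorm.

Section HalfLine.
Context {R : realType}.

Lemma max0_dist (s s' : R) : `|Num.max 0 s' - Num.max 0 s| <= `|s' - s|.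
Proof.
rewrite /Num.max; case: ltP => h1; case: ltP => h2; rewrite ?subrr ?normr0//.
- by rewrite subr0 !ger0_norm; lra.
- by rewrite sub0r normrN distrC !ger0_norm; lra.
Qed.

Lemma within_continuousR (f : R -> R) : {within `[0, +oo[, continuous f} ->
  continuous (fun s : R => f (Num.max 0 s)).
Proof.
move=> /subspace_continuousP hf s; apply/cvgrPdist_lt => e e0.
have := hf (Num.max 0 s).
rewrite /= in_itv/= andbT le_max lexx => /(_ isT)/cvgrPdist_lt/(_ e e0).
move=> [d /= d0 hd].
near=> s'; apply: hd.
  apply: le_lt_trans (max0_dist _ _) _; rewrite -distrC.
  near: s'; exact: nbhs_dist.
by rewrite /= in_itv/= andbT le_max lexx.
Unshelve. all: by end_near.
Qed.

Lemma within_vcont (H : completeNormedModType R[i]) (f : R -> H) :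
  {within `[0, +oo[, continuous f} -> vcont (fun s : R => f (Num.max 0 s)).
Proof.
move=> /subspace_continuousP hf s e e0.
have := hf (Num.max 0 s).
rewrite /= in_itv/= andbT le_max lexx => /(_ isT)/cvgrPdist_lt/(_ e%:C).
rewrite ltcR => /(_ e0)[d /= d0 hd].
exists d => // s' hs'; rewrite nm_distC -ltcR -nmE; apply: hd.
  by apply: le_lt_trans (max0_dist _ _) _; rewrite -distrC.
by rewrite /= in_itv/= andbT le_max lexx.
Qed.

Lemma is_derive_eps (G : R -> R) (s g : R) :
  (forall e, 0 < e -> exists2 d, 0 < d & forall h, h != 0 -> `|h| < d ->
     `|h^-1 * (G (h + s) - G s) - g| <= e) ->
  is_derive s (1 : R) G g.
Proof.
move=> hG; have cv : (fun h : R => h^-1 *: ((G \o shift s)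
  (h *: (1 : R)) - G s)) @ 0^' --> g.
  apply/cvgrPdist_le => e e0; have [d d0 hd] := hG e e0.
  exists d => // h /=; rewrite sub0r normrN => hd1 h0.
  by rewrite distrC; rewrite /GRing.scale/= mulr1; exact: hd.
apply: DeriveDef; first by apply/cvg_ex; exists g.
exact: cvg_lim cv.
Qed.

End HalfLine.

Section Semigroup.
Context {R : realType} {H : completeNormedModType R[i]}.
Variables (dot : {dot H for Num.conj}) (hdot : norm_of_dot dot).
Local Notation C := R[i].
Local Notation Re := complex.Re.
Local Notation ip := (ip dot).
Variables (S : R -> {linear H -> H}) (hS : C0_semigroup S).
Local Notation A := (generator S).

(** Orbits, frozen at negative times so as to be continuous on the whole line. *)
Definition orb x (s : R) : H := S (Num.max 0 s) x.

Lemma orbE x s : 0 <= s -> orb x s = S s x.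
Proof. by move=> s0; rewrite /orb max_r. Qed.

Lemma vcont_orb x : vcont (orb x).
Proof. by have [_ _ _ /(_ x)/within_vcont] := hS. Qed.

Lemma orbD x s t : 0 <= s -> 0 <= t -> orb x (s + t) = S s (orb x t).
Proof. by move=> s0 t0; rewrite !orbE ?addr_ge0//; case: hS => _ _ ->. Qed.

Lemma generatorP x y : A (x, y) <-> forall e : R, 0 < e ->
  exists2 d, 0 < d & forall h, 0 < h -> h < d ->
    nm ((h^-1)%:C *: (S h x - x) - y) < e.
Proof.
split=> [/cvgrPdist_lt hA e e0|hA].
  have := hA e%:C; rewrite ltcR => /(_ e0)[d /= d0 hd].
  exists d => // h h0 hlt; rewrite nm_distC -ltcR -nmE; apply: hd => //=.
  by rewrite sub0r normrN gtr0_norm.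
apply/cvgrPdist_lt => e e0.
have eE : e = (Re e)%:C by rewrite RRe_real// gtr0_real.
have [|d d0 hd] := hA (Re e); first by rewrite -ltcR -eE.
exists d => // h /=; rewrite sub0r normrN => hlt h0.
by rewrite eE nmE ltcR nm_distC; apply: hd => //; rewrite -(gtr0_norm h0).
Qed.

Lemma generator_commute (T : {linear H -> H}) x y : continuous T ->
  (forall h z, 0 <= h -> T (S h z) = S h (T z)) -> A (x, y) -> A (T x, T y).
Proof.
move=> /continuous_bounded[M M0 bT] TS /generatorP hA.
apply/generatorP => e e0.
have [|d d0 hd] := hA (e / (M + 1)); first by rewrite divr_gt0// ltr_wpDl.
exists d => // h h0 /(hd _ h0) hlt.
rewrite -TS ?ltW// -linearB -linearZ -linearB (le_lt_trans (bT _))//.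
rewrite (@le_lt_trans _ _ ((M + 1) * nm ((h^-1)%:C *: (S h x - x) - y)))//.
  by rewrite ler_wpM2r ?nm_ge0// lerDl.
by rewrite mulrC -ltr_pdivlMr// ltr_wpDl.
Qed.

Lemma S_commute s t x : 0 <= s -> 0 <= t -> S s (S t x) = S t (S s x).
Proof. by move=> s0 t0; case: hS => _ _ h _; rewrite -!h// addrC. Qed.

Lemma generator_S t x y : 0 <= t -> A (x, y) -> A (S t x, S t y).
Proof.
move=> t0; apply: generator_commute; first by case: hS => + _ _ _; exact.
by move=> h z h0; exact: S_commute.
Qed.

Variables (m : R -> R).
Hypothesis hm_cont : {within `[0, +oo[, continuous m}.
Hypothesis hm_pos : forall t, 0 <= t -> 0 < m t.
Hypothesis hm_bound : forall t, 0 <= t -> (opnorm (S t) <= (m t)%:E)%E.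

Definition mc s := m (Num.max 0 s).

Lemma mc_cont : continuous mc. Proof. exact: within_continuousR. Qed.

Lemma mc_gt0 s : 0 < mc s. Proof. by apply: hm_pos; rewrite le_max lexx. Qed.

Lemma mcE s : 0 <= s -> mc s = m s. Proof. by move=> s0; rewrite /mc max_r. Qed.

Lemma nm_S t x : 0 <= t -> nm (S t x) <= mc t * nm x.
Proof. by move=> t0; rewrite mcE//; exact/opnorm_bounded/hm_bound. Qed.

Lemma nm_orb s x : nm (orb x s) <= mc s * nm x.
Proof.
have s0 : 0 <= Num.max 0 s by rewrite le_max lexx.
by have := nm_S x s0; rewrite mcE.
Qed.

(** Left difference quotients are right difference quotients transported by
the semigroup, so the orbit of a vector in the domain is differentiable from
both sides. *)
Lemma orb_difference_quotient x x1 (s : R) : A (x, x1) -> 0 < s ->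
  forall e, 0 < e -> exists2 d, 0 < d & forall h, h != 0 -> `|h| < d ->
    nm ((h^-1)%:C *: (orb x (h + s) - orb x s) - orb x1 s) < e.
Proof.
move=> /generatorP hA s0 e e0.
have [B hB] : exists B, forall t, 0 <= t <= s -> mc t <= B.
  have [_ /(_ 0 s)[B hB]] := continuous_lbm mc_cont.
  by exists B => t /hB; apply: le_trans; exact: ler_norm.
have B0 : 0 < B by apply: lt_le_trans (mc_gt0 0) (hB 0 _); rewrite lexx ltW.
have [|d1 d10 hd1] := hA (e / 2 / B); first by rewrite !divr_gt0.
have e20 : 0 < e / 2 by rewrite divr_gt0.
have [d2 d20 hd2] := vcont_orb x1 s e20.
have key t h : 0 <= t <= s -> 0 < h -> h < d1 ->
    nm ((h^-1)%:C *: (orb x (h + t) - orb x t) - orb x1 t) < e / 2.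
  move=> /andP[t0 ts] h0 hh.
  have -> : orb x (h + t) = S t (S h x) by rewrite addrC orbD ?(ltW h0)// orbE//
    ltW.
  rewrite !(orbE _ t0) -linearB -linearZ -linearB.
  have h1 := hd1 h h0 hh.
  rewrite (le_lt_trans (nm_S _ t0))//.
  rewrite (@le_lt_trans _ _ (B * nm ((h^-1)%:C *: (S h x - x) - x1)))//.
    by rewrite ler_wpM2r ?nm_ge0// hB// t0.
  by rewrite mulrC -ltr_pdivlMr.
exists (Num.min (Num.min d1 d2) s) => [|h h0]; first by rewrite !lt_min d10 d20.
rewrite !lt_min => /andP[/andP[hd1' hd2'] hs].
have [hpos|hneg] := ltP 0 h.
  rewrite (lt_trans (key s h _ _ _))//.
  - by rewrite lexx ltW.
  - by rewrite -(gtr0_norm hpos).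
  - by rewrite ltr_pdivrMr// ltr_pMr// ltr1n.
have hlt : h < 0 by rewrite lt_neqAle h0.
have hE : `|h| = - h by rewrite ltr0_norm.
have ht : 0 <= h + s <= s by move: hs; rewrite hE => hs; apply/andP; split; lra.
have := key (h + s) (- h) ht; rewrite oppr_gt0 -hE => /(_ hlt hd1').
rewrite hE addrA addNr add0r invrN rmorphN scaleNr -scalerN opprB => k1.
rewrite -[_ - orb x1 s](subrKA (orb x1 (h + s))).
rewrite (le_lt_trans (nmD _ _))// [ltRHS]splitr ltrD//.
by apply: hd2; rewrite addrK.
Qed.

Lemma Cderiv_orb x x1 y a b : A (x, x1) -> 0 <= a ->
  Cderiv (fun s => ip (orb x s) y) (fun s => ip (orb x1 s) y)
    (fun s => a < s < b).
Proof.
move=> hA a0 s /andP[as_ _]; have s0 : 0 < s by exact: le_lt_trans as_.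
have key e : 0 < e -> exists2 d, 0 < d & forall h : R, h != 0 -> `|h| < d ->
    nm ((h^-1)%:C * (ip (orb x (h + s)) y - ip (orb x s) y) - ip (orb x1 s) y)
      <= e.
  move=> e0; have [|d d0 hd] := orb_difference_quotient hA s0 (e := e / (nm y + 1)).
    by rewrite divr_gt0// ltr_wpDl ?nm_ge0.
  exists d => // h h0 /(hd _ h0) hlt.
  rewrite -!dotNl -dotDl -dotZl -dotDl (le_trans (nm_dot hdot _ _))//.
  rewrite (@le_trans _ _ (e / (nm y + 1) * nm y))//.
    by rewrite ler_wpM2r ?nm_ge0// ltW.
  by rewrite mulrAC ler_pdivrMr ?ltr_wpDl ?nm_ge0// ler_wpM2l ?lerDl// ltW.
split; apply: is_derive_eps => e e0; have [d d0 hd] := key e e0;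
  exists d => // h h0 hh; have := hd h h0 hh.
- move=> k; apply: le_trans k; apply: le_trans (Re_le_nm _).
  by rewrite cReD cReN ReZl cReD cReN.
- move=> k; apply: le_trans k; apply: le_trans (Im_le_nm _).
  by rewrite cImD cImN cImM/= mul0r addr0 cImD cImN.
Qed.

End Semigroup.

(** * Resolvents and integrals along orbits *)

Section ResolventGraph.
Context {R : realType} {H : completeNormedModType R[i]}.
Local Notation C := R[i].
Implicit Types (A : set (H * H)) (T : {linear H -> H}).

Definition is_resolvent A (z : C) T :=
  continuous T /\ forall x y, T y = x <-> A (x, z *: x - y).

Variables (A : set (H * H)) (z0 : C) (T0 : {linear H -> H}).
Hypothesis hT0 : is_resolvent A z0 T0.

(** A single point of the resolvent set describes A completely; linearity of the
graph is read off the linear operator T0. *)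
Lemma graphE x y : A (x, y) <-> x = T0 (z0 *: x - y).
Proof.
have := hT0.2 x (z0 *: x - y).
by rewrite subKr => <-; split.
Qed.

Lemma graph_resolvent x : A (T0 x, z0 *: T0 x - x).
Proof. exact/hT0.2. Qed.

Lemma graphD x y x' y' : A (x, y) -> A (x', y') -> A (x + x', y + y').
Proof.
move=> /graphE h /graphE h'; apply/graphE.
by rewrite {1}h {1}h' -linearD scalerDr opprD addrACA.
Qed.

Lemma graphZ a x y : A (x, y) -> A (a *: x, a *: y).
Proof.
move=> /graphE h; apply/graphE.
by rewrite {1}h -linearZ/= scalerBr scalerA mulrC -scalerA.
Qed.

Definition graph_commutes T := continuous T /\
  forall x y, A (x, y) -> A (T x, T y).

Lemma is_resolvent_commutes z T : is_resolvent A z T -> graph_commutes T.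
Proof.
move=> [cT hT]; split=> // x y hxy.
have h : T (z *: x - y) = x by apply/hT; rewrite subKr.
have -> : T y = z *: T x - x by rewrite -{2}h linearB linearZ/= subKr.
exact/hT.
Qed.

Lemma commute_resolvent z T T1 x : is_resolvent A z T -> graph_commutes T1 ->
  T1 (T x) = T (T1 x).
Proof.
move=> [cT hT] [cT1 hT1]; apply/esym/hT.
have : A (T x, z *: T x - x) by apply/hT.
by move/hT1; rewrite linearB linearZ.
Qed.

End ResolventGraph.

Section GeneratorIntegral.
Context {R : realType} {H : completeNormedModType R[i]}.
Variables (dot : {dot H for Num.conj}) (hdot : norm_of_dot dot).
Local Notation C := R[i].
Local Notation ip := (ip dot).
Local Notation pint := (pint dot).
Variables (S : R -> {linear H -> H}) (hS : C0_semigroup S).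
Local Notation A := (generator S).
Local Notation orb := (orb S).
Variables (m : R -> R).
Hypothesis hm_cont : {within `[0, +oo[, continuous m}.
Hypothesis hm_pos : forall t, 0 <= t -> 0 < m t.
Hypothesis hm_bound : forall t, 0 <= t -> (opnorm (S t) <= (m t)%:E)%E.
Variables (z0 : C) (T0 : {linear H -> H}) (hT0 : is_resolvent A z0 T0).

Lemma S_commutes t : 0 <= t -> graph_commutes A (S t).
Proof.
move=> t0; split; first by case: hS => + _ _ _; exact.
by move=> x y; exact: generator_S.
Qed.

Lemma resolvent_orb x s : T0 (orb x s) = orb (T0 x) s.
Proof.
apply/esym/(commute_resolvent _ hT0)/S_commutes.
by rewrite le_max lexx.
Qed.

Lemma pint_resolvent a b phi x : a <= b -> lbmC phi ->
  T0 (pint a b phi (orb x)) = pint a b phi (orb (T0 x)).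
Proof.
move=> ab hp; rewrite (pint_linear hdot)//; [|exact: vcont_orb|by case: hT0].
by congr (pint _ _ _ _); apply/funext => s; rewrite /= resolvent_orb.
Qed.

(** Integration by parts along an orbit: the integral of phi S(s) x lies in the
domain of the generator even when x does not. *)
Lemma generator_integral a b (phi phi' : R -> C) x : 0 <= a -> a <= b ->
  cC phi -> cC phi' -> Cderiv phi phi' (fun s => a < s < b) ->
  A (pint a b phi (orb x),
     phi b *: orb x b - phi a *: orb x a - pint a b phi' (orb x)).
Proof.
move=> a0 ab cp cp' dp; have co y := vcont_orb hS y.
have lp := cC_lbmC cp; have lp' := cC_lbmC cp'.
apply/(graphE hT0); apply: (dot_ext hdot) => y.
set w := phi b *: _ - _ - _.
pose x1 := z0 *: T0 x - x.
have hx1 : A (T0 x, x1) by exact: (graph_resolvent hT0).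
have Tw : ip (T0 w) y = Cint a b (fun s => phi s * ip (orb x1 s) y).
  rewrite (Cint_by_parts ab cp (vcont_dot hdot y (co (T0 x))) cp'
    (vcont_dot hdot y (co x1)) dp).
    rewrite /w !linearB !linearZ/= pint_resolvent// !resolvent_orb.
    by rewrite !(dotDl, dotNl, dotZl) (pintE hdot).
  exact: (Cderiv_orb hdot hS hm_cont hm_pos hm_bound y hx1 a0).
rewrite linearB linearZ/= dotDl dotNl Tw dotZl pint_resolvent// !(pintE hdot)//.
have l1 z : lbmC (fun s => phi s * ip (orb z s) y) by exact: lbmC_dot.
rewrite -CintZ// -CintB//; last by apply: lbmCM => //; exact: lbmC_cst.
apply: eq_Cint => s _.
have -> : orb x1 s = z0 *: orb (T0 x) s - orb x s.
  by rewrite /x1 /orb linearB linearZ.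
by rewrite dotDl dotNl dotZl; ring.
Qed.

End GeneratorIntegral.

(** * The cutoff estimate *)

Lemma vcontZ (R : realType) (H : completeNormedModType R[i]) (c : R -> R[i])
  (X : R -> H) : cC c -> vcont X -> vcont (fun s => c s *: X s).
Proof.
move=> /cC_vcont cc cX s e e0; have e20 : 0 < e / 2 by rewrite divr_gt0.
pose B := nm (c s) + 1 + nm (X s).
have B0 : 0 < B by rewrite /B; have := nm_ge0 (c s); have := nm_ge0 (X s); lra.
have m0 : 0 < Num.min 1 (e / 2 / B) by rewrite lt_min ltr01 !divr_gt0.
have [d1 d10 h1] := cc s _ m0.
have [d2 d20 h2] := cX s _ (divr_gt0 e20 B0).
exists (Num.min d1 d2) => [|s']; first by rewrite lt_min d10.
rewrite lt_min => /andP[/h1 + /h2 k2]; rewrite lt_min => /andP[k0 k1].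
have -> : c s' *: X s' - c s *: X s = c s' *: (X s' - X s) + (c s' - c s) *: X s.
  by rewrite scalerBr scalerBl addrA subrK.
rewrite (le_lt_trans (nmD _ _))// !nmZ.
have nc : nm (c s') <= nm (c s) + 1 by rewrite addrC; apply: nm_split => //;
  exact: ltW.
move: k1 k2; rewrite !ltr_pdivlMr// /B => k1 k2.
have := nm_ge0 (c s); have := nm_ge0 (X s); have := nm_ge0 (c s').
have := nm_ge0 (X s' - X s); have := nm_ge0 (c s' - c s).
move: (nm (X s' - X s)) (nm (c s' - c s)) (nm (X s)) (nm (c s))
  (nm (c s')) nc k1 k2.
clear=> x1 x2 x3 x4 x5 nc k1 k2 p2 p1 p5 p3 p4.
have q1 : x5 * x1 <= (x4 + 1) * x1 by rewrite ler_wpM2r.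
have q2 : 0 <= x1 * x3 by rewrite mulr_ge0.
have q3 : 0 <= x2 * (x4 + 1) by rewrite mulr_ge0 ?addr_ge0.
lra.
Qed.

Section CutoffEstimate.
Context {R : realType} {H : completeNormedModType R[i]}.
Variables (dot : {dot H for Num.conj}) (hdot : norm_of_dot dot).
Local Notation C := R[i].
Local Notation pint := (pint dot).
Variables (S : R -> {linear H -> H}) (hS : C0_semigroup S).
Local Notation A := (generator S).
Local Notation orb := (orb S).
Variables (m : R -> R).
Hypothesis hm_cont : {within `[0, +oo[, continuous m}.
Hypothesis hm_pos : forall t, 0 <= t -> 0 < m t.
Hypothesis hm_bound : forall t, 0 <= t -> (opnorm (S t) <= (m t)%:E)%E.
Local Notation mc := (mc m).
Variables (z0 : C) (T0 : {linear H -> H}) (hT0 : is_resolvent A z0 T0).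

(** The density of the square of the weighted norm of 1 / m. *)
Definition weight (w s : R) : R := expR (2 * w * s) * (mc s)^-1 ^+ 2.

(** The squared norm of the orbit of x under the semigroup generated by A - w. *)
Definition energy (w : R) (x : H) (s : R) : R :=
  expR (- (2 * w * s)) * nm (orb x s) ^+ 2.

Lemma expR_lin_cont (c : R) : continuous (fun s : R => expR (c * s)).
Proof.
move=> s; apply: (@continuous_comp _ _ _ (fun s => c * s) (@expR R)).
  exact: continuous_mulRl.
exact: continuous_expR.
Qed.

Lemma weight_cont w : continuous (weight w).
Proof.
apply: contM; first exact: expR_lin_cont.
have ci : continuous (fun s => (mc s)^-1).
  move=> s; apply: continuousV; last exact: (mc_cont hm_cont).
  by rewrite gt_eqF// (mc_gt0 hm_pos).
by under eq_fun do rewrite expr2; exact: contM.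
Qed.

Lemma weight_gt0 w s : 0 < weight w s.
Proof. by rewrite mulr_gt0 ?expR_gt0// exprn_gt0// invr_gt0 (mc_gt0 hm_pos). Qed.

Lemma energy_cont w x : continuous (energy w x).
Proof.
have -> : energy w x =
    (fun s => expR ((- (2 * w)) * s) * (nm (orb x s) * nm (orb x s))).
  by apply/funext => s; rewrite /energy mulNr expr2.
apply: contM; first exact: expR_lin_cont.
by apply: contM; apply: vcont_nm; exact: vcont_orb.
Qed.

Lemma energy_ge0 w x s : 0 <= energy w x s.
Proof. by rewrite mulr_ge0 ?sqr_ge0// expR_ge0. Qed.

Lemma Rint_weight_gt0 w a : 0 < a -> 0 < Rint 0 a (weight w).
Proof.
move=> a0; have ci : continuous (fun s => (weight w s)^-1).
  by move=> s; apply: continuousV; [rewrite gt_eqF ?weight_gt0|exact: weight_cont].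
have [_ /(_ 0 a)[M hM]] := continuous_lbm ci.
have M0 : 0 < M.
  apply: lt_le_trans (hM 0 _); last by rewrite lexx ltW.
  by rewrite normr_gt0 invr_neq0// gt_eqF// weight_gt0.
apply: (@lt_le_trans _ _ (M^-1 * (a - 0)));
  first by rewrite subr0 mulr_gt0 ?invr_gt0.
rewrite -Rint_cst; last exact: ltW.
apply: le_Rint; [exact: lbm_cst|exact/continuous_lbm/weight_cont|].
move=> s /hM; rewrite gtr0_norm ?invr_gt0 ?weight_gt0// => h.
by rewrite -[leRHS]invrK lef_pV2 ?posrE ?invr_gt0 ?weight_gt0.
Qed.

Variables (w L : R) (x : H).
Local Notation e := (ek L).
Definition freq (k : int) : C := w +i* (k%:~R * (2 * pi / L)).
(** The function exp (- freq k * s), factored so that the integrals against it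
are Fourier coefficients of exponentially weighted functions. *)
Definition damped_ek (k : int) (s : R) : C := (expR (- w * s))%:C * e (- k) s.

Lemma cC_damped_ek k : cC (damped_ek k).
Proof. by apply: cCM; [exact/cCR/expR_lin_cont|exact: cC_ek]. Qed.

Lemma Cderiv_damped_ek k P : Cderiv (damped_ek k)
  (fun s => - freq k * damped_ek k s) P.
Proof.
have h1 : Cderiv (fun s => (expR (- w * s))%:C)
  (fun s => (- w * expR (- w * s))%:C) P.
  move=> s _; split => /=.
    by apply: is_derive_eq; rewrite /GRing.scale/=; ring.
  exact: is_derive_cst.
have := CderivM h1 (@Cderiv_expi _ ((- k)%:~R * (2 * pi / L)) P).
move=> h s Ps; have := h s Ps.
rewrite (_ : _ + _ = - freq k * damped_ek k s)//.
rewrite /damped_ek /freq /ek rmorphN/=; apply: Cext;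
  rewrite !(cReD, cImD, cReM, cImM)/=; ring.
Qed.

(** A cutoff chi puts chi' S(s) x on the right-hand side of the equation solved
by the orbit. The boundary terms cancel between consecutive pieces. *)
Lemma generator_piece k a b (chi chi' : R -> R) : 0 <= a -> a <= b ->
  continuous chi -> continuous chi' ->
  (forall s, is_derive s (1 : R) chi (chi' s)) ->
  let U := pint a b (fun s => (chi s)%:C * damped_ek k s) (orb x) in
  let V := pint a b (fun s => (chi' s)%:C * damped_ek k s) (orb x) in
  A (U, ((chi b)%:C * damped_ek k b) *: orb x b
    - ((chi a)%:C * damped_ek k a) *: orb x a
        + (freq k *: U - V)).
Proof.
move=> a0 ab cc cc' dc U V.
have cphi : cC (fun s => (chi s)%:C * damped_ek k s).
  by apply: cCM; [exact: cCR|exact: cC_damped_ek].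
have cphi1 : cC (fun s => (chi' s)%:C * damped_ek k s).
  by apply: cCM; [exact: cCR|exact: cC_damped_ek].
have cphi' : cC (fun s => (chi' s)%:C * damped_ek k s
  + (chi s)%:C * (- freq k * damped_ek k s)).
  apply: cCD => //; apply: cCM; first exact: cCR.
  by apply: cCM; [exact: cC_cst|exact: cC_damped_ek].
have dphi : Cderiv (fun s => (chi s)%:C * damped_ek k s)
    (fun s => (chi' s)%:C * damped_ek k s + (chi s)%:C * (- freq k * damped_ek k s))
    (fun s => a < s < b).
  apply: (CderivM _ (@Cderiv_damped_ek k _)) => s _; split => /=; first exact: dc.
  exact: is_derive_cst.
have := generator_integral hdot hS hm_cont hm_pos hm_bound hT0 (x := x) a0 ab
  cphi cphi' dphi.
congr (A (_, _ + _)).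
have co := vcont_orb hS x.
rewrite -opprB; congr (- _); apply: (dot_ext hdot) => y.
rewrite dotDl dotNl dotZl !(pintE hdot)//; last 3 first.
- exact: cC_lbmC.
- exact: cC_lbmC.
- exact: cC_lbmC.
have l1 := lbmC_dot hdot y (cC_lbmC cphi) co.
have l2 := lbmC_dot hdot y (cC_lbmC cphi1) co.
rewrite -CintZ// -CintB//; last by apply: lbmCM => //; exact: lbmC_cst.
by apply: eq_Cint => s _; ring.
Qed.

End CutoffEstimate.

Lemma telescope3 (V : zmodType) (b1 b2 p1 p2 p3 v1 v2 v3 : V) :
  b1 + (p1 - v1) + (b2 - b1 + (p2 - v2)) + (0 - b2 + (p3 - v3)) =
  p1 + p2 + p3 - (v1 + v2 + v3).
Proof.
rewrite sub0r [X in X + (- b2 + _)]addrACA (addrC b1) subrK addrACA subrr add0r.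
by rewrite !opprD [X in X + (p3 - v3)]addrACA [LHS]addrACA.
Qed.

Lemma eq_Cint_oc (R : realType) (a b : R) (f g : R -> R[i]) : lbmC f -> lbmC g ->
  (forall s, a < s <= b -> f s = g s) -> Cint a b f = Cint a b g.
Proof.
by move=> [fr fi] [gr gi] h; congr Complex; apply: eq_Rint_oc => // s /h ->.
Qed.

Section Cutoff.
Context {R : realType} {H : completeNormedModType R[i]}.
Variables (dot : {dot H for Num.conj}) (hdot : norm_of_dot dot).
Local Notation C := R[i].
Local Notation Re := complex.Re.
Local Notation ip := (ip dot).
Local Notation pint := (pint dot).
Variables (S : R -> {linear H -> H}) (hS : C0_semigroup S).
Local Notation A := (generator S).
Local Notation orb := (orb S).
Variables (m : R -> R).
Hypothesis hm_cont : {within `[0, +oo[, continuous m}.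
Hypothesis hm_pos : forall t, 0 <= t -> 0 < m t.
Hypothesis hm_bound : forall t, 0 <= t -> (opnorm (S t) <= (m t)%:E)%E.
Local Notation mc := (mc m).
Local Notation weight := (weight m).
Local Notation energy := (energy S).
Variables (z0 : C) (T0 : {linear H -> H}) (hT0 : is_resolvent A z0 T0).

Lemma pint_cat3 a b c d (k k1 k2 k3 : R -> C) X : a <= b -> b <= c -> c <= d ->
  lbmC k -> lbmC k1 -> lbmC k2 -> lbmC k3 -> vcont X ->
  (forall s, a < s <= b -> k s = k1 s) -> (forall s, b < s <= c -> k s = k2 s) ->
  (forall s, c < s <= d -> k s = k3 s) ->
  pint a d k X = pint a b k1 X + pint b c k2 X + pint c d k3 X.
Proof.
move=> ab bc cd hk hk1 hk2 hk3 cX e1 e2 e3; apply: (dot_ext hdot) => y.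
have ac := le_trans ab bc; have ad := le_trans ac cd.
rewrite !dotDl !(pintE hdot)//.
have l z : lbmC z -> lbmC (fun s => z s * ip (X s) y) by move=> hz; exact: lbmC_dot.
rewrite (Cint_cat (l _ hk) ac cd) (Cint_cat (l _ hk) ab bc).
congr (_ + _ + _); apply: eq_Cint_oc; try exact: l.
- by move=> s /e1 ->.
- by move=> s /e2 ->.
- by move=> s /e3 ->.
Qed.

Variables (w : R) (x : H) (Q : {linear H -> H}) (Cst : R).
Hypotheses (cQ : continuous Q)
  (QS : forall t z, 0 <= t -> Q (S t z) = S t (Q z)) (Qx : Q x = 0).
Hypotheses (C0 : 0 <= Cst)
  (mult : forall (z : C) u v, Re z = w -> Q u = 0 -> A (u, z *: u - v) ->
     nm u <= Cst * nm v).
Variables (a b : R) (a0 : 0 < a) (ab : a <= b).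

Let L := b + 1.
Let I := Rint 0 a (weight w).

(** The cutoff rises from 0 to 1 on [0, a] with a derivative proportional to the
weight: this profile minimizes the integral of chi' ^ 2 / weight. On [b, b + 1]
it falls back to 0, which makes the truncated orbit periodic. On the Fourier
side z - A maps the truncated orbit to the data created by chi', for frequencies
z on the line Re z = w, where mult inverts this relation. *)
Lemma cutoff_estimate : Rint a b (energy w x) <=
  Cst ^+ 2 * (nm x ^+ 2 / I + Rint b (b + 1) (energy w x)).
Proof.
have L0 : 0 < L by rewrite /L; move: a0 ab; lra.
have b0 : 0 <= b by move: a0 ab; lra.
have bL : b <= L by rewrite /L lerDl.
have aL : a <= L by exact: le_trans ab bL.
have I0 : 0 < I by exact: Rint_weight_gt0.
have cw : continuous (weight w) by exact: weight_cont.
have [F dF] := continuous_antiderivative cw.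
have cF := is_derive_continuous dF.
pose chi s := I^-1 * (F s - F 0).
have dchi s : is_derive s (1 : R) chi (I^-1 * weight w s).
  have h := dF s; rewrite -[weight w s]subr0.
  exact: is_deriveZ.
have cchi := is_derive_continuous dchi.
have cchi' : continuous (fun s => I^-1 * weight w s).
  by apply: contM => //; exact: cst_continuous.
have chi0 : chi 0 = 0 by rewrite /chi subrr mulr0.
have chia : chi a = 1.
  rewrite /chi -(@FTC2 _ F (weight w))//; [|exact: ltW].
  by rewrite mulVf// gt_eqF.
pose psi s := chi (Num.min s a) * Num.min 1 (L - s).
pose kap s := if s <= a then I^-1 * weight w s else if s <= b then 0 else -1.
have psi1 s : s <= a -> psi s = chi s.
  move=> sa; rewrite /psi min_l// (_ : Num.min 1 (L - s) = 1) ?mulr1//.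
  by apply: min_l; rewrite /L; move: sa ab; lra.
have psi2 s : a <= s -> s <= b -> psi s = 1.
  move=> sa sb; rewrite /psi min_r// chia mul1r.
  by apply: min_l; rewrite /L; move: sb; lra.
have psi3 s : b <= s -> psi s = L - s.
  move=> sb; rewrite /psi min_r ?chia ?mul1r; last exact: le_trans ab sb.
  by apply: min_r; rewrite /L; move: sb; lra.
have cpsi : continuous psi.
  have cmin (c : R) : continuous (fun s => Num.min s c).
    by move=> s; apply: continuous_min; [exact: cvg_id|exact: cvg_cst].
  apply: contM.
    move=> s; apply: (@continuous_comp _ _ _ (fun s => Num.min s a) chi).
      exact: cmin.
    exact: cchi.
  under eq_fun do rewrite minC.
  move=> s; apply: (@continuous_comp _ _ _ (fun s => L - s) (fun s => Num.min s 1)).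
    by apply: contD; [exact: cst_continuous|apply: contN => t; exact: cvg_id].
  exact: cmin.
have lkap : lbm kap.
  have mle (c : R) : measurable [set s : R | s <= c].
    have -> : [set s : R | s <= c] = `]-oo, c]%classic by apply/seteqP;
      split => s /=; rewrite in_itv.
    exact: measurable_itv.
  apply: lbm_ite => //; first exact: continuous_lbm.
  by apply: lbm_ite => //; exact: lbm_cst.
pose X := orb x; have cX : vcont X := vcont_orb hS x.
pose ew s := expR (- w * s).
have cew : continuous ew by exact: expR_lin_cont.
pose u s := (psi s * ew s)%:C *: X s.
pose kappa s := (kap s * ew s)%:C.
have cu : vcont u by apply: vcontZ => //; exact/cCR/contM.
have lkappa : lbmC kappa by apply/lbmCR/lbmM => //; exact: continuous_lbm.
have u0 : u 0 = 0 by rewrite /u psi1 ?chi0 ?mul0r ?scale0r// ltW.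
have uL : u L = 0 by rewrite /u psi3// subrr mul0r scale0r.
pose E := damped_ek w L.
pose uh k := pint 0 L (fun s => (psi s)%:C * E k s) X.
pose vh k := pint 0 L (fun s => (kap s)%:C * E k s) X.
have lE k : lbmC (E k) by exact/cC_lbmC/cC_damped_ek.
have lp (f : R -> R) k : lbm f -> lbmC (fun s => (f s)%:C * E k s).
  by move=> hf; apply: lbmCM => //; exact: lbmCR.
have lpsi : lbm psi by exact: continuous_lbm.
have hu k y : ip (uh k) y = Cint 0 L (fun s => Num.conj (ek L k s) * ip (u s) y).
  rewrite (pintE hdot); [|exact: ltW|exact: lp|exact: cX].
  apply: eq_Cint => s _;
    rewrite /u dotZl /E /damped_ek ekN [(psi s * _)%:C]rmorphM/= /ew; ring.
have hv k y : ip (vh k) y =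
    Cint 0 L (fun s => Num.conj (ek L k s) * (kappa s * ip (X s) y)).
  rewrite (pintE hdot); [|exact: ltW|exact: lp|exact: cX].
  apply: eq_Cint => s _;
    rewrite /kappa /E /damped_ek ekN [(kap s * _)%:C]rmorphM/= /ew; ring.
have Quh k : Q (uh k) = 0.
  rewrite (pint_linear hdot); [|exact: ltW|exact: lp|exact: cX|exact: cQ].
  apply: (dot_ext hdot) => y; rewrite (pintE hdot); [|exact: ltW|exact: lp|].
    rewrite dot0l (@eq_Cint _ _ _ _ (fun=> 0)); last first.
      move=> s _; rewrite /= /X /orb QS ?le_max ?lexx// Qx.
      by rewrite linear0 dot0l mulr0.
    by rewrite Cint_cst ?mul0r// ltW.
  exact: vcont_linear.
have huv k : nm (uh k) <= Cst * nm (vh k).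
  apply: (mult (z := freq w L k)) => //.
  have G1 := generator_piece hdot hS hm_cont hm_pos hm_bound hT0 (w := w)
    (L := L) (x := x) (k := k)
    (lexx 0) (ltW a0) cchi cchi' dchi.
  have d1 (s : R) : is_derive s (1 : R) (fun=> 1 : R) 0 by exact: is_derive_cst.
  have G2 := generator_piece hdot hS hm_cont hm_pos hm_bound hT0 (w := w)
    (L := L) (x := x) (k := k)
    (ltW a0) ab (@cst_continuous _ _ (1 : R)) (@cst_continuous _ _ (0 : R)) d1.
  have d3 (s : R) : is_derive s (1 : R) (fun s => L - s) (-1).
    by rewrite -[- 1 : R]add0r; apply: is_deriveD.
  have c3 := is_derive_continuous d3.
  have G3 := generator_piece hdot hS hm_cont hm_pos hm_bound hT0 (w := w)
    (L := L) (x := x) (k := k)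
    b0 bL c3 (@cst_continuous _ _ (-1 : R)) d3.
  have := graphD hT0 (graphD hT0 G1 G2) G3.
  rewrite /= chi0 chia subrr (_ : L - b = 1); last by rewrite /L addrAC subrr add0r.
  rewrite rmorph0 rmorph1 !mul0r !scale0r !subr0 !mul1r.
  set U1 := pint 0 a _ _; set U2 := pint a b _ _; set U3 := pint b L _ _.
  set V1 := pint 0 a _ _; set V2 := pint a b _ _; set V3 := pint b L _ _.
  have Us : U1 + U2 + U3 = uh k.
    apply/esym/pint_cat3 => //; try exact: ltW; try exact: lp.
    + by apply: lp; exact: continuous_lbm.
    + by apply: lp; exact: lbm_cst.
    + by apply: lp; exact: continuous_lbm.
    + by move=> s /andP[_ sa]; rewrite psi1.
    + by move=> s /andP[sa sb]; rewrite psi2// ltW.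
    + by move=> s /andP[sb _]; rewrite psi3// ltW.
  have Vs : V1 + V2 + V3 = vh k.
    apply/esym/pint_cat3 => //; try exact: ltW; try exact: lp.
    + by apply: lp; exact: continuous_lbm.
    + by apply: lp; exact: lbm_cst.
    + by apply: lp; exact: lbm_cst.
    + by move=> s /andP[_ sa]; rewrite /kap sa.
    + by move=> s /andP[sa sb]; rewrite /kap leNgt sa sb.
    + move=> s /andP[sb _]; rewrite /kap leNgt (le_lt_trans ab sb)/=.
      by rewrite leNgt sb.
  move: Us Vs (freq w L k) (_ *: orb x a) (_ *: orb x b) => + + z B1 B2.
  move: (uh k) (vh k) (U1) (U2) (U3) (V1) (V2) (V3).
  move=> uk vk u1 u2 u3 v1 v2 v3 <- <-.
  by rewrite telescope3 -!scalerDr.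
have ln : lbm (fun s => nm (u s) ^+ 2).
  have := lbm_vnm (lbmC_cst 1) cu; congr lbm; apply/funext => s.
  by rewrite scale1r.
have lv : lbm (fun s => nm (kappa s *: X s) ^+ 2) by exact: lbm_vnm.
have le : lbm (energy w x) by exact/continuous_lbm/energy_cont.
have lw := continuous_lbm cw.
have eE s (c : R) : nm ((c * ew s)%:C *: X s) ^+ 2 = c ^+ 2 * energy w x s.
  rewrite nmZ nmR exprMn real_normK ?num_real// exprMn /energy /ew mulrA.
  congr (_ * _ * _); rewrite expr2 -expRD; congr expR; ring.
have main := fourier_multiplier hdot L0 cu (etrans u0 (esym uL)) hu lkappa cX C0
  hv huv.
apply: (@le_trans _ _ (Rint 0 L (fun s => nm (u s) ^+ 2))).
  rewrite (Rint_cat ln (ltW a0) aL) (Rint_cat ln ab bL).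
  rewrite (@eq_Rint _ a b (energy w x) (fun s => nm (u s) ^+ 2)); last first.
    by move=> s /andP[sa sb]; rewrite /u eE psi2// expr1n mul1r.
  rewrite addrCA lerDl addr_ge0//.
    by apply: Rint_ge0 => s _; exact: sqr_ge0.
  by apply: Rint_ge0 => s _; exact: sqr_ge0.
apply: (le_trans main); rewrite ler_wpM2l ?sqr_ge0//.
rewrite (Rint_cat lv (ltW a0) aL) (Rint_cat lv ab bL).
have -> : Rint a b (fun s => nm (kappa s *: X s) ^+ 2) = 0.
  rewrite (@eq_Rint_oc _ _ _ _ (fun=> 0)) ?Rint_cst ?mul0r//; first exact: lbm_cst.
  move=> s /andP[sa sb]; rewrite /kappa eE /kap leNgt sa sb/=.
  by rewrite expr0n mul0r.
rewrite add0r lerD//.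
  apply: (@le_trans _ _ (Rint 0 a (fun s => nm x ^+ 2 / I ^+ 2 * weight w s))).
    apply: le_Rint => //; first by apply: lbmM => //; exact: lbm_cst.
    move=> s /andP[s0 sa]; rewrite /kappa eE /kap sa /energy.
    have mp := mc_gt0 hm_pos s.
    have I1 : I != 0 by rewrite gt_eqF.
    have -> : (I^-1 * weight w s) ^+ 2 * (expR (- (2 * w * s)) * nm (orb x s) ^+
      2) =
        I^-1 ^+ 2 * (weight w s * (nm (orb x s) ^+ 2 / mc s ^+ 2)).
      rewrite exprMn -!(mulrA (I^-1 ^+ 2)); congr (_ * _).
      rewrite expr2 -!(mulrA (weight w s)); congr (_ * _); rewrite /weight expRN.
      by field; rewrite !gt_eqF ?expR_gt0.
    rewrite [leRHS](_ : _ = I^-1 ^+ 2 * (nm x ^+ 2 * weight w s)); last by field.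
    apply: ler_wpM2l; first exact: sqr_ge0.
    rewrite [leRHS]mulrC; apply: ler_wpM2l; first exact/ltW/weight_gt0.
    rewrite ler_pdivrMr ?exprn_gt0// -exprMn mulrC ler_pXn2r ?nnegrE ?nm_ge0//.
      exact: nm_orb.
    by rewrite mulr_ge0 ?nm_ge0// ltW.
  rewrite RintZ// -/I expr2 invfM -!mulrA mulVf ?mulr1//.
  by rewrite gt_eqF.
rewrite (@eq_Rint_oc _ _ _ _ (energy w x))//.
move=> s /andP[sb _]; rewrite /kappa eE /kap leNgt (le_lt_trans ab sb)/=.
by rewrite leNgt sb/= sqrrN expr1n mul1r.
Qed.

End Cutoff.

(** * Liouville's theorem *)

Section Liouville.
Context {R : realType}.
Local Notation C := R[i].
Local Notation Re := complex.Re.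
Local Notation Im := complex.Im.

(** Second-order Taylor expansion with a cubic remainder: the only consequence
of holomorphy that the proof of Liouville's theorem uses. *)
Definition expands2 (V : normedModType R[i]) (f : C -> V) (z : C) :=
  exists c1 c2 K d, [/\ 0 <= K, 0 < d & forall h : C, nm h < d ->
    nm (f (z + h) - f z - h *: c1 - (h ^+ 2) *: c2) <= K * nm h ^+ 3].

Variable F : C -> C.
Hypothesis hF : forall z, @expands2 R[i]^o F z.
Hypothesis F0 : forall eps : R, 0 < eps -> exists M, forall z, M <= nm z ->
  nm (F z) <= eps.

Lemma expands2_cont z eps : 0 < eps ->
  exists2 d, 0 < d & forall z', nm (z' - z) < d -> nm (F z' - F z) < eps.
Proof.
move=> e0; have [c1 [c2 [K [d [K0 d0 hd]]]]] := hF z.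
pose B := nm c1 + nm c2 + K + 1.
have [n1 n2] := (nm_ge0 c1, nm_ge0 c2).
have B0 : 0 < B by rewrite /B; lra.
exists (Num.min d (Num.min 1 (eps / B)));
  first by rewrite !lt_min d0 ltr01 divr_gt0.
move=> z'; rewrite !lt_min => /and3P[h1 h2 h3].
set h := z' - z in h1 h2 h3 *.
have zE : z + h = z' by rewrite addrC subrK.
have := hd h h1; rewrite zE => k.
have h0 := nm_ge0 h.
have le2 : nm h ^+ 2 <= nm h by rewrite expr2 ler_piMl// ltW.
have le3 : nm h ^+ 3 <= nm h.
  by rewrite exprS (le_trans _ le2)// expr2 ler_wpM2l// -expr2.
have : nm (F z' - F z) <= K * nm h ^+ 3 + nm h ^+ 2 * nm c2 + nm h * nm c1.
  apply: (nm_split (y := h *: (c1 : R[i]^o))); last by rewrite nmZ.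
  by apply: (nm_split (y := h ^+ 2 *: (c2 : R[i]^o))); [exact: k|rewrite nmZ nmX].
move=> /le_lt_trans; apply.
rewrite (@le_lt_trans _ _ (nm h * B))//; last by rewrite -ltr_pdivlMr.
have a1 := ler_wpM2l K0 le3; have a2 := ler_wpM2r n2 le2.
by rewrite /B; lra.
Qed.

(** The increments t, - t, i t, - i t and their squares sum to zero, so the terms
of order 1 and 2 cancel. *)
Lemma four_point z : exists K d, [/\ 0 <= K, 0 < d & forall t : R, 0 < t -> t < d ->
  Re (F (z + t%:C)) + Re (F (z - t%:C)) + Re (F (z + t *i)) + Re (F (z - t *i))
   - 4 * Re (F z) >= - (K * t ^+ 3)].
Proof.
have [c1 [c2 [K [d [K0 d0 hd]]]]] := hF z.
exists (4 * K), d; split => //; first by rewrite mulr_ge0.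
move=> t t0 td.
have nt : nm (t%:C) = t by rewrite nmR gtr0_norm.
have nit : nm (t *i : C) = t.
  by rewrite nmc/= expr0n/= add0r sqrtr_sqr gtr0_norm.
have key (h : C) : nm h < d -> - (K * nm h ^+ 3) <=
    Re (F (z + h)) - Re (F z) - (Re h * Re c1 - Im h * Im c1)
    - ((Re h ^+ 2 - Im h ^+ 2) * Re c2 - 2 * Re h * Im h * Im c2).
  move=> /hd k; rewrite lerNl; apply: le_trans k; rewrite -nmN.
  apply: le_trans (nm_triR _).
  rewrite cReN !(cReD, cReN) [Re (h *: _)]cReM [Re (h ^+ 2 *: _)]cReM expr2 cReM
    cImM.
  by rewrite le_eqVlt; apply/orP; left; apply/eqP; ring.
have h1 := key t%:C; have h2 := key (- t%:C).
have h3 := key (t *i); have h4 := key (- (t *i)).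
move: h1 h2 h3 h4; rewrite !nmN nt nit => /(_ td) + /(_ td) + /(_ td) + /(_ td).
rewrite /= !oppr0 !expr0n/= sqrrN => h1 h2 h3 h4; lra.
Qed.

Lemma rect_max (g : C -> R) (z : C) (rho : R) :
  (forall z' eps, 0 < eps -> exists2 d, 0 < d & forall z1, nm (z1 - z') < d ->
     `|g z1 - g z'| < eps) -> 0 <= rho ->
  exists z', [/\ `|Re (z' - z)| <= rho, `|Im (z' - z)| <= rho &
    forall z1, `|Re (z1 - z)| <= rho -> `|Im (z1 - z)| <= rho -> g z1 <= g z'].
Proof.
move=> cg r0; pose ga (s : R * R) := g (z + (s.1 +i* s.2)).
pose I : set R := `[- rho, rho]%classic.
have cI : compact (I `*` I) by apply: compact_setX; exact: segment_compact.
have cga : continuous ga.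
  move=> s; apply/cvgrPdist_lt => eps e0.
  have [d d0 hd] := cg (z + (s.1 +i* s.2)) _ e0.
  have d20 : 0 < d / 2 by rewrite divr_gt0.
  exists ([set x | `|x - s.1| < d / 2], [set y | `|y - s.2| < d / 2]).
    by split; exact: nbhs_dist.
  move=> [x y] /= [hx hy]; rewrite distrC; apply: hd.
  rewrite (le_lt_trans (nm_le_ReIm _))// !(cReD, cImD, cReN, cImN)/=.
  by rewrite !opprD !addrA ![_ + x]addrC ![_ + y]addrC !addrK [ltRHS]splitr ltrD.
have I0 : (I `*` I) !=set0.
  by exists (0, 0); split; rewrite /I /= in_itv/= oppr_le0 r0.
have [s sI hmax] := compact_EVT_max I0 cI (continuous_subspaceT cga).
move: sI; rewrite inE => -[/= hs1 hs2].
exists (z + (s.1 +i* s.2)); rewrite addrC addKr; split => /=.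
- by rewrite ler_norml; move: hs1; rewrite /I /= in_itv.
- by rewrite ler_norml; move: hs2; rewrite /I /= in_itv.
- move=> z1 h1 h2; have := hmax (Re (z1 - z), Im (z1 - z)); rewrite inE /I /=.
  rewrite /ga /= (_ : z + _ = z1); last by apply: Cext;
    rewrite ?cReD ?cImD/= ?cReN ?cImN; ring.
  apply.
  by split; rewrite /= in_itv/= -ler_norml.
Qed.

(** Adding a small multiple of the squared modulus to the real part produces an
interior maximum, at which the four-point sum would have to be both nonpositive
and at least a positive multiple of t ^ 2. *)
Lemma Re_nonpositive z : Re (F z) <= 0.
Proof.
rewrite leNgt; apply/negP => c0; set c := Re (F z) in c0.
have [M hM] := F0 (divr_gt0 c0 (ltr0n R 2)).
pose rho := `|M| + nm z + 1.
have nz := nm_ge0 z; have nM := normr_ge0 M.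
have r0 : 0 < rho by rewrite /rho; lra.
(* On the boundary of the square of half-side rho the perturbation is at most
   e * (2 * rho ^ 2) = c / 4, and the real part of F at most c / 2. *)
pose e := c / (8 * rho ^+ 2).
have e0 : 0 < e by rewrite divr_gt0// mulr_gt0// exprn_gt0.
pose q z1 := Re (z1 - z) ^+ 2 + Im (z1 - z) ^+ 2.
pose g z1 := Re (F z1) + e * q z1.
have qnm z1 : q z1 = nm (z1 - z) ^+ 2 by rewrite nmc_sq.
have cg z' eps : 0 < eps -> exists2 d, 0 < d & forall z1, nm (z1 - z') < d ->
    `|g z1 - g z'| < eps.
  move=> eps0; have eps20 : 0 < eps / 2 by rewrite divr_gt0.
  have [d d0 hd] := expands2_cont z' eps20.
  pose B := 2 * nm (z' - z) + 1; have B0 : 0 < B.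
    by rewrite /B; have := nm_ge0 (z' - z); lra.
  have eB : 0 < e * B by rewrite mulr_gt0.
  exists (Num.min d (Num.min 1 (eps / 2 / (e * B)))).
    by rewrite !lt_min d0 ltr01 divr_gt0.
  move=> z1; rewrite !lt_min => /and3P[/hd h1 h2 h3].
  have -> : g z1 - g z' = (Re (F z1) - Re (F z')) + e * (q z1
    - q z') by rewrite /g; ring.
  rewrite (le_lt_trans (ler_normD _ _))// [ltRHS]splitr ltr_leD//.
    by rewrite -cReN -cReD (le_lt_trans (Re_le_nm _)).
  rewrite normrM gtr0_norm// !qnm subr_sqr normrM.
  have k1 : `|nm (z1 - z) - nm (z' - z)| <= nm (z1 - z').
    have t1 : nm (z1 - z) <= nm (z1 - z') + nm (z' - z).
      by apply: nm_split => //; rewrite opprB addrA subrK.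
    have t2 : nm (z' - z) <= nm (z1 - z') + nm (z1 - z).
      by apply: nm_split => //; rewrite nm_distC opprB addrA subrK.
    by rewrite ler_norml; lra.
  have k2 : `|nm (z1 - z) + nm (z' - z)| <= B.
    have t1 : nm (z1 - z) <= nm (z1 - z') + nm (z' - z).
      by apply: nm_split => //; rewrite opprB addrA subrK.
    rewrite ger0_norm ?addr_ge0 ?nm_ge0// /B; lra.
  move: h3; rewrite ltr_pdivlMr// => h3.
  apply: (@le_trans _ _ (e * (nm (z1 - z') * B))).
    by apply: ler_wpM2l; [exact: ltW|exact: ler_pM].
  by rewrite mulrCA ltW.
have [z' [h1 h2 hmax]] := rect_max z cg (ltW r0).
have gz : c <= g z'.
  have := hmax z; rewrite subrr /= normr0 => /(_ (ltW r0) (ltW r0)).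
  by rewrite /g /q subrr /= expr0n/= addr0 mulr0 addr0.
have interior : `|Re (z' - z)| < rho /\ `|Im (z' - z)| < rho.
  have bd : rho <= nm (z' - z) -> False.
    move=> hr; have : M <= nm z'.
      have : nm (z' - z) <= nm z' + nm z by exact: nmB.
      have := ler_norm M; rewrite /rho in hr; lra.
    move/hM => /(le_trans (nm_triR _)) hc.
    have hq : q z' <= rho ^+ 2 + rho ^+ 2.
      rewrite /q -[Re _ ^+ 2]real_normK ?num_real// -[Im _ ^+ 2]real_normK
        ?num_real//.
      by rewrite lerD// ler_pXn2r// nnegrE ltW.
    have : e * q z' <= e * (rho ^+ 2 + rho ^+ 2) by rewrite ler_wpM2l// ltW.
    have -> : e * (rho ^+ 2 + rho ^+ 2) = c / 4 by rewrite /e; field;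
      rewrite gt_eqF.
    by move: gz; rewrite /g; lra.
  split; rewrite ltNge; apply/negP => hr; apply: bd; apply: (le_trans hr).
    exact: Re_le_nm.
  exact: Im_le_nm.
case: interior => i1 i2.
have [K [d [K0 d0 hd]]] := four_point z'.
pose t := Num.min (d / 2) (Num.min ((rho - `|Re (z' - z)|) / 2)
  (Num.min ((rho - `|Im (z' - z)|) / 2) (2 * e / (K + 1)))).
have t0 : 0 < t.
  rewrite !lt_min; apply/and4P; split; apply: divr_gt0 => //.
  - by rewrite subr_gt0.
  - by rewrite subr_gt0.
  - by rewrite mulr_gt0.
  - by rewrite ltr_wpDl.
have td : t < d.
  by rewrite (@le_lt_trans _ _ (d / 2)) ?ge_min ?lexx// ltr_pdivrMr// ltr_pMr//
    ltr1n.
have t1 : t <= (rho - `|Re (z' - z)|) / 2 by rewrite !ge_min lexx orbT.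
have t2 : t <= (rho - `|Im (z' - z)|) / 2 by rewrite !ge_min lexx !orbT.
have t3 : t <= 2 * e / (K + 1) by rewrite !ge_min lexx !orbT.
have inside (h : C) : `|Re h| <= t -> `|Im h| <= t -> g (z' + h) <= g z'.
  move=> r1 r2; apply: hmax; rewrite addrAC.
    by rewrite cReD (le_trans (ler_normD _ _))//; lra.
  by rewrite cImD (le_trans (ler_normD _ _))//; lra.
have tn : `|t| <= t by rewrite gtr0_norm.
have tz : `|0 : R| <= t by rewrite normr0 ltW.
have g1 := inside t%:C tn tz.
have g2 := inside (- t%:C); rewrite /= oppr0 normrN in g2; have {}g2 := g2 tn tz.
have g3 := inside (t *i) tz tn.
have g4 := inside (- (t *i)); rewrite /= oppr0 normrN in g4; have {}g4 := g4 tz tn.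
have hd' := hd t t0 td.
have h4 : 4 * e * t ^+ 2 <= K * t ^+ 3.
  move: g1 g2 g3 g4 hd'; rewrite /g /q.
  rewrite !(cReD, cImD, cReN, cImN)/=.
  move: (Re (F z')) (Re (F (z' + t%:C))) (Re (F (z' - t%:C))) (Re (F (z' + t *i)))
    (Re (F (z' - t *i))) (Re z') (Im z') (Re z) (Im z) => f0 f1 f2 f3 f4 x' y' x y.
  by lra.
have : K * t ^+ 3 < 4 * e * t ^+ 2.
  rewrite exprS mulrA ltr_pM2r ?exprn_gt0//.
  apply: (@le_lt_trans _ _ ((K + 1) * t)).
    by rewrite ler_wpM2r ?(ltW t0)// lerDl.
  move: t3; rewrite ler_pdivlMr ?ltr_wpDl// => t3.
  by rewrite mulrC (le_lt_trans t3)// ltr_pM2r// ltr_nat.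
by rewrite ltNge h4.
Qed.

End Liouville.

Lemma expands2Z (R : realType) (F : R[i] -> R[i]) (k z : R[i]) :
  @expands2 R R[i]^o F z -> @expands2 R R[i]^o (fun z => k * F z) z.
Proof.
move=> [c1 [c2 [K [d [K0 d0 hd]]]]].
exists (k * c1), (k * c2), (nm k * K), d; split => //.
  by rewrite mulr_ge0// nm_ge0.
move=> h /hd hh; rewrite -mulrA; apply: le_trans (ler_wpM2l (nm_ge0 k) hh).
rewrite -nmM le_eqVlt; apply/orP; left; apply/eqP; congr nm.
rewrite !mulrBr; congr (_ - _ - _); rewrite /GRing.scale/=; ring.
Qed.

Lemma liouville (R : realType) (F : R[i] -> R[i]) :
  (forall z, @expands2 R R[i]^o F z) ->
  (forall eps : R, 0 < eps -> exists M, forall z, M <= nm z -> nm (F z) <= eps) ->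
  forall z, F z = 0.
Proof.
move=> hF F0 z; apply: nm_eq0; apply/eqP; rewrite -sqrf_eq0 eq_le sqr_ge0 andbT.
have := @Re_nonpositive R (fun z1 => Num.conj (F z) * F z1) _ _ z.
rewrite mulrC nm_conjM /=; apply.
  by move=> z1; exact: expands2Z.
move=> eps e0; have n1 : 0 < nm (F z) + 1 by rewrite ltr_wpDl ?nm_ge0.
have [M hM] := F0 _ (divr_gt0 e0 n1).
exists M => z1 /hM h; rewrite nmM nmJ.
apply: (@le_trans _ _ ((nm (F z) + 1) * (eps / (nm (F z) + 1)))).
  by apply: ler_pM; rewrite ?nm_ge0// lerDl.
by rewrite mulrC divfK// gt_eqF.
Qed.

(** * Contour integrals of the resolvent *)

Section ComplexTopology.
Context {R : realType}.
Local Notation C := R[i].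

Lemma interiorP (D : set C^o) (z : C) :
  D° z <-> exists2 d : R, 0 < d & forall z' : C, nm (z' - z) < d -> D z'.
Proof.
split=> [/nbhs_ballP[d /= d0 hd]|[d d0 hd]].
  have dE : d = (complex.Re d)%:C by rewrite RRe_real// gtr0_real.
  exists (complex.Re d); first by rewrite -ltcR -dE.
  move=> z' hz; apply: hd; rewrite -ball_normE /=.
  by rewrite distrC nmE [ltRHS]dE ltcR.
apply/nbhs_ballP; exists d%:C; first by rewrite /= ltcR.
by move=> z'; rewrite -ball_normE /= distrC nmE ltcR; exact: hd.
Qed.

Lemma cC_inv (f : R -> C) : cC f -> (forall t, f t != 0) -> cC (fun t => (f t)^-1).
Proof.
move=> cf f0.
have -> : (fun t => (f t)^-1) =
    (fun t => ((complex.Re (f t) * complex.Re (f t) +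
       complex.Im (f t) * complex.Im (f t))^-1)%:C * Num.conj (f t)).
  apply/funext => t; have := f0 t; case: (f t) => a b ft0.
  have d0 : a ^+ 2 + b ^+ 2 != 0.
    apply: contra ft0; rewrite paddr_eq0 ?sqr_ge0// !sqrf_eq0 => /andP[/eqP ->
      /eqP ->].
    by rewrite eq_complex /= eqxx.
  by apply: Cext; rewrite ?cReM ?cImM cReJ cImJ /= -!expr2; field.
apply: cCM; last exact: cCJ.
pose D t := complex.Re (f t) * complex.Re (f t)
  + complex.Im (f t) * complex.Im (f t).
have cD : continuous D by case: cf => cr ci; apply: contD; exact: contM.
have D0 t : D t != 0.
  have : nm (f t) ^+ 2 != 0 by rewrite sqrf_eq0 gt_eqF// nm_gt0.
  by rewrite nmc_sq !expr2.
by apply: (cCR (f := fun t => (D t)^-1)) => t; apply: (continuousV (D0 t));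
  exact: cD.
Qed.

Lemma derivable_cont (f : R -> R) : (forall t, derivable f t 1) -> continuous f.
Proof. by move=> h t; apply/differentiable_continuous/derivable1_diffP. Qed.

Lemma contour_integralE n (g : 'I_n -> R -> C) (f : C -> C) :
  contour_integral g f =
  \sum_(j < n) Cint 0 1 (fun t => f (g j t) * velocity (g j) t).
Proof. by []. Qed.

Lemma periodic_frac (g : R -> C) : (forall t, g (t + 1) = g t) ->
  forall t, exists2 s, 0 <= s < 1 & g t = g s.
Proof.
move=> hg; have hn (n : nat) t : g (t + n%:R) = g t.
  elim: n t => [|n IH] t; first by rewrite addr0.
  by rewrite -addn1 natrD addrA hg IH.
move=> t; exists (t - (Num.floor t)%:~R).
  rewrite subr_ge0 floor_le/= ltrBlDl.
  by have := floorD1_gt t; rewrite rmorphD/=.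
case: (Num.floor t) => k.
  by rewrite -[in LHS](subrK (k%:R : R) t) hn.
by rewrite NegzE rmorphN opprK hn.
Qed.

End ComplexTopology.

Section ResolventEstimates.
Context {R : realType} {H : completeNormedModType R[i]}.
Local Notation C := R[i].
Implicit Types (A : set (H * H)).

Lemma resolventE A z T : is_resolvent A z T -> resolvent A z = T.
Proof.
move=> [_ hT]; apply/funext => y; rewrite /resolvent.
case: xgetP => [x _ hx|]; first by apply/esym/hT.
by move=> /(_ (T y)) h; exfalso; apply: h; apply/hT.
Qed.

Lemma resolvent_setP A (z : C) : resolvent_set A z <-> exists T, is_resolvent A z T.
Proof. by split=> -[T hT]; exists T. Qed.

(** Any solution x of (z - A) x = p is a fixed point x = T1 (p + (z1 - z) x), so
it is controlled near z1 without knowing that z is in the resolvent set. *)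
Lemma resolvent_near A z1 T1 M : is_resolvent A z1 T1 -> 0 <= M ->
  bounded_by T1 M ->
  forall z x p, A (x, z *: x - p) -> nm (z1 - z) * M <= 2^-1 ->
  nm x <= 2 * M * nm p /\ nm (x - T1 p) <= nm (z1 - z) * M * (2 * M * nm p).
Proof.
move=> hT1 M0 bT z x p hx hz.
have xE : x = T1 p + (z1 - z) *: T1 x.
  have /graphE := hx; move/(_ _ _ hT1) => {1}->.
  rewrite -linearZ -linearD; congr (T1 _).
  by rewrite scalerBl opprB addrCA addrC -addrA [- _ + _]addrC.
have d1 : nm (x - T1 p) <= nm (z1 - z) * M * nm x.
  rewrite {1}xE addrAC subrr add0r nmZ -mulrA ler_wpM2l ?nm_ge0//.
have n1 : nm x <= 2 * M * nm p.
  have : nm x <= nm (x - T1 p) + nm (T1 p) by apply: nm_split.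
  have := bT p; have := ler_wpM2r (nm_ge0 x) hz.
  lra.
split=> //; apply: le_trans d1 _; rewrite ler_wpM2l// mulr_ge0//.
exact: nm_ge0.
Qed.

End ResolventEstimates.

Section ContourOperators.
Context {R : realType} {H : completeNormedModType R[i]}.
Variables (dot : {dot H for Num.conj}) (hdot : norm_of_dot dot).
Local Notation C := R[i].
Local Notation ip := (ip dot).
Variables (A : set (H * H)) (n : nat) (g : 'I_n -> R -> C).
Hypothesis gC1 : forall j, C1_closed_curve (g j).
Hypothesis gres : forall j t, resolvent_set A (g j t).

Let res j t := resolvent A (g j t).

Lemma curve_cC j : cC (g j).
Proof. by have [_ h _ _ _] := gC1 j; split; apply: derivable_cont => t;
  have [] := h t. Qed.

Lemma velocity_cC j : cC (velocity (g j)).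
Proof. by have [_ _ h1 h2 _] := gC1 j. Qed.

Lemma res_linear j t : exists T, is_resolvent A (g j t) T /\ res j t = T.
Proof.
have /resolvent_setP[T hT] := gres j t.
by exists T; split=> //; exact: resolventE.
Qed.

Lemma res_graph j t x : A (res j t x, g j t *: res j t x - x).
Proof. by have [T [[_ hT] ->]] := res_linear j t; apply/hT. Qed.

Lemma res_near j t : exists M d, [/\ 0 < M, 0 < d &
  forall t', `|t' - t| < d -> forall x, nm (res j t' x) <= M * nm x /\
    nm (res j t' x - res j t x) <= nm (g j t' - g j t) * M * nm x].
Proof.
have [T [hT rT]] := res_linear j t.
have [M M0 bT] := continuous_bounded hT.1.
pose M1 := M + 1; have M10 : 0 < M1 by rewrite /M1 ltr_wpDl.
have bT1 : bounded_by T M1.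
  by move=> x; apply: le_trans (bT x) _; rewrite ler_wpM2r ?nm_ge0// lerDl.
have e0 : 0 < 2^-1 / M1 by rewrite divr_gt0// invr_gt0.
have [d d0 hd] := cC_vcont (curve_cC j) t e0.
(* One constant serves both estimates: 2 M1 bounds the norms and 2 M1 ^ 2 the
   increments. *)
exists (2 * M1 * M1 + 2 * M1), d; split => //.
  by rewrite addr_gt0 ?mulr_gt0.
move=> t' /hd h x.
have hz : nm (g j t - g j t') * M1 <= 2^-1.
  by rewrite nm_distC -ler_pdivlMr// ltW.
have [h1 h2] := resolvent_near hT (ltW M10) bT1 (res_graph j t' x) hz.
split.
  apply: le_trans h1 _; rewrite ler_wpM2r ?nm_ge0// lerDr.
  by rewrite !mulr_ge0 ?ltW.
rewrite rT; apply: le_trans h2 _; rewrite nm_distC -!mulrA ler_wpM2l ?nm_ge0//.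
have := nm_ge0 x; have : 0 <= M1 * nm x by rewrite mulr_ge0 ?nm_ge0// ltW.
by move=> a b; lra.
Qed.

Lemma res_vcont j x : vcont (fun t => res j t x).
Proof.
move=> t e e0; have [M [d [M0 d0 hd]]] := res_near j t.
have B0 : 0 < M * nm x + 1 by rewrite ltr_wpDl// mulr_ge0 ?nm_ge0// ltW.
have [d1 d10 hd1] := cC_vcont (curve_cC j) t (divr_gt0 e0 B0).
exists (Num.min d d1); first by rewrite lt_min d0.
move=> t'; rewrite lt_min => /andP[/hd/(_ x)[_ h1] /hd1 h2].
apply: le_lt_trans h1 _.
rewrite -mulrA (@le_lt_trans _ _ (nm (g j t' - g j t) * (M * nm x + 1)))//.
  by rewrite ler_wpM2l ?nm_ge0// lerDl.
by rewrite -ltr_pdivlMr.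
Qed.

Lemma res_bounded j : exists2 B, 0 <= B &
  forall t x, 0 <= t <= 1 -> nm (res j t x) <= B * nm x.
Proof.
have /compact_near_coveringP cpt := @segment_compact R 0 1.
have := cpt R (pinfty_nbhs R) (fun B t => forall x, nm (res j t x) <= B * nm x) _.
move=> [].
  move=> t _; have [M [d [M0 d0 hd]]] := res_near j t.
  exists ([set t' | `|t' - t| < d], [set B | M < B]) => /=.
    by split; [exact: nbhs_dist|exists M; split => //; exact: num_real].
  move=> [t' B] /= [/hd h1 h2] x; have [h3 _] := h1 x.
  by apply: le_trans h3 _; rewrite ler_wpM2r ?nm_ge0// ltW.
move=> B0 [_ hB]; exists (`|B0| + 1); first by rewrite addr_ge0.
move=> t x ht; apply: (hB (`|B0| + 1)); last by rewrite /= in_itv.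
by rewrite (le_lt_trans (ler_norm _))// ltrDl.
Qed.

Definition cauchy_pairing (f : C ->
  C) : C := (two_pi_i (R := R))^-1 * contour_integral g f.

(** The weak form of (2 pi i)^-1 times the contour integral of k(z) (z - A)^-1 x.
The constant kernel 1 gives the spectral projection, and the Cauchy kernel an
inverse of zeta - A on a part of the space. *)
Definition contour_op (k : C -> C) (x : H) : H :=
  rep dot (fun y => cauchy_pairing (fun z => k z * ip (resolvent A z x) y)).

(** All that matters of a kernel is its restriction to the curves. *)
Definition contour_continuous (k : C -> C) := forall j, cC (fun t => k (g j t)).

Lemma contour_continuous_lbmC k j x y : contour_continuous k ->
  lbmC (fun t => k (g j t) * ip (res j t x) y * velocity (g j) t).
Proof.
move=> hk; apply/cC_lbmC/cCM; last exact: velocity_cC.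
by apply: cCM; [exact: hk|exact/(vcont_dot hdot)/res_vcont].
Qed.

Lemma pairing_bound : exists2 D, 0 <= D & forall k Kb x y, contour_continuous k ->
  (forall j t, 0 <= t <= 1 -> nm (k (g j t)) <= Kb) ->
  nm (cauchy_pairing (fun z => k z * ip (resolvent A z x) y)) <=
    D * Kb * nm x * nm y.
Proof.
have hB0 j : exists Bj : R, 0 <= Bj /\
    forall t x, 0 <= t <= 1 -> nm (res j t x) <= Bj * nm x.
  by have [Bj h1 h2] := res_bounded j; exists Bj.
have [B hB] := choice hB0.
have hW0 j : exists Wj : R, 0 <= Wj /\
    forall t, 0 <= t <= 1 -> nm (velocity (g j) t) <= Wj.
  have [M hM] := lbmC_bounded 0 1 (cC_lbmC (velocity_cC j)).
  exists M; split=> //; apply: le_trans (nm_ge0 _) (hM 0 _).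
  by rewrite lexx ler01.
have [W hW] := choice hW0.
exists (nm (two_pi_i (R := R))^-1 * \sum_j B j * W j).
  rewrite mulr_ge0 ?nm_ge0// sumr_ge0// => j _.
  by rewrite mulr_ge0; [|by case: (hB j)|by case: (hW j)].
move=> k Kb x y hk hKb; rewrite nmM -!mulrA ler_wpM2l ?nm_ge0//.
rewrite contour_integralE (le_trans (nm_sum _ _ _))// mulr_suml ler_sum// => j _.
have [B0 hBj] := hB j; have [W0 hWj] := hW j.
rewrite (@le_trans _ _ (Kb * (B j * nm x * nm y) * W j * (1 - 0)))//.
  apply: nm_Cint_le_cst => //; first exact: contour_continuous_lbmC.
  move=> t ht; rewrite !nmM ler_pM ?mulr_ge0 ?nm_ge0 ?hWj//.
  rewrite ler_pM ?nm_ge0 ?hKb// (le_trans (nm_dot hdot _ _))//.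
  by rewrite ler_wpM2r ?nm_ge0// hBj.
by rewrite le_eqVlt; apply/orP; left; apply/eqP; ring.
Qed.

Lemma contour_continuous_bounded k : contour_continuous k ->
  exists Kb, forall j t, 0 <= t <= 1 -> nm (k (g j t)) <= Kb.
Proof.
move=> hk; have hM0 j : exists Mj, forall t, 0 <= t <= 1 -> nm (k (g j t)) <= Mj.
  exact: lbmC_bounded (cC_lbmC (hk j)).
have [M hM] := choice hM0.
exists (\sum_j `|M j|) => j t ht; rewrite (le_trans (hM _ _ ht))//.
rewrite (le_trans (ler_norm _))// (bigD1 j)//= lerDl sumr_ge0//.
Qed.

Lemma pairing_lin (f1 f2 : C -> C) (a1 a2 : C) :
  (forall j, lbmC (fun t => f1 (g j t) * velocity (g j) t)) ->
  (forall j, lbmC (fun t => f2 (g j t) * velocity (g j) t)) ->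
  cauchy_pairing (fun z => a1 * f1 z + a2 * f2 z) =
  a1 * cauchy_pairing f1 + a2 * cauchy_pairing f2.
Proof.
move=> l1 l2; rewrite /cauchy_pairing !contour_integralE.
rewrite (mulrCA a1) (mulrCA a2) -mulrDr; congr (_ * _).
rewrite !mulr_sumr -big_split/=; apply: eq_bigr => j _; rewrite -!CintZ// -CintD;
  last 2 first.
- by apply: lbmCM => //; exact: lbmC_cst.
- by apply: lbmCM => //; exact: lbmC_cst.
by apply: eq_Cint => t _; ring.
Qed.

Lemma contour_opE k x y : contour_continuous k ->
  ip (contour_op k x) y = cauchy_pairing (fun z => k z * ip (resolvent A z x) y).
Proof.
move=> hk; have [D D0 hD] := pairing_bound.
have [Kb hKb] := contour_continuous_bounded hk.
apply: (repE hdot (M := D * Kb * nm x)) => [a u v|u]; last exact: hD.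
rewrite -[in RHS](mul1r (cauchy_pairing (fun z => k z * ip _ v))).
rewrite -(@pairing_lin _ _ (Num.conj a) 1)//; try by move=> j;
  exact: contour_continuous_lbmC.
by congr cauchy_pairing; apply/funext => z; rewrite dotDr dotZr; ring.
Qed.

Lemma contour_op_bound : exists2 D, 0 <= D & forall k Kb x,
  contour_continuous k -> 0 <= Kb ->
  (forall j t, 0 <= t <= 1 -> nm (k (g j t)) <= Kb) ->
  nm (contour_op k x) <= D * Kb * nm x.
Proof.
have [D D0 hD] := pairing_bound; exists D => // k Kb x hk K0 hKb.
apply: (dot_nm_le hdot); first by rewrite !mulr_ge0 ?nm_ge0.
by move=> y; rewrite contour_opE//; exact: hD.
Qed.

Lemma contour_op_lin k1 k2 (a1 a2 : C) x : contour_continuous k1 ->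
  contour_continuous k2 ->
  contour_op (fun z => a1 * k1 z + a2 * k2 z) x =
  a1 *: contour_op k1 x + a2 *: contour_op k2 x.
Proof.
move=> h1 h2; apply: (dot_ext hdot) => y.
have h12 : contour_continuous (fun z => a1 * k1 z + a2 * k2 z).
  by move=> j; apply: cCD; apply: cCM; try exact: cC_cst; [exact: h1|exact: h2].
rewrite dotDl !dotZl !contour_opE//.
rewrite -(@pairing_lin _ _ a1 a2)//; try by move=> j;
  exact: contour_continuous_lbmC.
by congr cauchy_pairing; apply/funext => z; ring.
Qed.

Lemma contour_op_ext k1 k2 x : (forall j t, k1 (g j t) = k2 (g j t)) ->
  contour_op k1 x = contour_op k2 x.
Proof.
move=> h; rewrite /contour_op /cauchy_pairing; congr (rep dot _); apply/funext => y.
congr (_ * _); rewrite !contour_integralE; apply: eq_bigr => j _.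
by apply: eq_Cint => t _; rewrite h.
Qed.

Lemma contour_op_commute k x T : contour_continuous k -> graph_commutes A T ->
  T (contour_op k x) = contour_op k (T x).
Proof.
move=> hk hT; have [Ta hTa] := adjoint hdot hT.1.
apply: (dot_ext hdot) => y; rewrite hTa !contour_opE//.
rewrite /cauchy_pairing !contour_integralE; congr (_ * _); apply: eq_bigr => j _.
apply: eq_Cint => t _; congr (_ * _ * _); rewrite -hTa.
have [T1 [hT1 e1]] := res_linear j t; rewrite /res in e1; rewrite e1.
by rewrite (commute_resolvent x hT1 hT).
Qed.

Definition cauchy_kernel (zeta z : C) : C := (zeta - z)^-1.

Lemma contour_continuous_cauchy zeta : (forall j t, g j t != zeta) ->
  contour_continuous (cauchy_kernel zeta).
Proof.
move=> h j; apply: cC_inv.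
  by apply: cCD; [exact: cC_cst|exact/cCN/curve_cC].
by move=> t; rewrite subr_eq0 eq_sym.
Qed.

Lemma contour_continuous1 : contour_continuous (fun=> 1).
Proof. by move=> j; exact: cC_cst. Qed.

Lemma contour_continuousM k1 k2 : contour_continuous k1 ->
  contour_continuous k2 -> contour_continuous (fun z => k1 z * k2 z).
Proof. by move=> h1 h2 j; apply: cCM; [exact: h1|exact: h2]. Qed.

(** Since (z - A)^-1 (zeta - A) u = (zeta - z) (z - A)^-1 u + u, the Cauchy kernel
leaves the integral of (z - A)^-1 u and the winding number times u. *)
Lemma contour_op_left_inverse zeta nu u u1 : (forall j t, g j t != zeta) ->
  cauchy_pairing (fun z => (z - zeta)^-1) = nu -> A (u, u1) ->
  contour_op (cauchy_kernel zeta) (zeta *: u - u1) =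
  contour_op (fun=> 1) u - nu *: u.
Proof.
move=> hz hnu hu; have hk := contour_continuous_cauchy hz.
apply: (dot_ext hdot) => y.
rewrite dotDl dotNl dotZl !contour_opE//; last exact: contour_continuous1.
have lv j : lbmC (fun t => cauchy_kernel zeta (g j t) * velocity (g j) t).
  by apply/cC_lbmC/cCM; [exact: hk|exact: velocity_cC].
have l1 j : lbmC (fun t => 1 * ip (res j t u) y * velocity (g j) t).
  by apply: (contour_continuous_lbmC (k := fun=> 1)); exact: contour_continuous1.
have -> : nu = - cauchy_pairing (cauchy_kernel zeta).
  rewrite -hnu /cauchy_pairing -mulrN !contour_integralE -sumrN; congr (_ * _).
  apply: eq_bigr => j _; rewrite -CintN//; apply: eq_Cint => t _.
  by rewrite /cauchy_kernel -[zeta - _]opprB invrN mulNr opprK.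
rewrite mulNr opprK [_ * ip u y]mulrC.
rewrite -[in RHS](mul1r (cauchy_pairing (fun z => 1 * ip (resolvent A z u) y))).
rewrite -(@pairing_lin _ _ 1 (ip u y))//.
rewrite /cauchy_pairing !contour_integralE; congr (_ * _); apply: eq_bigr => j _.
apply: eq_Cint => t _; congr (_ * _).
have [T1 [hT1 e1]] := res_linear j t; rewrite /res in e1; rewrite e1.
have -> : T1 (zeta *: u - u1) = (zeta - g j t) *: T1 u + u.
  have : T1 (g j t *: u - u1) = u by apply/hT1.2; rewrite subKr.
  rewrite !linearB !linearZ/= => {3}<-.
  by rewrite scalerBl addrA subrK.
rewrite /cauchy_kernel dotDl dotZl !mul1r mulrDr mulrA mulVf ?mul1r; last first.
  by rewrite subr_eq0 eq_sym.
by rewrite [(ip u y) * _]mulrC.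
Qed.

End ContourOperators.

(** * The spectral projection *)

Section Expansions.
Context {R : realType} {H : completeNormedModType R[i]}.
Variables (dot : {dot H for Num.conj}) (hdot : norm_of_dot dot).
Local Notation C := R[i].
Local Notation ip := (ip dot).

Lemma expands2_near (f f' : C -> H) z :
  (exists2 d : R, 0 < d & forall z', nm (z' - z) < d -> f z' = f' z') ->
  expands2 f' z -> expands2 f z.
Proof.
move=> [d d0 e] [c1 [c2 [K [d1 [K0 d10 hd]]]]].
exists c1, c2, K, (Num.min d d1); split => //; first by rewrite lt_min d0.
move=> h; rewrite lt_min => /andP[h1 h2].
rewrite !e ?subrr ?nm0//; first exact: hd.
by rewrite addrAC subrr add0r.
Qed.

Lemma expands2N (f : C -> H) z : expands2 f z -> expands2 (fun z => - f z) z.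
Proof.
move=> [c1 [c2 [K [d [K0 d0 hd]]]]]; exists (- c1), (- c2), K, d; split => // h /hd.
by rewrite -nmN !scalerN !opprD.
Qed.

Lemma expands2_ip (f : C -> H) z y : expands2 f z ->
  @expands2 R R[i]^o (fun z => ip (f z) y) z.
Proof.
move=> [c1 [c2 [K [d [K0 d0 hd]]]]].
exists (ip c1 y), (ip c2 y), (K * nm y), d; split => //.
  by rewrite mulr_ge0 ?nm_ge0.
move=> h /hd k; rewrite mulrAC; apply: le_trans (ler_wpM2r (nm_ge0 y) k).
apply: le_trans (nm_dot hdot _ _).
by rewrite !(dotDl, dotNl, dotZl).
Qed.

(** The expansion needs the resolvent at the single point z: nearby, only the
equation satisfied by f is used. *)
Lemma expands2_resolvent (A : set (H * H)) z T (f : C -> H) p :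
  is_resolvent A z T -> (forall z', A (f z', z' *: f z' - p)) -> expands2 f z.
Proof.
move=> hT hf; have [M M0 bT] := continuous_bounded hT.1.
have bT1 : bounded_by T (M + 1).
  by move=> x; apply: le_trans (bT x) _; rewrite ler_wpM2r ?nm_ge0// lerDl.
have M1 : 0 < M + 1 by rewrite ltr_wpDl.
exists (- T (T p)), (T (T (T p))), (M * (M * (M * (2 * (M
  + 1) * nm p)))), (2^-1 / (M + 1)).
split.
- by rewrite !mulr_ge0 ?nm_ge0// ltW.
- by rewrite divr_gt0// invr_gt0.
move=> h; rewrite ltr_pdivlMr// => hh.
set x := f (z + h).
have xE : x = T p - h *: T x.
  have /(graphE hT) := hf (z + h); rewrite -/x => {1}->.
  rewrite -linearZ -linearB; congr (T _).
  by rewrite scalerDl opprB addrCA; congr (_ + _); rewrite opprD addrA subrr add0r.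
have fz : f z = T p by apply/esym/hT.2/hf.
have nx : nm x <= 2 * (M + 1) * nm p.
  have [] // := resolvent_near hT (ltW M1) bT1 (hf (z + h)).
  by rewrite opprD addrA subrr add0r nmN ltW.
have -> : x - f z - h *: - T (T p) - h ^+ 2 *: T (T (T p)) =
  - (h ^+ 3 *: T (T (T x))).
  have e1 : T x = T (T p) - h *: T (T x) by rewrite {1}xE linearB linearZ.
  have e2 : T (T x) = T (T (T p))
    - h *: T (T (T x)) by rewrite {1}e1 linearB linearZ.
  rewrite fz {1}xE [_ - T p]addrAC subrr add0r [in LHS]e1 [in LHS]e2.
  rewrite !scalerBr !scalerA scalerN opprK opprB subrK -expr2 addrAC subrr add0r.
  by rewrite -exprSr.
rewrite nmN nmZ nmX mulrC ler_wpM2r ?exprn_ge0 ?nm_ge0//.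
apply: (le_trans (bT _)); apply: ler_wpM2l => //.
apply: (le_trans (bT _)); apply: ler_wpM2l => //.
by apply: (le_trans (bT _)); apply: ler_wpM2l.
Qed.

Variables (A : set (H * H)) (n : nat) (g : 'I_n -> R -> C).
Hypothesis gC1 : forall j, C1_closed_curve (g j).
Hypothesis gres : forall j t, resolvent_set A (g j t).
Local Notation op := (contour_op dot A g).
Local Notation q := (fun zeta => op (cauchy_kernel zeta)).

Lemma expands2_cauchy zeta x (d : R) : 0 < d ->
  (forall j t, d <= nm (zeta - g j t)) -> expands2 (fun z => q z x) zeta.
Proof.
move=> d0 hd; have [D D0 hD] := contour_op_bound hdot gC1 gres.
have far (z : C) : nm (z - zeta) < d / 2 -> forall j t, d / 2 <= nm (z - g j t).
  move=> hz j t; have := hd j t.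
  have : nm (zeta - g j t) <= nm (z - zeta) + nm (z - g j t).
    by apply: nm_split => //; rewrite opprB addrA subrK nm_distC.
  lra.
have d20 : 0 < d / 2 by rewrite divr_gt0.
have ne (z : C) : nm (z - zeta) < d / 2 -> forall j t, g j t != z.
  move=> /far hz j t; apply/eqP => e; have := hz j t.
  by rewrite e subrr nm0 leNgt d20.
have hk (z : C) : nm (z - zeta) < d / 2 -> contour_continuous g (cauchy_kernel z).
  by move=> /ne; exact: contour_continuous_cauchy.
have hz0 : nm (zeta - zeta) < d / 2 by rewrite subrr nm0.
pose k := cauchy_kernel zeta; have k0 : contour_continuous g k := hk _ hz0.
have k2 : contour_continuous g (fun z => k z * k z) by exact: contour_continuousM.
have k3 : contour_continuous g (fun z => k z * (k z * k z)) by exact: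
  contour_continuousM.
exists (- op (fun z => k z * k z) x), (op (fun z => k z * (k z * k z)) x),
  (D * (d^-1 * (d^-1 * d^-1) * (d / 2)^-1) * nm x), (d / 2); split => //.
  by rewrite !mulr_ge0 ?nm_ge0 ?invr_ge0 ?(ltW d0) ?(ltW d20).
(* 1 / (a + h) = 1 / a - h / a ^ 2 + h ^ 2 / a ^ 3 - h ^ 3 / (a ^ 3 (a + h)) under
   the contour integral, with a = zeta - z. *)
move=> h hh; have hzh : nm (zeta + h - zeta) < d / 2 by rewrite addrAC subrr add0r.
pose kh := cauchy_kernel (zeta + h); have k1 : contour_continuous g kh := hk _ hzh.
have k4 : contour_continuous g (fun z => k z * (k z * k z) * kh z) by exact:
  contour_continuousM.
have -> : op kh x = op k x + h *: - op (fun z => k z * k z) x +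
   h ^+ 2 *: op (fun z => k z * (k z * k z)) x
     - h ^+ 3 *: op (fun z => k z * (k z * k z) * kh z) x.
  rewrite (@contour_op_ext _ _ dot A n g _ (fun z => 1 * (1 * (1 * k z
    + (- h) * (k z * k z)) +
     h ^+ 2 * (k z * (k z * k z))) + (- h ^+ 3) * (k z * (k z * k z) * kh z))).
    have glin (f1 f2 : C -> C) (a1 a2 : C) : contour_continuous g f1 ->
      contour_continuous g f2 ->
        contour_continuous g (fun z => a1 * f1 z + a2 * f2 z).
      by move=> g1 g2 j; apply: cCD; apply: cCM; try exact: cC_cst;
        [exact: g1|exact: g2].
    have l1 := glin _ _ 1 (- h) k0 k2; have l2 := glin _ _ 1 (h ^+ 2) l1 k3.
    rewrite (contour_op_lin hdot gC1 gres _ _ x l2 k4).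
    rewrite (contour_op_lin hdot gC1 gres _ _ x l1 k3).
    rewrite (contour_op_lin hdot gC1 gres _ _ x k0 k2).
    by rewrite !scale1r scalerN !scaleNr.
  move=> j t; rewrite /k /kh /cauchy_kernel.
  have n1 : zeta - g j t != 0 by rewrite subr_eq0 eq_sym (ne _ hz0).
  have n2 : zeta + h - g j t != 0 by rewrite subr_eq0 eq_sym (ne _ hzh).
  by field; rewrite n1 n2.
rewrite [X in nm X](_ : _ =
  - (h ^+ 3 *: op (fun z => k z * (k z * k z) * kh z) x)); last first.
  move: (op k x) (h *: _) (h ^+ 2 *: _) (h ^+ 3 *: _) => v1 v2 v3 v4.
  have -> : v1 + v2 + v3 - v4 - v1 - v2 - v3 = v1 + v2 + v3 - v4 - (v1 + v2 + v3).
    by rewrite !opprD !addrA.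
  by rewrite addrAC subrr add0r.
rewrite nmN nmZ nmX mulrC ler_wpM2r ?exprn_ge0 ?nm_ge0//.
apply: hD => //; first by rewrite !mulr_ge0 ?invr_ge0 ?(ltW d0) ?(ltW d20).
move=> j t _; rewrite !nmM /k /kh /cauchy_kernel !nmV.
have a1 : (nm (zeta - g j t))^-1 <= d^-1.
  by rewrite lef_pV2 ?posrE//; apply: lt_le_trans (hd j t).
have a2 : (nm (zeta + h - g j t))^-1 <= (d / 2)^-1.
  have := far _ hzh j t => a; rewrite lef_pV2 ?posrE//; exact: lt_le_trans a.
have i0 (a : C) : 0 <= (nm a)^-1 by rewrite invr_ge0 nm_ge0.
by do ?[apply: ler_pM => //]; rewrite ?mulr_ge0.
Qed.

End Expansions.

Section SpectralProjection.
Context {R : realType} {H : completeNormedModType R[i]}.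
Variables (dot : {dot H for Num.conj}) (hdot : norm_of_dot dot).
Local Notation C := R[i].
Local Notation ip := (ip dot).
Variables (A : set (H * H)) (z0 : C) (T0 : {linear H -> H}).
Hypothesis hT0 : is_resolvent A z0 T0.
Variables (V : set C^o) (n : nat) (g : 'I_n -> R -> C).
Hypotheses (cV : compact V) (bV : oriented_C1_boundary V g).
Hypothesis hres : forall z : C, V z -> ~ V° z -> resolvent_set A z.

Lemma V_closed : closed V.
Proof. by apply: compact_closed cV; exact: norm_hausdorff. Qed.

Lemma curve_C1 j : C1_closed_curve (g j). Proof. by case: bV. Qed.

Lemma curve_boundary j t : V (g j t) /\ ~ V° (g j t).
Proof.
have [hper _ _ _ _] := curve_C1 j; have [s hs ->] := periodic_frac hper t.
have [_ _ hb _ _] := bV.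
have : (closure V `\` V°) (g j s) by rewrite -hb; exists j => //; exists s.
by move=> [+ h]; rewrite -(closure_id V).1; [|exact: V_closed].
Qed.

Lemma curve_res j t : resolvent_set A (g j t).
Proof. by have [h1 h2] := curve_boundary j t; exact: hres. Qed.

Local Notation op := (contour_op dot A g).
Local Notation q := (fun zeta => op (cauchy_kernel zeta)).
Local Notation Pc := (op (fun=> 1)).
Let gC1 := curve_C1.
Let gres := curve_res.

Lemma two_pi_i_neq0 : two_pi_i != 0 :> C.
Proof.
by rewrite eq_complex /= eqxx mulf_eq0 negb_or (gt_eqF (pi_gt0 R)) pnatr_eq0.
Qed.

Lemma boundary_far zeta : V° zeta \/ ~ V zeta ->
  exists2 d : R, 0 < d & forall j t, d <= nm (zeta - g j t).
Proof.
move=> h; have [D hD hg] : exists2 D : set C^o, D° zeta & forall j t, ~ D (g j t).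
  case: h => h.
    by exists V°; [rewrite (interior_id _).1//; exact: open_interior|move=> j t;
      case: (curve_boundary j t)].
  exists (~` V); first by rewrite (interior_id _).1//; exact/closed_openC/V_closed.
  by move=> j t; have [h1 _] := curve_boundary j t; apply.
move/interiorP: hD => [d d0 hd]; exists d => // j t.
rewrite leNgt; apply/negP; rewrite nm_distC => /hd; exact: hg.
Qed.

Lemma boundary_neq zeta : V° zeta \/ ~ V zeta -> forall j t, g j t != zeta.
Proof.
move=> /boundary_far[d d0 hd] j t; apply/eqP => e.
by have := hd j t; rewrite e subrr nm0 leNgt d0.
Qed.

Lemma winding_in zeta : V° zeta -> cauchy_pairing g (fun z => (z - zeta)^-1) = 1.
Proof.
move=> h; have [_ _ _ hw _] := bV.
by rewrite /cauchy_pairing hw// mulVf// two_pi_i_neq0.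
Qed.

Lemma winding_out zeta : ~ V zeta -> cauchy_pairing g (fun z => (z - zeta)^-1) = 0.
Proof.
move=> h; have [_ _ _ _ hw] := bV.
by rewrite /cauchy_pairing hw// mulr0.
Qed.

Lemma contour_op_linear k a x y : contour_continuous g k ->
  op k (a *: x + y) = a *: op k x + op k y.
Proof.
move=> hk; apply: (dot_ext hdot) => v.
rewrite dotDl dotZl; apply: (etrans (contour_opE hdot gC1 gres _ v hk)).
apply/esym; apply: (etrans (congr2 +%R
  (congr1 ( *%R a) (contour_opE hdot gC1 gres x v hk))
  (contour_opE hdot gC1 gres y v hk))).
rewrite -[X in _ + X = _]mul1r -pairing_lin; last 2 first.
- by move=> j; exact: (contour_continuous_lbmC hdot gC1 gres).
- by move=> j; exact: (contour_continuous_lbmC hdot gC1 gres).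
rewrite /cauchy_pairing !contour_integralE; congr (_ * _); apply: eq_bigr => j _.
apply: eq_Cint => t _; congr (_ * _).
have /resolvent_setP[T hT] := gres j t.
by rewrite (resolventE hT) linearP dotDl dotZl; ring.
Qed.

Lemma T0_commutes : graph_commutes A T0.
Proof. exact: is_resolvent_commutes hT0. Qed.

Lemma contour_op_right_inverse zeta nu x : (forall j t, g j t != zeta) ->
  cauchy_pairing g (fun z => (z - zeta)^-1) = nu ->
  A (q zeta x, zeta *: q zeta x - (Pc x - nu *: x)).
Proof.
move=> hz hnu; have hk := contour_continuous_cauchy gC1 hz.
apply/(graphE hT0).
have := contour_op_left_inverse hdot gC1 gres hz hnu (graph_resolvent hT0 x).
have -> : zeta *: T0 x - (z0 *: T0 x - x) = (zeta - z0) *: T0 x + x.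
  by rewrite opprB addrA addrAC scalerBl.
rewrite contour_op_linear// -!(contour_op_commute hdot gC1 gres _ _ T0_commutes)//;
  last exact: contour_continuous1.
move=> e.
have -> : z0 *: q zeta x - (zeta *: q zeta x - (Pc x - nu *: x)) =
    (Pc x - nu *: x) - (zeta - z0) *: q zeta x.
  by rewrite opprB addrCA scalerBl opprB.
have -> : T0 ((Pc x - nu *: x) - (zeta - z0) *: q zeta x) =
    T0 (Pc x) - nu *: T0 x - (zeta - z0) *: T0 (q zeta x).
  by rewrite -!linearZ -!linearB.
by rewrite -e addrAC subrr add0r.
Qed.

Lemma Pc_linear a x y : Pc (a *: x + y) = a *: Pc x + Pc y.
Proof. by apply: contour_op_linear; exact: contour_continuous1. Qed.

Lemma PcB x y : Pc (x - y) = Pc x - Pc y.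
Proof. by rewrite -scaleN1r addrC Pc_linear scaleN1r addrC. Qed.

Lemma V_bounded : exists M : R, forall z, V z -> nm z <= M.
Proof.
have /compact_near_coveringP cpt := cV.
have := cpt R (pinfty_nbhs R) (fun M z => nm (z : C) <= M) _.
move=> [].
  move=> z _; exists ([set z1 : C^o | nm (z1
    - z : C) < 1], [set M | nm (z : C) + 1 < M]).
    split; last by exists (nm (z : C) + 1); split => //; exact: num_real.
    have : (([set z1 : C^o | nm (z1 - z : C) < 1])° : set C^o) z.
      by apply/interiorP; exists 1.
    by [].
  move=> [z1 M] /= [h1 h2].
  have : nm (z1 : C) <= nm (z1 - z : C) + nm (z : C) by exact: nm_split.
  by move: h1 h2; lra.
move=> M0 [_ hM]; exists (`|M0| + 1) => z Vz; apply: (hM (`|M0| + 1)) => //=.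
by rewrite (le_lt_trans (ler_norm _))// ltrDl.
Qed.

(** A candidate for the resolvent of A applied to Pc x - Pc (Pc x): it solves
(zeta - A) f = Pc x - Pc (Pc x) for every complex zeta, including the spectrum. *)
Definition global_solution x zeta : H :=
  if `[< V° zeta >] then - q zeta (Pc x)
  else if `[< V zeta >] then resolvent A zeta (Pc x - Pc (Pc x))
  else q zeta (x - Pc x).

Lemma global_solutionP x zeta : A (global_solution x zeta,
  zeta *: global_solution x zeta - (Pc x - Pc (Pc x))).
Proof.
rewrite /global_solution; case: asboolP => [h|h].
  have := contour_op_right_inverse (Pc x) (boundary_neq (or_introl h))
    (winding_in h).
  rewrite scale1r => /(graphZ hT0 (-1)).
  by rewrite !scaleN1r scalerN opprB addrC [- (Pc x - _)]opprB.
case: asboolP => [h1|h1].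
  have /resolvent_setP[T hT] := hres h1 h.
  by rewrite (resolventE hT); apply/hT.2.
have := contour_op_right_inverse (x - Pc x) (boundary_neq (or_intror h1))
  (winding_out h1).
by rewrite scale0r subr0 PcB.
Qed.

Lemma expands2_global_solution x zeta : expands2 (global_solution x) zeta.
Proof.
case: (pselect (V° zeta)) => [h|h].
  have [d d0 hd] := boundary_far (or_introl h).
  have h2 : (V°)° zeta by rewrite (interior_id _).1//; exact: open_interior.
  apply: (expands2_near (f' := fun z => - q z (Pc x))).
    have /interiorP[e e0 he] := h2; exists e => // z' /he h3.
    by rewrite /global_solution; case: asboolP.
  by apply: expands2N; exact: (expands2_cauchy hdot gC1 gres _ d0 hd).
case: (pselect (V zeta)) => [h1|h1].
  have /resolvent_setP[T hT] := hres h1 h.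
  by apply: (expands2_resolvent hT) => z'; exact: global_solutionP.
have [d d0 hd] := boundary_far (or_intror h1).
have h2 : (~` V)° zeta by rewrite (interior_id _).1//; exact/closed_openC/V_closed.
apply: (expands2_near (f' := fun z => q z (x - Pc x))).
  have /interiorP[e e0 he] := h2; exists e => // z' /he h3.
  rewrite /global_solution; case: asboolP => [/interior_subset//|_].
  by case: asboolP.
exact: (expands2_cauchy hdot gC1 gres _ d0 hd).
Qed.

Lemma global_solution_decay x (eps : R) : 0 < eps ->
  exists M, forall z, M <= nm z -> nm (global_solution x z) <= eps.
Proof.
move=> e0; have [D D0 hD] := contour_op_bound hdot gC1 gres.
have [M hM] := V_bounded.
pose r := D * nm (x - Pc x) / eps + 1.
have r0 : 0 < r by rewrite ltr_wpDl// divr_ge0 ?mulr_ge0 ?nm_ge0// ltW.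
exists (M + r) => z hz.
have hV : ~ V z by move=> /hM h; move: r0 h hz; lra.
rewrite /global_solution; case: asboolP => [/interior_subset//|_].
case: asboolP => // _.
have hk : contour_continuous g (cauchy_kernel z).
  by apply: (contour_continuous_cauchy gC1); exact: (boundary_neq (or_intror hV)).
apply: (@le_trans _ _ (D * r^-1 * nm (x - Pc x))).
  apply: hD => //; first by rewrite invr_ge0 ltW.
  move=> j t _; have [/hM h _] := curve_boundary j t.
  have h2 : nm z <= nm (z - g j t) + nm (g j t) by exact: nm_split.
  have h3 : r <= nm (z - g j t) by move: h h2 hz; lra.
  rewrite /cauchy_kernel nmV lef_pV2 ?posrE//; exact: lt_le_trans h3.
rewrite mulrAC ler_pdivrMr//.
have -> : eps * r = D * nm (x - Pc x) + eps by rewrite /r; field; rewrite gt_eqF.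
by rewrite lerDl ltW.
Qed.

(** Liouville's theorem shows that the global solution vanishes, hence so does
its datum Pc x - Pc (Pc x). *)
Lemma contour_projection_idempotent x :
  (forall p, A (0, - p) -> p = 0) -> Pc (Pc x) = Pc x.
Proof.
move=> A0; have f0 z : global_solution x z = 0.
  apply: (dot_ext hdot) => y; rewrite dot0l.
  apply: (@liouville R (fun z => ip (global_solution x z) y)) => [z1|eps e0].
    exact/(expands2_ip hdot)/expands2_global_solution.
  have n1 : 0 < nm y + 1 by rewrite ltr_wpDl ?nm_ge0.
  have [M hM] := global_solution_decay x (divr_gt0 e0 n1).
  exists M => z1 /hM h; apply: le_trans (nm_dot hdot _ _) _.
  apply: (@le_trans _ _ (eps / (nm y + 1) * (nm y + 1))).
    by apply: ler_pM; rewrite ?nm_ge0// lerDl.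
  by rewrite divfK// gt_eqF.
have := global_solutionP x 0; rewrite f0 scaler0 sub0r => /A0/eqP.
rewrite subr_eq0 => /eqP h; exact/esym.
Qed.

(** On the kernel of Pc the operator - q z is a left inverse of z - A for z inside
V, with a norm controlled by the distance from z to the curves; compactness of K
keeps this distance away from 0 near K. *)
Lemma kernel_lower_bound (K : set C^o) : compact K -> K `<=` V° ->
  exists (U : set C^o) (M : R), [/\ K `<=` U°, 0 <= M & forall z u v, U z ->
    Pc u = 0 -> A (u, z *: u - v) -> nm u <= M * nm v].
Proof.
move=> cK KV; have [D D0 hD] := contour_op_bound hdot gC1 gres.
have /compact_near_coveringP cpt := cK.
have := cpt R (0^'+) (fun d z => forall z' : C, nm (z' - z) < d -> V° z') _.
move=> [].
  move=> z /KV hz; have : (V°)° z by rewrite (interior_id _).1//;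
    exact: open_interior.
  move=> /interiorP[d d0 hd].
  have d20 : 0 < d / 2 by rewrite divr_gt0.
  exists ([set z1 : C^o | nm (z1 - z : C) < d / 2], [set d' | d' < d / 2]) => /=.
    split; last exact: nbhs_right_lt.
    have : (([set z1 : C^o | nm (z1 - z : C) < d / 2])° : set C^o) z.
      by apply/interiorP; exists (d / 2).
    by [].
  move=> [z1 d'] /= [h1 h2] z' h3; apply: hd.
  have : nm (z' - z) <= nm (z' - z1) + nm (z1 - z).
    by apply: nm_split => //; rewrite opprB addrA subrK.
  move: h1 h2 h3; lra.
move=> d1 /= d10 hd1; pose d := d1 / 2; have d0 : 0 < d by rewrite divr_gt0.
have hd z z' : K z -> nm (z' - z) < d -> V° z'.
  move=> Kz; apply: (hd1 d) => //=.
  by rewrite sub0r normrN gtr0_norm// /d ltr_pdivrMr// ltr_pMr// ltr1n.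
have d20 : 0 < d / 2 by rewrite divr_gt0.
pose U : set C^o := [set z | exists2 k, K k & nm (z - k : C) < d / 2].
exists U, (D * (d / 2)^-1); split.
- move=> k Kk; apply/interiorP; exists (d / 2) => // z' hz'.
  by exists k.
- by rewrite mulr_ge0 ?invr_ge0// ltW.
move=> z u v [k Kk hk] Pu hu.
have Vz : V° z by apply: (hd k) => //;
  rewrite (lt_trans hk)// ltr_pdivrMr// ltr_pMr// ltr1n.
have hz := boundary_neq (or_introl Vz).
have := contour_op_left_inverse hdot gC1 gres hz (winding_in Vz) hu.
rewrite subKr Pu scale1r sub0r => qv.
rewrite -nmN -qv; apply: hD;
  [exact: contour_continuous_cauchy|by rewrite invr_ge0 ltW|].
move=> j t _; have far : d / 2 <= nm (z - g j t).
  rewrite leNgt; apply/negP => h; have [_] := curve_boundary j t; apply.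
  apply: (hd k) => //.
  have : nm (g j t - k) <= nm (z - g j t) + nm (z - k).
    rewrite [X in _ <= X + _]nm_distC; apply: nm_split => //.
    by rewrite opprB addrA subrK.
  by move: h hk; lra.
by rewrite /cauchy_kernel nmV lef_pV2 ?posrE//; exact: lt_le_trans far.
Qed.

End SpectralProjection.

(** * Exponential decay on the kernel of the projection *)

Section Translations.
Context {R : realType}.
Implicit Types f : R -> R.

Lemma continuous_addRr (c : R) f : continuous f -> continuous (fun s => f (s + c)).
Proof.
move=> cf s; apply: (@continuous_comp _ _ _ (fun s => s + c) f); last exact: cf.
by apply: contD; [move=> t; exact: cvg_id|exact: cst_continuous].
Qed.

Lemma continuous_subRl (c : R) f : continuous f -> continuous (fun s => f (c - s)).
Proof.
move=> cf s; apply: (@continuous_comp _ _ _ (fun s => c - s) f); last exact: cf.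
by apply: contD; [exact: cst_continuous|apply: contN => t; exact: cvg_id].
Qed.

Lemma Rint_shift f a b : continuous f -> a <= b ->
  Rint a b f = Rint 0 (b - a) (fun s => f (s + a)).
Proof.
move=> cf ab; have [F dF] := continuous_antiderivative cf.
have cF := is_derive_continuous dF.
have ba : 0 <= b - a by rewrite subr_ge0.
have dG s : is_derive s (1 : R) (fun s => F (s + a)) (f (s + a)).
  have d1 : is_derive s (1 : R) (fun s => s + a) 1.
    by rewrite -[X in is_derive _ _ _ X]addr0; apply: is_deriveD.
  have := @is_derive1_comp _ F (fun s => s + a) s _ _ (dF (s + a)) d1.
  by rewrite mulr1.
rewrite (FTC2 ab cf (fun x _ => dF x) cF).
rewrite (FTC2 ba (continuous_addRr (c := a) cf) (fun x _ => dG x)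
  (continuous_addRr (c := a) cF)).
by rewrite subrK add0r.
Qed.

Lemma Rint_reflect f a t : continuous f -> a <= t ->
  Rint a t (fun s => f (t - s)) = Rint 0 (t - a) f.
Proof.
move=> cf ab; have [F dF] := continuous_antiderivative cf.
have cF := is_derive_continuous dF.
have ta : 0 <= t - a by rewrite subr_ge0.
have dG s : is_derive s (1 : R) (fun s => - F (t - s)) (f (t - s)).
  have d1 : is_derive s (1 : R) (fun s => t - s) (-1).
    by rewrite -[X in is_derive _ _ _ X]add0r; apply: is_deriveD.
  have d2 := @is_derive1_comp _ F (fun s => t - s) s _ _ (dF (t - s)) d1.
  have := is_deriveN d2; by rewrite mulrN1 opprK.
rewrite (FTC2 ta cf (fun x _ => dF x) cF).
rewrite (FTC2 ab (continuous_subRl (c := t) cf) (fun x _ => dG x)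
  (contN (continuous_subRl (c := t) cF))).
by rewrite subrr opprK addrC.
Qed.

End Translations.

Section EnergyEstimates.
Context {R : realType} {H : completeNormedModType R[i]}.
Variables (dot : {dot H for Num.conj}) (hdot : norm_of_dot dot).
Local Notation C := R[i].
Local Notation Re := complex.Re.
Variables (S : R -> {linear H -> H}) (hS : C0_semigroup S).
Local Notation A := (generator S).
Variables (m : R -> R).
Hypothesis hm_cont : {within `[0, +oo[, continuous m}.
Hypothesis hm_pos : forall t, 0 <= t -> 0 < m t.
Hypothesis hm_bound : forall t, 0 <= t -> (opnorm (S t) <= (m t)%:E)%E.
Local Notation mc := (mc m).
Local Notation weight := (weight m).
Local Notation energy := (energy S).
Variables (z0 : C) (T0 : {linear H -> H}) (hT0 : is_resolvent A z0 T0).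
Variables (Q : {linear H -> H}) (cQ : continuous Q)
  (QS : forall t z, 0 <= t -> Q (S t z) = S t (Q z)).
Variables (w' : R) (C1 : R) (C10 : 0 <= C1).

Definition bounded_below (w c : R) := forall (z : C) u v, Re z = w -> Q u = 0 ->
  A (u, z *: u - v) -> nm u <= c * nm v.

Lemma lbm_energy w y : lbm (energy w y).
Proof. exact/continuous_lbm/energy_cont. Qed.

Lemma energy_shift w y tau s : 0 <= tau -> 0 <= s ->
  energy w y (s + tau) = expR (- (2 * w * tau)) * energy w (S tau y) s.
Proof.
move=> t0 s0; rewrite /energy addrC orbD// orbE// [in RHS]orbE//.
rewrite S_commute// mulrA -expRD; congr (expR _ * _); ring.
Qed.

Lemma Rint_energy_shift w y tau T : 0 <= tau -> tau <= T ->
  Rint tau T (energy w y) = expR (- (2 * w * tau)) * Rint 0 (T - tau)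
    (energy w (S tau y)).
Proof.
move=> t0 tT; rewrite Rint_shift//; last exact: energy_cont.
rewrite -RintZ; last exact: lbm_energy.
by apply: eq_Rint => s /andP[s0 _]; exact: energy_shift.
Qed.

Lemma Rint_energy_mono w y a b c d : 0 <= a -> a <= b -> b <= c -> c <= d ->
  Rint b c (energy w y) <= Rint a d (energy w y).
Proof.
move=> a0 ab bc cd; have l := lbm_energy w y.
rewrite (Rint_cat l ab (le_trans bc cd)) (Rint_cat l bc cd) addrCA lerDl.
by rewrite addr_ge0// Rint_ge0// => s _; exact: energy_ge0.
Qed.

Definition energy_bounded_by (D w : R) := forall y, Q y = 0 ->
  forall T, 0 <= T -> Rint 0 T (energy w y) <= D * nm y ^+ 2.

(** The descent of the cutoff costs the energy of an interval of length 1. When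
the total energy is finite, this interval can be chosen far away with an
arbitrarily small cost. *)
Lemma energy_tail w c y : bounded_below w c -> 0 <= c -> Q y = 0 ->
  (exists B, forall T, 0 <= T -> Rint 0 T (energy w y) <= B) ->
  forall a T, 0 < a -> a <= T ->
    Rint a T (energy w y) <= c ^+ 2 * (nm y ^+ 2 / Rint 0 a (weight w)).
Proof.
move=> hb c0 Qy [B hB] a T a0 aT.
have T0' : 0 <= T by exact: le_trans (ltW a0) aT.
have small e : 0 < e -> exists2 b, T <= b & Rint b (b + 1) (energy w y) < e.
  move=> e0; apply: contrapT => hn.
  have hge (k : nat) : e <= Rint (T + k%:R) (T + k%:R + 1) (energy w y).
    rewrite leNgt; apply/negP => h; apply: hn.
    by exists (T + k%:R); rewrite ?lerDl.
  have hsum (k : nat) : k%:R * e <= Rint T (T + k%:R) (energy w y).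
    elim: k => [|k IH].
      by rewrite mul0r Rint_ge0// => s _; exact: energy_ge0.
    rewrite (@Rint_cat _ _ (T + k%:R)); [|exact: lbm_energy|by rewrite lerDl|].
      by rewrite -addn1 natrD mulrDl mul1r addrA lerD.
    by rewrite lerD2l ler_nat.
  pose k := (Num.truncn (B / e)).+1.
  have : B / e < k%:R by exact: truncnS_gt.
  rewrite ltr_pdivrMr// ltNge => /negP; apply.
  apply: le_trans (hsum k) _.
  apply: le_trans (hB (T + k%:R) _); last by rewrite addr_ge0.
  by apply: Rint_energy_mono => //; rewrite lerDl.
apply/ler_addgt0Pr => e e0.
have e1 : 0 < e / (c ^+ 2 + 1) by rewrite divr_gt0// ltr_wpDl// sqr_ge0.
have [b Tb hb1] := small _ e1.
have := cutoff_estimate hdot hS hm_cont hm_pos hm_bound hT0 cQ QS Qy c0 hb a0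
  (le_trans aT Tb).
move=> h; apply: (@le_trans _ _ (Rint a b (energy w y))).
  by apply: Rint_energy_mono => //; exact: ltW.
apply: (le_trans h); rewrite mulrDr lerD2l.
apply: (@le_trans _ _ ((c ^+ 2 + 1) * (e / (c ^+ 2 + 1)))).
  by apply: ler_pM; rewrite ?sqr_ge0 ?lerDl ?(ltW hb1)// Rint_ge0// => s _;
    exact: energy_ge0.
by rewrite mulrC divfK// gt_eqF// ltr_wpDl// sqr_ge0.
Qed.

(** The bound does not depend on w in a bounded range: this is what lets the
induction on w proceed by steps of a fixed length. *)
Lemma uniform_energy_bound (Om : R) : exists2 D, 0 < D & forall w c,
  `|w| <= Om -> 0 <= c -> c <= C1 -> bounded_below w c ->
  (forall y, Q y = 0 -> exists B, forall T, 0 <= T -> Rint 0 T (energy w y) <= B) ->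
  energy_bounded_by D w.
Proof.
have [M hM] : exists M, forall s, 0 <= s <= 1 -> mc s <= M.
  have [_ /(_ 0 1)[M hM]] := continuous_lbm (mc_cont hm_cont).
  by exists M => s /hM; apply: le_trans; exact: ler_norm.
have M0 : 0 < M.
  by apply: lt_le_trans (mc_gt0 hm_pos 0) (hM 0 _); rewrite lexx ler01.
pose E := expR (2 * Om).
have E0 : 0 < E by exact: expR_gt0.
exists ((1 + C1 ^+ 2) * (E * M ^+ 2)).
  by rewrite !mulr_gt0 ?exprn_gt0// ltr_pwDl// sqr_ge0.
move=> w c hw c0 cC hb hq y Qy T T0'.
have Om0 : 0 <= Om by exact: le_trans (normr_ge0 _) hw.
have EE s : 0 <= s <= 1 -> expR (- (2 * w * s)) <= E.
  move=> /andP[s0 s1]; rewrite ler_expR.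
  have : - w * s <= Om * 1.
    apply: (@le_trans _ _ (`|w| * s));
      first by rewrite ler_wpM2r// -normrN ler_norm.
    by apply: ler_pM.
  lra.
have EE' s : 0 <= s <= 1 -> E^-1 <= expR (2 * w * s).
  move=> hs; rewrite -[leRHS]invrK -expRN lef_pV2 ?posrE ?expR_gt0//; exact: EE.
have n0 := sqr_ge0 (nm y).
have I1 : Rint 0 1 (energy w y) <= E * M ^+ 2 * nm y ^+ 2.
  rewrite -[leRHS]mulr1 -[X in _ <= _ * X](subr0 1); apply: Rint_le_cst => //;
    first exact: lbm_energy.
  move=> s hs; rewrite /energy -(mulrA E); apply: ler_pM;
    rewrite ?expR_ge0 ?sqr_ge0 ?EE//.
  rewrite -exprMn ler_pXn2r ?nnegrE ?nm_ge0 ?mulr_ge0 ?(ltW M0) ?nm_ge0//.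
  apply: le_trans (nm_orb hm_bound _ _) _.
  by rewrite ler_wpM2r ?nm_ge0// hM.
have W1 : (E * M ^+ 2)^-1 <= Rint 0 1 (weight w).
  rewrite -[leLHS]mulr1 -[X in _ * X <= _](subr0 1) -Rint_cst//; apply: le_Rint.
  - exact: lbm_cst.
  - exact/continuous_lbm/weight_cont.
  - move=> s hs; rewrite invfM /weight; apply: ler_pM;
      rewrite ?invr_ge0 ?sqr_ge0 ?(ltW E0) ?EE'//.
    rewrite exprVn lef_pV2 ?posrE ?exprn_gt0 ?(mc_gt0 hm_pos)//.
    by rewrite ler_pXn2r ?nnegrE ?(ltW M0) ?(ltW (mc_gt0 hm_pos _)) ?hM.
have EM0 : 0 < E * M ^+ 2 by rewrite mulr_gt0// exprn_gt0.
have C20 : 0 <= C1 ^+ 2 by exact: sqr_ge0.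
have [T1|T1] := leP T 1.
  apply: (@le_trans _ _ (E * M ^+ 2 * nm y ^+ 2)).
    by apply: le_trans I1; apply: Rint_energy_mono.
  rewrite -(mulrA (1 + C1 ^+ 2)); apply: ler_peMl; last by rewrite lerDl.
  by rewrite mulr_ge0// ltW.
rewrite (Rint_cat (lbm_energy w y) ler01 (ltW T1)) !mulrDl mul1r lerD//.
apply: le_trans (energy_tail hb c0 Qy (hq y Qy) ltr01 (ltW T1)) _.
rewrite -[leRHS]mulrA; apply: ler_pM; rewrite ?sqr_ge0//.
- by rewrite divr_ge0// ltW// (Rint_weight_gt0 hm_cont hm_pos).
- by rewrite ler_pXn2r ?nnegrE.
rewrite mulrC ler_wpM2r// -[leRHS]invrK lef_pV2 ?posrE ?invr_gt0//.
exact: (Rint_weight_gt0 hm_cont hm_pos).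
Qed.

(** Datko's argument: the energy left after time s is at most D times its density
at s. Integrating the derivative of exp (2 (w - w1) s) times this remainder bounds
the energy for w1 by D * nm y ^ 2 plus at most half of itself. *)
Lemma energy_bound_improves D w w1 : 0 < D -> energy_bounded_by D w ->
  w1 <= w -> 4 * D * (w - w1) <= 1 -> energy_bounded_by (2 * D) w1.
Proof.
move=> D0 hD ww hstep y Qy T T0'; set dl := w - w1.
have dl0 : 0 <= dl by rewrite subr_ge0.
have cG := energy_cont hS (w := w) (x := y).
have [F dF] := continuous_antiderivative cG.
have cF := is_derive_continuous dF.
pose E s := expR (2 * dl * s); have cE : continuous E by exact: expR_lin_cont.
pose h s := F T - F s.
have ch : continuous h by apply: contD; [exact: cst_continuous|exact: contN].
have EG s : E s * energy w y s = energy w1 y s.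
  by rewrite /E /energy mulrA -expRD /dl; congr (expR _ * _); ring.
have hle s : 0 <= s <= T -> h s <= D * energy w y s.
  move=> /andP[s0 sT]; rewrite /h -(FTC2 sT cG (fun x _ => dF x) cF).
  rewrite Rint_energy_shift// /energy (orbE _ _ s0) mulrCA ler_wpM2l ?expR_ge0//.
  by apply: hD; [rewrite QS// Qy linear0|rewrite subr_ge0].
have dEh s : is_derive s (1 : R) (fun s => E s * h s)
    (2 * dl * (E s * h s) - energy w1 y s).
  have d1 : is_derive s (1 : R) E (2 * dl * E s).
    by rewrite /E; apply: is_derive_eq; rewrite /GRing.scale/=; ring.
  have d2 : is_derive s (1 : R) h (- energy w y s).
    have := dF s => d; rewrite -[- _]add0r; apply: is_deriveB.
  rewrite -EG; apply: (is_derive_eq (is_deriveM d1 d2)).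
  rewrite /GRing.scale/=; ring.
have cEh : continuous (fun s => E s * h s) by exact: contM.
have lEh := continuous_lbm cEh.
have lE1 := lbm_energy w1 y.
have cd : continuous (fun s => 2 * dl * (E s * h s) - energy w1 y s).
  apply: contD; first by apply: contM => //; exact: cst_continuous.
  by apply: contN; exact: energy_cont.
have := FTC2 T0' cd (fun x _ => dEh x) cEh.
rewrite RintB//; last by apply: lbmM => //; exact: lbm_cst.
rewrite RintZ// /h subrr mulr0 sub0r {2}/E mulr0 expR0 mul1r => key.
have h0 : F T - F 0 <= D * nm y ^+ 2.
  by rewrite -(FTC2 T0' cG (fun x _ => dF x) cF); exact: hD.
have J : Rint 0 T (fun s => E s * h s) <= D * Rint 0 T (energy w1 y).
  rewrite -RintZ//; apply: le_Rint => //; first by apply: lbmM => //;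
    exact: lbm_cst.
  move=> s hs; rewrite -EG mulrCA ler_wpM2l ?expR_ge0//; exact: hle.
have J0 : 0 <= Rint 0 T (energy w1 y) by apply: Rint_ge0 => s _; exact: energy_ge0.
move: key h0 J J0 hstep; rewrite -/dl /h.
move: (Rint 0 T (energy w1 y)) (Rint 0 T (fun s => E s * (F T - F s))) (F T - F 0)
  => a b f key h0 J J0 hstep.
have k1 : 2 * dl * b <= 2 * dl * (D * a) by rewrite ler_wpM2l// mulr_ge0.
have k2 : 4 * D * dl * a <= 1 * a by rewrite ler_wpM2r.
move: k1 k2 key h0; lra.
Qed.

(** Passing from y to S 1 y multiplies the energy by at most exp (- 2 w) * M ^ 2.
For large w this is at most 1 / 2, and a geometric series bounds the energy. *)
Lemma energy_bound_start (w2 : R) : exists2 w, w2 <= w & forall y, Q y = 0 ->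
  exists B, forall T, 0 <= T -> Rint 0 T (energy w y) <= B.
Proof.
have [M hM] : exists M, forall s, 0 <= s <= 1 -> mc s <= M.
  have [_ /(_ 0 1)[M hM]] := continuous_lbm (mc_cont hm_cont).
  by exists M => s /hM; apply: le_trans; exact: ler_norm.
have M0 : 0 < M.
  by apply: lt_le_trans (mc_gt0 hm_pos 0) (hM 0 _); rewrite lexx ler01.
pose w := Num.max w2 (M ^+ 2).
have wM : M ^+ 2 <= w by rewrite le_max lexx orbT.
have w0 : 0 <= w by exact: le_trans (sqr_ge0 _) wM.
exists w; first by rewrite le_max lexx.
have q : expR (- (2 * w * 1)) * M ^+ 2 <= 2^-1.
  rewrite expRN mulrC mulr1 ler_pdivrMr ?expR_gt0//.
  have := expR_ge1Dx (2 * w); lra.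
have I1 y : Rint 0 1 (energy w y) <= M ^+ 2 * nm y ^+ 2.
  rewrite -[leRHS]mulr1 -[X in _ <= _ * X](subr0 1); apply: Rint_le_cst => //;
    first exact: lbm_energy.
  move=> s hs; rewrite /energy -[leRHS]mul1r; apply: ler_pM;
    rewrite ?expR_ge0 ?sqr_ge0//.
    by rewrite -expR0 ler_expR oppr_le0 !mulr_ge0//; case/andP: hs.
  rewrite -exprMn ler_pXn2r ?nnegrE ?nm_ge0 ?mulr_ge0 ?(ltW M0) ?nm_ge0//.
  apply: le_trans (nm_orb hm_bound _ _) _.
  by rewrite ler_wpM2r ?nm_ge0// hM.
have In (k : nat) y : Rint 0 k%:R (energy w y) <= 2 * M ^+ 2 * nm y ^+ 2.
  elim: k y => [|k IH] y.
    rewrite /Rint set_itv1 Rintegral_set1.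
    by apply: mulr_ge0; [apply: mulr_ge0 => //; exact: sqr_ge0|exact: sqr_ge0].
  have k1 : (1 : R) <= k.+1%:R by rewrite ler1n.
  rewrite (Rint_cat (lbm_energy w y) ler01 k1) (@Rint_energy_shift w y 1)//.
  have -> : k.+1%:R - 1 = k%:R :> R by rewrite -addn1 natrD addrK.
  have a1 : nm (S 1 y) ^+ 2 <= M ^+ 2 * nm y ^+ 2.
    rewrite -exprMn ler_pXn2r ?nnegrE ?nm_ge0 ?mulr_ge0 ?(ltW M0) ?nm_ge0//.
    apply: le_trans (nm_S hm_bound _ ler01) _.
    by rewrite ler_wpM2r ?nm_ge0// hM// lexx ler01.
  have a2 : Rint 0 k%:R (energy w (S 1 y)) <= 2 * M ^+ 2 * (M ^+ 2 * nm y ^+ 2).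
    by apply: le_trans (IH _) _; apply: ler_wpM2l => //; apply: mulr_ge0 => //;
      exact: sqr_ge0.
  have a3 := ler_wpM2l (expR_ge0 (- (2 * w * 1))) a2.
  have a4 : expR (- (2 * w * 1)) * M ^+ 2 * (2 * M ^+ 2 * nm y ^+ 2) <=
      2^-1 * (2 * M ^+ 2 * nm y ^+ 2).
    apply: ler_wpM2r => //.
    by apply: mulr_ge0; [apply: mulr_ge0 => //; exact: sqr_ge0|exact: sqr_ge0].
  have := I1 y; move: a3 a4; lra.
move=> y Qy; exists (2 * M ^+ 2 * nm y ^+ 2) => T T0'.
pose k := (Num.truncn T).+1.
have Tk : T < k%:R by exact: truncnS_gt.
by apply: le_trans (In k y); apply: Rint_energy_mono => //; exact: ltW.
Qed.

(** The exponent goes down from a large value to w' by steps of length 1 / (4 D).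
At each step Datko's argument provides finiteness at the new exponent, and then
the cutoff estimate restores the constant D. *)
Lemma energy_bounded_down : (forall w, w' <= w -> bounded_below w C1) ->
  forall y, Q y = 0 -> exists B, forall T, 0 <= T -> Rint 0 T (energy w' y) <= B.
Proof.
move=> hb; have [w1 ww1 hq1] := energy_bound_start w'.
pose Om := Num.max `|w'| `|w1|.
have [D D0 hD] := uniform_energy_bound Om.
pose e := (4 * D)^-1; have e0 : 0 < e by rewrite invr_gt0 mulr_gt0.
pose wn (k : nat) := Num.max w' (w1 - k%:R * e).
have wnOm k : `|wn k| <= Om.
  have h1 : w' <= wn k by rewrite le_max lexx.
  have h2 : wn k <= w1.
    by rewrite ge_max ww1/= gerBl mulr_ge0// ltW.
  rewrite ler_norml; apply/andP; split.
    apply: le_trans h1; rewrite lerNl (@le_trans _ _ `|w'|)//.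
      by rewrite -normrN ler_norm.
    by rewrite le_max lexx.
  apply: le_trans h2 _; rewrite (le_trans (ler_norm _))//.
  by rewrite le_max lexx orbT.
have hn k : energy_bounded_by D (wn k).
  elim: k => [|k IH].
    apply: (hD _ C1) => //; first by apply: hb; rewrite le_max lexx.
    rewrite /wn mul0r subr0 (_ : Num.max w' w1 = w1)//; exact: max_r.
  apply: (hD _ C1) => //; first by apply: hb; rewrite le_max lexx.
  move=> y Qy; exists (2 * D * nm y ^+ 2).
  apply: (energy_bound_improves D0 IH) => //.
    by rewrite /wn ge_max !le_max lexx/= lerD2l lerN2 ler_wpM2r ?ler_nat ?orbT//
      ltW.
  have : wn k - wn k.+1 <= e.
    rewrite lerBlDl /wn ge_max; apply/andP; split.
      by rewrite -[leLHS]addr0 lerD ?(ltW e0)// le_max lexx.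
    rewrite -[leLHS](subrK e) addrC [leRHS]addrC lerD2l le_max; apply/orP; right.
    by rewrite -addn1 natrD mulrDl mul1r opprD addrA.
  move=> he; apply: (@le_trans _ _ (4 * D * e)).
    by apply: ler_wpM2l => //; rewrite mulr_ge0// ltW.
  by rewrite /e mulfV// gt_eqF// mulr_gt0.
have [k hk] : exists k : nat, w1 - k%:R * e <= w'.
  exists (Num.truncn ((w1 - w') / e)).+1.
  have := truncnS_gt ((w1 - w') / e); rewrite ltr_pdivrMr//; lra.
move=> y Qy; exists (D * nm y ^+ 2) => T T0'.
have := hn k y Qy T T0'; rewrite /wn max_l//.
Qed.

End EnergyEstimates.

(** * The semigroup bound *)

Section DecayEstimate.
Context {R : realType} {H : completeNormedModType R[i]}.
Variables (S : R -> {linear H -> H}) (hS : C0_semigroup S).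
Local Notation A := (generator S).
Local Notation orb := (orb S).
Variables (m : R -> R).
Hypothesis hm_cont : {within `[0, +oo[, continuous m}.
Hypothesis hm_pos : forall t, 0 <= t -> 0 < m t.
Hypothesis hm_bound : forall t, 0 <= t -> (opnorm (S t) <= (m t)%:E)%E.
Local Notation mc := (mc m).
Local Notation weight := (weight m).
Local Notation energy := (energy S).

Lemma generator0 p : A (0, - p) -> p = 0.
Proof.
move=> /generatorP h; apply: nm_eq0; apply/eqP; rewrite eq_le nm_ge0 andbT.
apply/ler_addgt0Pr => e e0; rewrite add0r; have [d d0 hd] := h e e0.
have d20 : 0 < d / 2 by rewrite divr_gt0.
have := hd (d / 2) d20; rewrite linear0 subrr scaler0 sub0r opprK.
by rewrite ltr_pdivrMr// ltr_pMr// ltr1n => /(_ isT)/ltW.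
Qed.

(** Since S(t) y = S(t - s) (S(s) y), the energy at each time s before t bounds
the value at time t. *)
Lemma energy_lower_bound w y a t : 0 <= a -> a <= t ->
  nm (S t y) ^+ 2 * expR (- (2 * w * t)) * Rint 0 (t - a) (weight w) <=
  Rint a t (energy w y).
Proof.
move=> a0 at_; have t0 := le_trans a0 at_.
have cw := weight_cont hm_cont hm_pos (w := w).
rewrite -(Rint_reflect cw at_) -RintZ; last exact/continuous_lbm/continuous_subRl.
apply: le_Rint.
- by apply: lbmM; [exact: lbm_cst|exact/continuous_lbm/continuous_subRl].
- exact: lbm_energy.
move=> s /andP[as_ st]; have s0 := le_trans a0 as_.
have ts0 : 0 <= t - s by rewrite subr_ge0.
have h1 : nm (S t y) <= mc (t - s) * nm (orb y s).
  rewrite orbE// -{1}(subrK s t); case: hS => _ _ -> // _.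
  exact: (nm_S hm_bound).
have mp := mc_gt0 hm_pos (t - s).
have h2 : nm (S t y) ^+ 2 / mc (t - s) ^+ 2 <= nm (orb y s) ^+ 2.
  rewrite ler_pdivrMr ?exprn_gt0// -exprMn mulrC ler_pXn2r ?nnegrE ?nm_ge0//.
  by rewrite mulr_ge0 ?nm_ge0// ltW.
rewrite /weight /energy.
have -> : nm (S t y) ^+ 2 * expR (- (2 * w * t)) *
    (expR (2 * w * (t - s)) * (mc (t - s))^-1 ^+ 2) =
    expR (- (2 * w * s)) * (nm (S t y) ^+ 2 / mc (t - s) ^+ 2).
  have -> : expR (- (2 * w * s)) = expR (- (2 * w * t)) * expR (2 * w * (t - s)).
    by rewrite -expRD; congr expR; ring.
  by field; rewrite gt_eqF.
by apply: ler_wpM2l => //; exact: expR_ge0.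
Qed.

Lemma weighted_L2norm_weight w b : 0 <= b ->
  weighted_L2norm w b (fun s => (m s)^-1) = Num.sqrt (Rint 0 b (weight w)).
Proof.
move=> b0; congr Num.sqrt; apply: eq_Rint => s /andP[s0 _].
rewrite /weight mcE// ger0_norm// invr_ge0 ltW//; exact: hm_pos.
Qed.

End DecayEstimate.

Theorem theorem1p6 (R : realType) (H : completeNormedModType R[i])
    (dot : {dot H for Num.conj}) (hdot : norm_of_dot dot)
    (S : R -> {linear H -> H}) (hS : C0_semigroup S)
    (A : set (H * H)) (hA : A = generator S)
    (w : R)
    (hw : resolvent_bounded_on A [set z : R[i]^o | w <= complex.Re z])
    (m : R -> R)
    (hm_cont : {within `[0, +oo[, continuous m})
    (hm_pos : forall t, 0 <= t -> 0 < m t)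
    (hm_bound : forall t, 0 <= t -> (opnorm (S t) <= (m t)%:E)%E)
    (w' : R) (hw'w : w' < w)
    (hline : forall z : R[i]^o, complex.Re z = w' -> ~ spectrum A z)
    (K : set R[i]^o)
    (hK : K = [set z : R[i]^o | spectrum A z /\ w' < complex.Re z])
    (hK_compact : compact K)
    (hU : forall U : set R[i]^o, K `<=` U° ->
      resolvent_bounded_on A ([set z : R[i]^o | w' <= complex.Re z] `\` U))
    (r : R)
    (hr : (r^-1)%:E = ereal_sup [set opnorm (resolvent A z) |
                                  z in [set z : R[i]^o | complex.Re z = w']])
    (P : {linear H -> H}) (hP : spectral_projection dot A K P)
    (t : R) (ht : 0 < t) :
  (forall x, S t x = S t (P x) + S t (x - P x)) /\
  (forall a a' : R, 0 < a -> 0 < a' -> a + a' = t ->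
     (opnorm (fun x => S t (x - P x)%R) <=
      (expR (w' * t) /
         (r * weighted_L2norm w' a (fun s => (m s)^-1)
            * weighted_L2norm w' a' (fun s => (m s)^-1)))%:E
      * opnorm (fun x => (x - P x)%R))%E).
Proof.
split=> [x|a a' a0 a'0 aa']; first by rewrite -linearD addrC subrK.
subst A.
have res_bound z M u v : resolvent_set (generator S) z ->
    (opnorm (resolvent (generator S) z) <= M%:E)%E ->
    (generator S) (u, z *: u - v) -> nm u <= M * nm v.
  move=> /resolvent_setP[T hT]; rewrite (resolventE hT) => /opnorm_bounded hM hu.
  by rewrite -[u](hT.2 u v).2//; exact: hM.
(* The half-plane Re z >= w provides one point of the resolvent set. *)
have [z0 [T0 hT0]] : exists z0 T0, is_resolvent (generator S) z0 T0.
  have [M hM] := hw; have [|/resolvent_setP[T hT] _] := hM w%:C; first exact: lexx.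
  by exists w%:C, T.
have [cP [V [n [g [cV KV VK bV hPg]]]]] := hP.
have hres z : V z -> ~ V° z -> resolvent_set (generator S) z.
  move=> Vz nVz; apply: contrapT => hz; apply: nVz; apply: KV.
  apply: contrapT => nK.
  have : (V `&` (spectrum (generator S) `\` K)) z by [].
  by rewrite VK.
have gC1 := curve_C1 bV; have gres := curve_res cV bV hres.
have PE x : P x = contour_op dot (generator S) g (fun=> 1) x.
  apply: (dot_ext hdot) => y; rewrite (contour_opE hdot gC1 gres)//;
    last exact: contour_continuous1.
  rewrite /ip hPg /cauchy_pairing; congr (_ * contour_integral _ _).
  by apply/funext => z; rewrite mul1r.
have PP x : P (P x) = P x.
  rewrite !PE; apply: (contour_projection_idempotent hdot hT0 cV bV hres).
  exact: generator0.
have PS s z : 0 <= s -> P (S s z) = S s (P z).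
  move=> s0; rewrite !PE; apply/esym.
  apply: (contour_op_commute hdot gC1 gres); first exact: contour_continuous1.
  exact: S_commutes.
have [U [M [KU M0 hUM]]] := kernel_lower_bound hdot cV bV hres hK_compact KV.
have [M' hM'] := hU U KU.
pose C1 := Num.max M `|M'|.
have C10 : 0 <= C1 by rewrite le_max M0.
(* Away from K the resolvent is bounded by hypothesis; near K, where z may belong
   to the spectrum, the contour operator takes its place. *)
have hb w1 : w' <= w1 -> bounded_below S P w1 C1.
  move=> hw1 z u v Rez Pu hu; have [Uz|nUz] := pselect (U z).
    apply: (@le_trans _ _ (M * nm v)); first by apply: (hUM z) => //; rewrite -PE.
    by rewrite ler_wpM2r ?nm_ge0// le_max lexx.
  have [|hz1 hz2] := hM' z; first by split => //=; rewrite Rez.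
  apply: (@le_trans _ _ (M' * nm v)); first exact: (res_bound z).
  by rewrite ler_wpM2r ?nm_ge0// le_max (ler_norm M') orbT.
have r0 : 0 <= r^-1.
  rewrite -lee_fin hr; apply: (@le_trans _ _ (opnorm (resolvent (generator S)
    w'%:C))).
    have /contrapT/resolvent_setP[T hT] : ~ ~ resolvent_set (generator S) w'%:C.
      by apply: hline.
    rewrite (resolventE hT); apply: ereal_sup_ubound; exists 0;
      rewrite /= ?normr0//.
    by rewrite linear0 normr0.
  by apply: ereal_sup_ubound; exists w'%:C.
(* On the line Re z = w' itself the constant is the sharp one. *)
have hbr : bounded_below S P w' r^-1.
  move=> z u v Rez _ hu; have /contrapT hz := hline z Rez.
  apply: (res_bound z) => //; rewrite hr; apply: ereal_sup_ubound.
  by exists z.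
have decay y : P y = 0 -> nm (S t y) <= expR (w' * t) /
    (r * weighted_L2norm w' a (fun s => (m s)^-1)
       * weighted_L2norm w' a' (fun s => (m s)^-1)) * nm y.
  move=> Py; have at_ : a <= t by rewrite -aa' lerDl ltW.
  have := energy_tail hdot hS hm_cont hm_pos hm_bound hT0 cP PS hbr r0 Py
    (energy_bounded_down hdot hS hm_cont hm_pos hm_bound hT0 cP PS C10 hb Py) a0
      at_.
  have := energy_lower_bound hS hm_cont hm_pos hm_bound w' y (ltW a0) at_.
  have -> : t - a = a' by rewrite -aa' addrAC subrr add0r.
  rewrite !(weighted_L2norm_weight hm_pos) ?(ltW a0) ?(ltW a'0)//.
  have := Rint_weight_gt0 hm_cont hm_pos w' a0.
  have := Rint_weight_gt0 hm_cont hm_pos w' a'0.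
  move: (Rint 0 a _) (Rint 0 a' _) => I I' I'0 I0 h1 h2.
  have := le_trans h1 h2.
  set N := nm (S t y); set Y := nm y => h.
  have N0 : 0 <= N by exact: nm_ge0.
  have Y0 : 0 <= Y by exact: nm_ge0.
  have E0 := expR_gt0 (w' * t).
  rewrite -(@ler_pXn2r _ 2)// ?nnegrE//; last first.
    by rewrite !mulr_ge0 ?(ltW E0)// !invfM !mulr_ge0// invr_ge0 sqrtr_ge0.
  rewrite !invfM !exprMn !exprVn !sqr_sqrtr ?(ltW I0) ?(ltW I'0)//.
  have E2 : expR (- (2 * w' * t)) = (expR (w' * t) ^+ 2)^-1.
    by rewrite expRN expr2 -expRD; congr (expR _)^-1; ring.
  move: h; rewrite E2 -ler_pdivlMr// -ler_pdivlMr ?invr_gt0 ?exprn_gt0// invrK.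
  move/le_trans; apply; rewrite le_eqVlt; apply/orP; left; apply/eqP.
  rewrite -exprVn; ring.
have eq_nm_opnorm : forall (F : H -> H) x, `|x| <= 1 ->
  ((nm (F x))%:E <= opnorm F)%E.
  by move=> F x hx; apply: ereal_sup_ubound; exists x.
apply: ge_ereal_sup => _ [x /= hx <-].
set c := expR (w' * t) / _ in decay *.
apply: (@le_trans _ _ ((c * nm (x - P x))%:E)).
  by rewrite lee_fin; apply: decay; rewrite linearB PP subrr.
have c0 : 0 <= c.
  by rewrite /c mulr_ge0 ?expR_ge0// !invfM !mulr_ge0// invr_ge0 /weighted_L2norm
    sqrtr_ge0.
by rewrite EFinM; apply: lee_wpmul2l => //;
  exact: (eq_nm_opnorm (fun x => x - P x)).
Qed.
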